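(* The reduced discrete problem (R) admits at least one solution $(\mathbf u_h,T_h)\in\mathbf W_h\times S_h^0$.
   Context: Let $d\in\{2,3\}$, $\Omega\subset\mathbb R^d$ a polygonal/polyhedral domain, $\Omega_f\subset\Omega$ a polygonal/polyhedral subdomain, $\Omega_s=\Omega\setminus\Omega_f$. Let $\mathcal T_h^f,\mathcal T_h^s$ be shape-regular simplicial triangulations of $\Omega_f,\Omega_s$ with $\mathcal T_h=\mathcal T_h^f\cup\mathcal T_h^s$ a shape-regular simplicial triangulation of $\Omega$; $\varepsilon_h^f,\varepsilon_h$ the sets of edges/faces of elements of $\mathcal T_h^f,\mathcal T_h$. $h_K=\mathrm{diam}\,K$, $\mathbf n_K$ outward unit normal, $\tau|_{\partial K}=h_K^{-1}$. $P_j(D)$: polynomials of degree $\le j$. $Q_j^b$: $L^2(e)$-projection onto $P_j(e)$ (componentwise: $\mathbf Q_j^b$). $(\cdot,\cdot)_{\mathcal T}=\sum_{K\in\mathcal T}(\cdot,\cdot)_K$, $\langle\cdot,\cdot\rangle_{\partial\mathcal T}=\sum_{K\in\mathcal T}\langle\cdot,\cdot\rangle_{\partial K}$. Weak gradient: $\nabla_{w,r}v|_K\in[P_r(K)]^d$, $(\nabla_{w,r}v,\boldsymbol\tau)_K=-(v_0,\nabla\cdot\boldsymbol\tau)_K+\langle v_b,\boldsymbol\tau\cdot\mathbf n_K\rangle_{\partial K}$ for all $\boldsymbol\tau\in[P_r(K)]^d$ (row by row for vector pairs). Weak divergence: $\nabla_{w,r}\cdot\mathbf v|_K\in P_r(K)$,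 $(\nabla_{w,r}\cdot\mathbf v,\varphi)_K=-(\mathbf v_0,\nabla\varphi)_K+\langle\mathbf v_b\cdot\mathbf n_K,\varphi\rangle_{\partial K}$ for all $\varphi\in P_r(K)$ (row by row for matrix pairs). Products of pairs componentwise: $\mathbf u\otimes\mathbf w=\{\mathbf u_0\otimes\mathbf w_0,\mathbf u_b\otimes\mathbf w_b\}$, $\mathbf us=\{\mathbf u_0s_0,\mathbf u_bs_b\}$. Fix integers $k\ge1$, $l\in\{k-1,k\}$, $m$ with $k-1\le m\le l$. $\mathbf V_h^0=\{\mathbf v=\{\mathbf v_0,\mathbf v_b\}:\mathbf v_0|_K\in[P_k(K)]^d\,\forall K\in\mathcal T_h^f,\ \mathbf v_b|_e\in[P_l(e)]^d\,\forall e\in\varepsilon_h^f,\ \mathbf v_b=0\text{ on }\partial\Omega_f\}$ (extended by zero to $\Omega_s$ in forms over $\mathcal T_h$); $Q_h^0=\{q=\{q_0,q_b\}:q_0|_K\in P_{k-1}(K)\,\forall K\in\mathcal T_h^f,\ q_b|_e\in P_k(e)\,\forall e\in\varepsilon_h^f,\ \int_{\Omega_f}q_0=0\}$; $S_h^0=\{s=\{s_0,s_b\}:s_0|_K\in P_k(K)\,\forall K\in\mathcal T_h,\ s_b|_e\in P_l(e)\,\forall e\in\varepsilon_h,\ s_b=0\text{ on }\partial\Omega\}$. $\mathrm{Pr},\kappa,Ra>0$, $\mathbf j=(0,1)^T$ or $(0,0,1)^T$, $\mathbf f\in[L^2(\Omega_f)]^d$, $g\in L^2(\Omega)$. Forms: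 $a_h(\mathbf u,\mathbf v)=\mathrm{Pr}(\nabla_{w,m}\mathbf u,\nabla_{w,m}\mathbf v)_{\mathcal T_h^f}+\mathrm{Pr}\langle\tau(\mathbf Q_l^b\mathbf u_0-\mathbf u_b),\mathbf Q_l^b\mathbf v_0-\mathbf v_b\rangle_{\partial\mathcal T_h^f}$; $b_h(\mathbf v,q)=(\nabla_{w,k}q,\mathbf v_0)_{\mathcal T_h^f}$; $d_h(T,\mathbf v)=\mathrm{Pr}\,Ra(\mathbf jT_0,\mathbf v_0)_{\Omega_f}$; $\bar a_h(T,s)=\kappa(\nabla_{w,m}T,\nabla_{w,m}s)_{\mathcal T_h}+\kappa\langle\tau(Q_l^bT_0-T_b),Q_l^bs_0-s_b\rangle_{\partial\mathcal T_h}$; $c_h(\mathbf w;\mathbf u,\mathbf v)=\frac12(\nabla_{w,k}\cdot(\mathbf u\otimes\mathbf w),\mathbf v_0)_{\mathcal T_h^f}-\frac12(\nabla_{w,k}\cdot(\mathbf v\otimes\mathbf w),\mathbf u_0)_{\mathcal T_h^f}$; $\bar c_h(\mathbf w;T,s)=\frac12(\nabla_{w,k}\cdot(\mathbf wT),s_0)_{\mathcal T_h}-\frac12(\nabla_{w,k}\cdot(\mathbf ws),T_0)_{\mathcal T_h}$; $A_h(\mathbf w;\mathbf u,\mathbf v)=a_h(\mathbf u,\mathbf v)+c_h(\mathbf w;\mathbf u,\mathbf v)$, $\bar A_h(\mathbf w;T,s)=\bar a_h(T,s)+\bar c_h(\mathbf w;T,s)$. $\mathbf W_h=\{\mathbf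 w\in\mathbf V_h^0:b_h(\mathbf w,q)=0\ \forall q\in Q_h^0\}$. (R): find $(\mathbf u_h,T_h)\in\mathbf W_h\times S_h^0$ with $A_h(\mathbf u_h;\mathbf u_h,\mathbf v)-d_h(T_h,\mathbf v)=(\mathbf f,\mathbf v_0)_{\Omega_f}$ for all $\mathbf v\in\mathbf W_h$ and $\bar A_h(\mathbf u_h;T_h,s)=(g,s_0)_\Omega$ for all $s\in S_h^0$. *)

(* Defs.v *)
From HB Require Import structures.
From mathcomp Require Import all_boot all_order all_algebra.
From mathcomp Require Import all_classical all_reals all_analysis.
Set Implicit Arguments.
Unset Strict Implicit.
Unset Printing Implicit Defensive.
Import Order.TTheory GRing.Theory Num.Theory.
Import numFieldNormedType.Exports.
Local Open Scope classical_set_scope.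
Local Open Scope ring_scope.

Section Coords.
Context {R : realType}.
Definition pt1 (t : R) : 'rV[R]_1 := \row_(i < 1) t.
Definition pt2 (p : R * R) : 'rV[R]_2 :=
  \row_(i < 2) (if val i == 0%N then p.1 else p.2).
Definition pt3 (p : (R * R) * R) : 'rV[R]_3 :=
  \row_(i < 3) (if val i == 0%N then p.1.1
                else if val i == 1%N then p.1.2 else p.2).

Definition leb2 := (@lebesgue_measure R \x @lebesgue_measure R)%E.
Definition leb3 := ((@lebesgue_measure R \x @lebesgue_measure R)
                      \x @lebesgue_measure R)%E.

Definition vol_int (n : nat) : set 'rV[R]_n -> ('rV[R]_n -> R) -> R :=
  match n as n0 return set 'rV[R]_n0 -> ('rV[R]_n0 -> R) -> R with
  | 2 => fun A F => Rintegral leb2 (pt2 @^-1` A) (F \o pt2)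
  | 3 => fun A F => Rintegral leb3 (pt3 @^-1` A) (F \o pt3)
  | _ => fun _ _ => 0
  end.

Definition L2 (n : nat) : set 'rV[R]_n -> ('rV[R]_n -> R) -> Prop :=
  match n as n0 return set 'rV[R]_n0 -> ('rV[R]_n0 -> R) -> Prop with
  | 2 => fun A F => measurable_fun (pt2 @^-1` A) (F \o pt2) /\
           leb2.-integrable (pt2 @^-1` A) (fun p => ((F (pt2 p)) ^+ 2)%:E)
  | 3 => fun A F => measurable_fun (pt3 @^-1` A) (F \o pt3) /\
           leb3.-integrable (pt3 @^-1` A) (fun p => ((F (pt3 p)) ^+ 2)%:E)
  | _ => fun _ _ => False
  end.

(* Lebesgue integral over the reference n-simplex {y >= 0, sum y <= 1},
   n in {1,2} (used to integrate over faces of d-simplices, d in {2,3}). *)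
Definition ref_int (n : nat) : ('rV[R]_n -> R) -> R :=
  match n as n0 return ('rV[R]_n0 -> R) -> R with
  | 1 => fun F => Rintegral (@lebesgue_measure R) `[0, 1]%classic (F \o pt1)
  | 2 => fun F => Rintegral leb2
                   [set p | 0 <= p.1 /\ 0 <= p.2 /\ p.1 + p.2 <= 1] (F \o pt2)
  | _ => fun _ => 0
  end.
End Coords.

(* A d-simplex is a (d+1) x d matrix whose rows are its vertices.      *)
Section WG.
Context {R : realType} {d : nat}.
Local Notation pt := 'rV[R]_d.
Local Notation simplex := 'M[R]_(d.+1, d).

Definition dotv (u v : pt) : R := \sum_(i < d) u 0 i * v 0 i.
Definition enorm (u : pt) : R := Num.sqrt (dotv u u).
Definition ecoord (c : 'I_d) : pt := \row_(j < d) (if j == c then 1 else 0).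
Definition jvec : pt := \row_(j < d) (if val j == d.-1 then 1 else 0).

Definition poly_le (n : nat) (p : pt -> R) : Prop :=
  exists c : {ffun {ffun 'I_d -> 'I_n.+1} -> R}, forall x,
    p x = \sum_(a : {ffun 'I_d -> 'I_n.+1} | (\sum_(i < d) (a i : nat) <= n)%N)
            c a * \prod_(i < d) x 0 i ^+ a i.
Definition poly_vec (n : nat) (p : pt -> pt) : Prop :=
  forall c : 'I_d, poly_le n (fun x => p x 0 c).

Definition gradf (phi : pt -> R) (x : pt) : pt :=
  \row_(c < d) derive phi x (ecoord c).
Definition divf (tau : pt -> pt) (x : pt) : R :=
  \sum_(c < d) derive (fun y => tau y 0 c) x (ecoord c).

Definition conv (s : seq pt) : set pt :=
  [set x | exists lam : 'I_(size s) -> R, (forall j, 0 <= lam j) /\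
      \sum_j lam j = 1 /\ x = \sum_j lam j *: nth 0 s j].
Definition verts (K : simplex) : seq pt := [seq row i K | i <- enum 'I_d.+1].
Definition hull (K : simplex) : set pt := conv (verts K).
Definition face_verts (K : simplex) (i : 'I_d.+1) : seq pt :=
  [seq row j K | j <- enum 'I_d.+1 & j != i].
Definition face (K : simplex) (i : 'I_d.+1) : set pt := conv (face_verts K i).
Definition nondeg (K : simplex) : bool :=
  \det (\matrix_(j < d, c < d) (K (lift ord0 j) c - K ord0 c)) != 0.
Definition hK (K : simplex) : R :=
  \big[Num.max/0]_(i < d.+1) \big[Num.max/0]_(j < d.+1) enorm (row i K - row j K).
Definition tauK (K : simplex) : R := (hK K)^-1.
Definition nrm (K : simplex) (i : 'I_d.+1) : pt :=
  xget 0 [set n : pt | enorm n = 1 /\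
     (forall j j', j != i -> j' != i -> dotv n (row j K - row j' K) = 0) /\
     (forall j, j != i -> 0 < dotv n (row j K - row i K))].

(* surface integral over the face of K opposite to vertex i, through the
   affine parametrisation y |-> p0 + y G of the face by the reference
   (d-1)-simplex, with Jacobian factor sqrt(det(G G^T)) *)
Definition face_int (K : simplex) (i : 'I_d.+1) (phi : pt -> R) : R :=
  let s := face_verts K i in
  let p0 := nth 0 s 0 in
  let G : 'M[R]_(d.-1, d) := \matrix_(j < d.-1, c < d) (nth 0 s j.+1 0 c - p0 0 c) in
  Num.sqrt (\det (G *m G^T)) * ref_int (fun y : 'rV[R]_(d.-1) => phi (p0 + y *m G)).

Definition el_int (K : simplex) (F : pt -> R) : R := vol_int (hull K) F.

Definition wgrad (r : nat) (K : simplex) (v0 : pt -> R) (vb : 'I_d.+1 -> pt -> R)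
  : pt -> pt :=
  xget (fun _ => 0) [set G | poly_vec r G /\ forall tau, poly_vec r tau ->
    el_int K (fun x => dotv (G x) (tau x)) =
    - el_int K (fun x => v0 x * divf tau x)
    + \sum_(i < d.+1) face_int K i (fun x => vb i x * dotv (tau x) (nrm K i))].

Definition wdiv (r : nat) (K : simplex) (v0 : pt -> pt) (vb : 'I_d.+1 -> pt -> pt)
  : pt -> R :=
  xget (fun _ => 0) [set D | poly_le r D /\ forall phi, poly_le r phi ->
    el_int K (fun x => D x * phi x) =
    - el_int K (fun x => dotv (v0 x) (gradf phi x))
    + \sum_(i < d.+1) face_int K i (fun x => dotv (vb i x) (nrm K i) * phi x)].

Definition Qb (r : nat) (K : simplex) (i : 'I_d.+1) (phi : pt -> R) : pt -> R :=
  xget (fun _ => 0) [set q | poly_le r q /\ forall p, poly_le r p ->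
    face_int K i (fun x => (q x - phi x) * p x) = 0].

(* weak functions v = {v0, vb}: v0 given elementwise, vb given facewise
   (a face being identified with the point set it occupies) *)
Record wfun (T : Type) := WF { f0 : simplex -> pt -> T ; fb : set pt -> pt -> T }.

Definition comp (v : wfun pt) (c : 'I_d) : wfun R :=
  WF (fun K x => f0 v K x 0 c) (fun e x => fb v e x 0 c).
(* s w = {s0 w0, sb wb}; with s = u_c this is the c-th row of u (x) w *)
Definition scalw (s : wfun R) (w : wfun pt) : wfun pt :=
  WF (fun K x => f0 s K x *: f0 w K x) (fun e x => fb s e x *: fb w e x).

Definition wG (r : nat) (K : simplex) (v : wfun R) : pt -> pt :=
  wgrad r K (f0 v K) (fun i => fb v (face K i)).
Definition wD (r : nat) (K : simplex) (v : wfun pt) : pt -> R :=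
  wdiv r K (f0 v K) (fun i => fb v (face K i)).

Definition union (s : seq simplex) : set pt :=
  \bigcup_(K in [set K | K \in s]) hull K.
Definition bdry (A : set pt) : set pt := closure A `\` interior A.
Definition is_face_of (s : seq simplex) (e : set pt) : Prop :=
  exists K i, K \in s /\ e = face K i.

(* conforming simplicial triangulation of a (polygonal/polyhedral) domain:
   distinct nondegenerate simplices, any two of which meet in the convex hull
   of their common vertices (empty, or a common subsimplex), and whose union
   has a nonempty connected interior *)
Definition triangulation (s : seq simplex) : Prop :=
  uniq s /\ (forall K, K \in s -> nondeg K) /\
  (forall K K', K \in s -> K' \in s -> K != K' ->
     hull K `&` hull K' = conv [seq v <- verts K | v \in verts K']) /\
  interior (union s) !=set0 /\ connected (interior (union s)).

(* T_h^f, T_h^s triangulations of Omega_f, Omega_s with T_h = T_h^f u T_h^s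
   a triangulation of Omega, Omega_f a (polygonal) subdomain *)
Definition fs_mesh (THf THs : seq simplex) : Prop :=
  triangulation (THf ++ THs) /\ triangulation THf.

Definition Omega (THf THs : seq simplex) : set pt := interior (union (THf ++ THs)).
Definition Omegaf (THf : seq simplex) : set pt := interior (union THf).

Definition in_V0 (THf : seq simplex) (k l : nat) (v : wfun pt) : Prop :=
  (forall K, K \in THf -> poly_vec k (f0 v K)) /\
  (forall K i, K \in THf -> poly_vec l (fb v (face K i))) /\
  (forall K i, K \in THf -> face K i `<=` bdry (Omegaf THf) ->
      forall x, face K i x -> fb v (face K i) x = 0).

Definition in_Q0 (THf : seq simplex) (k : nat) (q : wfun R) : Prop :=
  (forall K, K \in THf -> poly_le k.-1 (f0 q K)) /\
  (forall K i, K \in THf -> poly_le k (fb q (face K i))) /\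
  \sum_(K <- THf) el_int K (f0 q K) = 0.

Definition in_S0 (THf THs : seq simplex) (k l : nat) (s : wfun R) : Prop :=
  (forall K, K \in THf ++ THs -> poly_le k (f0 s K)) /\
  (forall K i, K \in THf ++ THs -> poly_le l (fb s (face K i))) /\
  (forall K i, K \in THf ++ THs -> face K i `<=` bdry (Omega THf THs) ->
      forall x, face K i x -> fb s (face K i) x = 0).

Definition ext0 (THf : seq simplex) (w : wfun pt) : wfun pt :=
  WF (fun K x => if K \in THf then f0 w K x else 0)
     (fun e x => if `[< is_face_of THf e >] then fb w e x else 0).

Definition a_h (Pr : R) (m l : nat) (THf : seq simplex) (u v : wfun pt) : R :=
  Pr * \sum_(K <- THf) \sum_(c < d)
    (el_int K (fun x => dotv (wG m K (comp u c) x) (wG m K (comp v c) x))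
     + \sum_(i < d.+1) face_int K i (fun x => tauK K *
         ((Qb l K i (f0 (comp u c) K) x - fb (comp u c) (face K i) x) *
          (Qb l K i (f0 (comp v c) K) x - fb (comp v c) (face K i) x)))).

Definition b_h (k : nat) (THf : seq simplex) (v : wfun pt) (q : wfun R) : R :=
  \sum_(K <- THf) el_int K (fun x => dotv (wG k K q x) (f0 v K x)).

Definition d_h (Pr Ra : R) (THf : seq simplex) (T : wfun R) (v : wfun pt) : R :=
  Pr * Ra * \sum_(K <- THf) el_int K (fun x => f0 T K x * dotv jvec (f0 v K x)).

Definition abar_h (kappa : R) (m l : nat) (TH : seq simplex) (T s : wfun R) : R :=
  kappa * \sum_(K <- TH)
    (el_int K (fun x => dotv (wG m K T x) (wG m K s x))
     + \sum_(i < d.+1) face_int K i (fun x => tauK K *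
         ((Qb l K i (f0 T K) x - fb T (face K i) x) *
          (Qb l K i (f0 s K) x - fb s (face K i) x)))).

Definition c_h (k : nat) (THf : seq simplex) (w u v : wfun pt) : R :=
  2^-1 * \sum_(K <- THf) \sum_(c < d)
      el_int K (fun x => wD k K (scalw (comp u c) w) x * f0 v K x 0 c)
  - 2^-1 * \sum_(K <- THf) \sum_(c < d)
      el_int K (fun x => wD k K (scalw (comp v c) w) x * f0 u K x 0 c).

Definition cbar_h (k : nat) (THf THs : seq simplex) (w : wfun pt) (T s : wfun R) : R :=
  2^-1 * \sum_(K <- THf ++ THs)
      el_int K (fun x => wD k K (scalw T (ext0 THf w)) x * f0 s K x)
  - 2^-1 * \sum_(K <- THf ++ THs)
      el_int K (fun x => wD k K (scalw s (ext0 THf w)) x * f0 T K x).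

Definition A_h Pr k m l THf (w u v : wfun pt) : R :=
  a_h Pr m l THf u v + c_h k THf w u v.
Definition Abar_h kappa k m l THf THs (w : wfun pt) (T s : wfun R) : R :=
  abar_h kappa m l (THf ++ THs) T s + cbar_h k THf THs w T s.

Definition in_W (THf : seq simplex) (k l : nat) (w : wfun pt) : Prop :=
  in_V0 THf k l w /\ forall q, in_Q0 THf k q -> b_h k THf w q = 0.

Definition rhs_f (THf : seq simplex) (f : pt -> pt) (v : wfun pt) : R :=
  \sum_(K <- THf) el_int K (fun x => dotv (f x) (f0 v K x)).
Definition rhs_g (TH : seq simplex) (g : pt -> R) (s : wfun R) : R :=
  \sum_(K <- TH) el_int K (fun x => g x * f0 s K x).

End WG.

(* Main.v *)
Require Import Defs.
From mathcomp Require Import all_boot.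
Set Implicit Arguments.
Unset Strict Implicit.
Unset Printing Implicit Defensive.

(* A continuous field F on R^N with F(x).x >= 0 outside a box has a zero: Scarf's
   combinatorial lemma, a parity argument, gives the complementarity theorem on
   the simplex, of which this is a consequence.  Since both convection forms vanish on the
   diagonal, the reduced problem, with the temperature equations suitably
   weighted, is the search for such a zero, once the two diffusion forms are known to be
   coercive modulo functions that all forms ignore.

   If a diffusion form vanishes on u, Gauss' theorem and k - 1 <= m <= l make u_0 equal
   on each simplex to a constant, also taken by u_b on all its faces.  To show that
   these constants vanish, leave a simplex with constant c <> 0 along a generic ray, and
   consider the last point of the ray lying in some simplex with constant c.  It is interior to
   a face; a face inside the boundary would force c = 0, and any other face is shared
   with a simplex, having therefore the same constant c, into which the ray continues.

   Gauss' theorem for polynomials reduces, by affine maps and by the invariance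
   of simplex integrals under permutations of the vertices, to the fundamental theorem of
   calculus in the last coordinate of the reference simplex. *)

(** * Scarf's lemma *)

(** A weak function is a pair of arbitrary functions, constrained only on the elements and faces of
    the mesh, so the discrete spaces are infinite-dimensional as they stand and the diffusion forms
    only semidefinite. A basis is replaced by finitely many moments whose vanishing annihilates the
    diffusion energy. They bound the length of orthonormal families, and a maximal family splits
    every function into a finite combination and a null function, on which the equations hold
    trivially.

    The discrete operators are chosen by [xget], hence come without any linearity. That the choice
    succeeds is a Riesz representation among polynomials; linearity of a form is read off the
    defining identity, with the operator applied to the other argument as test function. The
    projection [Qb] is not even unique as a function, since a polynomial may vanish on a face only;
    it is removed by testing with polynomials of degree at most [l]. *)

Section Scarf.
Variables (X I : finType) (rk : I -> X -> nat) (c : X -> I) (i0 : I) (x0 : X).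
Hypothesis rk_inj : forall i, injective (rk i).

(** For nonempty [B], no point lies above the minimum of [B] in all rankings of [C] at once. This is
    the order-theoretic substitute for a simplex of a triangulation. *)
Definition dominant (B : {set X}) (C : {set I}) :=
  [forall x, exists i in C, forall b in B, rk i x <= rk i b].

Lemma dominantP (B : {set X}) (C : {set I}) :
  reflect (forall x, exists2 i, i \in C & forall b, b \in B -> rk i x <= rk i b)
          (dominant B C).
Proof.
apply: (iffP forallP) => H x.
  have /exists_inP[i iC /forall_inP Hb] := H x; by exists i.
have [i iC Hb] := H x; apply/exists_inP; exists i => //; exact/forall_inP.
Qed.

Lemma dominantW (B B' : {set X}) (C C' : {set I}) :
  B' \subset B -> C \subset C' -> dominant B C -> dominant B' C'.
Proof.
move=> sB sC /dominantP H; apply/dominantP => x; have [i iC Hb] := H x.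
by exists i; [exact: (subsetP sC) | move=> b /(subsetP sB); exact: Hb].
Qed.

Definition room (r : {set X} * {set I}) := dominant r.1 r.2 && (#|r.1| == #|r.2|).
(** The cardinalities force [c] to be injective on the points, so a door shows each colour of its
    index set exactly once, except [i0], which is missing. *)
Definition door (e : {set X} * {set I}) :=
  [&& dominant e.1 e.2, i0 \in e.2, c @: e.1 == e.2 :\ i0 & #|e.2| == #|e.1|.+1].
Definition incident (r e : {set X} * {set I}) :=
  [exists b in r.1, e == (r.1 :\ b, r.2)] ||
  [exists i in ~: r.2, e == (r.1, i |: r.2)].

Definition mini (D : {set X}) (x1 : X) (i : I) : X := [arg min_(x < x1 in D) rk i x].

(** * The two rooms of a door *)

Section Door.
Variables (D : {set X}) (E : {set I}) (d : X).
Hypotheses (dD : d \in D) (domDE : dominant D E) (cardDE : #|E| = #|D|.+1).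
Let mu := mini D d.

Lemma mini_in i : mu i \in D.
Proof. by rewrite /mu /mini; case: arg_minnP. Qed.
Lemma mini_le i b : b \in D -> rk i (mu i) <= rk i b.
Proof. by rewrite /mu /mini; case: arg_minnP => // x _ H /H. Qed.
Lemma mini_eq i b : b \in D -> (forall b', b' \in D -> rk i b <= rk i b') -> mu i = b.
Proof.
move=> bD H; apply: (@rk_inj i); apply/eqP; rewrite eqn_leq mini_le //=.
exact/H/mini_in.
Qed.

Lemma mini_surj b : b \in D -> exists2 i, i \in E & mu i = b.
Proof.
move=> bD; have /dominantP/(_ b)[i iE H] := domDE; exists i => //.
exact: mini_eq.
Qed.

(** Pigeonhole: [mu] maps [E] into [D], which has one element less. As [mu] is also onto, this is
    its only coincidence, and the two indices involved yield the two rooms of the door. *)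
Lemma shared_pair : exists i j, [/\ i \in E, j \in E, i != j & mu i = mu j].
Proof.
have : ~~ [forall i in E, forall j in E, (mu i == mu j) ==> (i == j)].
  apply/negP => /forall_inP H.
  have inj : {in E &, injective mu}.
    move=> i j iE jE eq; have /forall_inP/(_ j jE) := H i iE.
    by rewrite eq eqxx /= => /eqP.
  have := card_in_imset inj; have : mu @: E \subset D.
    by apply/subsetP => _ /imsetP[i _ ->]; exact: mini_in.
  by move/subset_leq_card => + eq; rewrite eq cardDE ltnn.
rewrite negb_forall_in => /exists_inP[i iE]; rewrite negb_forall_in.
move=> /exists_inP[j jE]; rewrite negb_imply => /andP[/eqP eq ne].
by exists i, j.
Qed.

Lemma inj_off i j k k' : i \in E -> j \in E -> i != j -> mu i = mu j ->
  k \in E -> k' \in E -> k != i -> k' != i -> mu k = mu k' -> k = k'.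
Proof.
move=> iE jE nij eij kE k'E ki k'i eq.
have im : mu @: (E :\ i) = D.
  apply/eqP; rewrite eqEsubset; apply/andP; split.
    by apply/subsetP => _ /imsetP[z _ ->]; exact: mini_in.
  apply/subsetP => b /mini_surj[z zE <-].
  have [->|zi] := eqVneq z i.
    by rewrite eij imset_f // !inE jE eq_sym nij.
  by rewrite imset_f // !inE zi.
have /imset_injP inj : #|mu @: (E :\ i)| == #|E :\ i|.
  by rewrite im; have := cardsD1 i E; rewrite iE cardDE => -[->].
by apply: inj => //; rewrite !inE ?ki ?k'i.
Qed.

Definition above (k : I) : pred X :=
  [pred x | [forall j in E :\ k, rk j (mu j) < rk j x]].
(** The pivot step. Giving up the ranking [k] admits the points above [D] in all the other rankings;
    the one highest in ranking [k] joins [D]. If there is none, [k] itself is discarded. *)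
Definition next (k : I) : {set X} * {set I} :=
  if [pick x | above k x] is Some x1
  then ([arg max_(x > x1 | above k x) rk k x] |: D, E) else (D, E :\ k).

Lemma above_ndom k : (exists x, above k x) -> ~~ dominant D (E :\ k).
Proof.
case=> x /forall_inP ax; apply/negP => /dominantP/(_ x)[j jE H].
by have := H _ (mini_in j); rewrite leqNgt ax.
Qed.

Lemma nabove_dom k : (forall x, ~~ above k x) -> dominant D (E :\ k).
Proof.
move=> H; apply/dominantP => x; have := H x.
rewrite /= negb_forall_in => /exists_inP[j jE]; rewrite -leqNgt => le.
exists j => // b bD; exact: leq_trans le (mini_le _ bD).
Qed.

Lemma nextP k : k \in E ->
  (dominant D (E :\ k) /\ next k = (D, E :\ k)) \/
  (exists x, [/\ above k x, rk k x <= rk k (mu k), (forall y, above k y -> rk k y <= rk k x)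
     & next k = (x |: D, E)]).
Proof.
move=> kE; rewrite /next; case: pickP => [x1 ax1|none]; last first.
  by left; split => //; apply: nabove_dom => x; rewrite none.
right; case: arg_maxnP => // x ax mx; exists x; split => //.
have /dominantP/(_ x)[j jE H] := domDE.
have [<-|jk] := eqVneq j k; first by apply: H; exact: mini_in.
have /forall_inP/(_ j) := ax; rewrite !inE jk jE => /(_ isT).
by rewrite ltnNge H // mini_in.
Qed.

(** Were [x] in [D], it would be the minimiser shared by [i] and [j], although it lies strictly
    above that minimiser in ranking [j]. *)
Lemma above_notin i j x : i \in E -> j \in E -> i != j -> mu i = mu j ->
  above i x -> rk i x <= rk i (mu i) -> x \notin D.
Proof.
move=> iE jE nij eij /forall_inP ax le; apply/negP => xD.
have eq : mu i = x by apply: mini_eq => // b bD; exact: leq_trans le (mini_le _ bD).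
by have := ax j; rewrite !inE eq_sym nij jE => /(_ isT); rewrite -eij eq ltnn.
Qed.

(** Suppose that [x] was added. A point above the old minima in all rankings but [i] loses to [x] in
    ranking [i], where [x] was chosen highest; any other point fails in an index other than [i],
    whose minimum is not lowered by [x]. *)
Lemma next_room i j : i \in E -> j \in E -> i != j -> mu i = mu j ->
  room (next i) && incident (next i) (D, E).
Proof.
move=> iE jE nij eij; have [[dom ->]|[x [ax le mx ->]]] := nextP iE.
  rewrite /room /incident /= dom /=; apply/andP; split.
    by have := cardsD1 i E; rewrite iE cardDE => -[->].
  by apply/orP; right; apply/exists_inP; exists i; rewrite ?inE ?eqxx // setD1K.
have xD := above_notin iE jE nij eij ax le.
rewrite /room /incident /=; apply/andP; split; last first.
  apply/orP; left; apply/exists_inP; exists x; first by rewrite !inE eqxx.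
  by rewrite setU1K.
rewrite cardsU1 xD cardDE eqxx andbT; apply/dominantP => y.
have ymu k : k \in E -> rk k y <= rk k (mu k) -> k != i -> exists2 k0, k0 \in E &
    forall b, b \in x |: D -> rk k0 y <= rk k0 b.
  move=> kE yk ki; exists k => // b /setU1P[->|/(mini_le k)]; last exact: leq_trans.
  apply: (leq_trans yk); have /forall_inP/(_ k) := ax; rewrite !inE ki kE => /(_ isT).
  exact: ltnW.
have [ay|] := boolP (above i y).
  exists i => // b /setU1P[->|bD]; first exact: mx.
  by apply: leq_trans (mx _ ay) (leq_trans le (mini_le _ bD)).
rewrite /= negb_forall_in => /exists_inP[k]; rewrite !inE -leqNgt => /andP[ki kE] yk.
exact: ymu yk ki.
Qed.

Lemma next_neq i j : i \in E -> j \in E -> i != j -> mu i = mu j -> next i != next j.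
Proof.
move=> iE jE nij eij.
have [[_ ->]|[x [ax lex _ ->]]] := nextP iE; have [[_ ->]|[y [ay ley _ ->]]] := nextP jE.
- apply/eqP => -[] /setP/(_ i); by rewrite !inE eqxx iE nij.
- apply/eqP => -[] _ /setP/(_ i); by rewrite !inE eqxx iE.
- apply/eqP => -[] _ /setP/(_ j); by rewrite !inE eqxx jE.
apply/eqP => -[] eq.
have : y \in x |: D by rewrite eq !inE eqxx.
have nji : j != i by rewrite eq_sym.
rewrite !inE (negbTE (above_notin jE iE nji (esym eij) ay ley)) orbF => /eqP eyx.
have /forall_inP/(_ i) := ay; rewrite !inE nij iE => /(_ isT).
by rewrite eyx ltnNge lex.
Qed.

Lemma surj_off k : k \in E -> (forall b, b \in D -> exists2 k', k' \in E :\ k & mu k' = b) ->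
  exists2 k', k' \in E & k != k' /\ mu k = mu k'.
Proof.
move=> kE H; have [k' + e] := H _ (mini_in k); rewrite !inE => /andP[n k'E].
by exists k' => //; rewrite eq_sym n e.
Qed.

(** The index given up is the one that dominates the extra point of the room, or else the one that
    the door adds. The remaining indices still attain every point of [D], so this index shares its
    minimiser with one of them. *)
Lemma incident_next r : room r -> incident r (D, E) ->
  exists k k', [/\ k \in E, k' \in E, k != k', mu k = mu k' & r = next k].
Proof.
case: r => B C /andP[/= dom /eqP card] /orP[] /exists_inP/= [].
  move=> x xB /eqP[eD eE]; subst C.
  have eB : B = x |: D by rewrite eD setD1K.
  have xD : x \notin D by rewrite eD !inE eqxx.
  subst B.
  have /dominantP domP := dom.
  have /(_ x)[k kE Hk] := domP.
  have surj b : b \in D -> exists2 k', k' \in E :\ k & mu k' = b /\ rk k' b < rk k' x.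
    move=> bD; have [k' k'E H'] := domP b.
    have nbx : b != x by apply: contraNneq xD => <-.
    have lt : rk k' b < rk k' x.
      rewrite ltn_neqAle H' ?inE ?eqxx // andbT; apply: contraNneq nbx => /rk_inj ->; exact: eqxx.
    exists k'; last by split => //; apply: mini_eq => // b' b'D; apply: H'; rewrite !inE b'D orbT.
    rewrite !inE k'E andbT; apply: contraTneq lt => ->; rewrite -leqNgt.
    by apply: Hk; rewrite !inE bD orbT.
  have [k' k'E [nkk ekk]] : exists2 k', k' \in E & k != k' /\ mu k = mu k'.
    by apply: surj_off => // b /surj[k1 k1E [<- _]]; exists k1.
  exists k, k'; split => //.
  have ax : above k x.
    apply/forall_inP => j; rewrite !inE => /andP[jk jE].
    have [k2 + [ek2 lt2]] := surj _ (mini_in j); rewrite !inE => /andP[k2k k2E].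
    by move: lt2; rewrite -ek2 (inj_off kE k'E nkk ekk k2E jE k2k jk ek2).
  have [[domk _]|[y [ay ley my ->]]] := nextP kE.
    by have := above_ndom (ex_intro _ x ax); rewrite domk.
  suff -> : y = x by [].
  apply: (@rk_inj k); apply/eqP; rewrite eqn_leq my // andbT.
  have [j jE Hj] := domP y; have [<-|jk] := eqVneq j k; first by apply: Hj; rewrite !inE eqxx.
  have /forall_inP/(_ j) := ay; rewrite !inE jk jE => /(_ isT).
  by rewrite ltnNge Hj // !inE mini_in orbT.
move=> k; rewrite inE => kC /eqP[eD eE]; subst B.
have eC : C = E :\ k by rewrite eE setU1K.
have kE : k \in E by rewrite eE !inE eqxx.
subst C; have [k' k'E [nkk ekk]] : exists2 k', k' \in E & k != k' /\ mu k = mu k'.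
  apply: surj_off => // b bD; have /dominantP/(_ b)[k' k'E H] := dom.
  by exists k' => //; apply: mini_eq.
exists k, k'; split => //.
have [[_ ->//]|[y [ay _ _ _]]] := nextP kE.
by have := above_ndom (ex_intro _ y ay); rewrite dom.
Qed.

Lemma door_rooms : #|[set r | room r & incident r (D, E)]| = 2.
Proof.
have [i [j [iE jE nij eij]]] := shared_pair.
suff -> : [set r | room r & incident r (D, E)] = [set next i; next j].
  by rewrite cards2 next_neq.
have nji : j != i by rewrite eq_sym.
apply/setP => r; rewrite !inE; apply/idP/idP; last first.
  by case/orP => /eqP ->; [apply: (next_room iE jE)|apply: (next_room jE iE)].
case/andP => /incident_next H /H[k [k' [kE k'E nk ek ->]]].
have [->|ki] := eqVneq k i; first by rewrite eqxx.
have [k'i|k'i] := eqVneq k' i.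
  suff -> : k = j by rewrite eqxx orbT.
  by apply: (inj_off iE jE) => //; rewrite ek k'i.
by have := inj_off iE jE nij eij kE k'E ki k'i ek => /eqP; rewrite (negbTE nk).
Qed.
End Door.

(** Dominance of a single point in a single ranking is maximality, so the only room behind the door
    without points holds the highest point of ranking [i0]. *)
Lemma root_door_rooms : #|[set r | room r & incident r (set0, [set i0])]| = 1.
Proof.
pose x1 := [arg max_(x > x0) rk i0 x].
have mx y : rk i0 y <= rk i0 x1 by rewrite /x1; case: arg_maxnP => // x _ H; exact: H.
suff -> : [set r | room r & incident r (set0, [set i0])] = [set ([set x1], [set i0])].
  by rewrite cards1.
apply/setP => -[B C]; rewrite !inE; apply/idP/idP => [|/eqP[-> ->]].
  case/andP => /andP[/= /dominantP dom /eqP card] /orP[] /exists_inP /= [].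
    move=> b bB /eqP[eB eC]; subst C.
    have e : B = [set b] by rewrite -(setD1K bB) -eB setU0.
    subst B; apply/eqP; congr ([set _], _).
    apply: (@rk_inj i0); apply/eqP; rewrite eqn_leq mx /=.
    have [i + H] := dom x1; rewrite inE => /eqP ei; subst i; by apply: H; rewrite inE.
  move=> i iC /eqP[eB _]; subst B; move: card; rewrite cards0 => /esym/eqP; rewrite cards_eq0.
  by move=> /eqP eC; subst C; have [j] := dom x0; rewrite inE.
rewrite /room /incident /= !cards1 eqxx andbT; apply/andP; split.
  apply/dominantP => x; exists i0; rewrite ?inE // => b; rewrite inE => /eqP ->; exact: mx.
by apply/orP; left; apply/exists_inP; exists x1; rewrite ?inE // setDv.
Qed.

(** * The doors of a room *)

Section Room.
Variables (B : {set X}) (C : {set I}).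
Hypothesis rBC : room (B, C).

Definition drops := [set b in B | (i0 \in C) && (c @: (B :\ b) == C :\ i0)].
Definition adds := [set i in ~: C | (i0 \in i |: C) && (c @: B == (i |: C) :\ i0)].

Lemma room_doors : #|[set e | door e & incident (B, C) e]| = #|drops| + #|adds|.
Proof.
have /andP[/= dom /eqP card] := rBC.
have -> : [set e | door e & incident (B, C) e] =
    [set (B :\ b, C) | b in drops] :|: [set (B, i |: C) | i in adds].
  apply/setP => e; rewrite !inE; apply/idP/idP.
    case/andP => /and4P[_ e1 e2 _] /orP[] /exists_inP/= [z zB /eqP ee]; subst e;
      rewrite /= in e1 e2.
      by rewrite imset_f // !inE zB e1 e2.
    by rewrite orbC imset_f // inE zB e1 e2.
  rewrite /door /incident /= => /orP[] /imsetP[z]; rewrite inE.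
    case/and3P => zB e1 e2 -> /=; rewrite (dominantW _ _ dom) ?subsetDl // e1 e2 /=.
    rewrite -card (cardsD1 z B) zB add1n eqxx /=.
    by apply/orP; left; apply/exists_inP; exists z.
  case/and3P => zB e1 e2 -> /=; rewrite (dominantW _ _ dom) ?subsetUr // e1 e2 /=.
  rewrite cardsU1 -in_setC zB card add1n eqxx /=.
  by apply/orP; right; apply/exists_inP; exists z.
rewrite cardsU.
have -> : [set (B :\ b, C) | b in drops] :&: [set (B, i |: C) | i in adds] = set0.
  apply/setP => e; rewrite !inE; apply/negP => /andP[/imsetP[b _ ->] /imsetP[i]].
  by rewrite inE inE => /andP[iC _] [_] /setP/(_ i); rewrite !inE eqxx (negbTE iC).
rewrite cards0 subn0; congr (_ + _); apply: card_in_imset => x y.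
  rewrite !inE => /andP[xB _] /andP[yB _] [] /setP/(_ x); rewrite !inE eqxx xB /= andbT.
  by move/esym/negbFE/eqP.
rewrite !inE => /andP[xB _] /andP[yB _] [] /setP/(_ x); rewrite !inE eqxx (negbTE xB) /= orbF.
by move/esym/eqP.
Qed.

Lemma room_doors_odd : odd #|[set e | door e & incident (B, C) e]| = (c @: B == C).
Proof.
rewrite room_doors; have /andP[/= dom /eqP card] := rBC.
have [i0C|i0C] := boolP (i0 \in C); last first.
  have -> : drops = set0.
    by apply/setP => b; rewrite !inE (negbTE i0C) andbF.
  have -> : adds = if c @: B == C then [set i0] else set0.
    apply/setP => i; rewrite !inE (negbTE i0C) orbF.
    have [e|ne] := eqVneq (c @: B) C; rewrite ?inE.
      have [->|ne] := eqVneq i i0; last by rewrite andbF.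
      by rewrite i0C setU1K // e eqxx.
    apply/negP => /and3P[iC /eqP ei /eqP e]; case/eqP: ne; by rewrite e ei setU1K.
  by case: (c @: B == C); rewrite !(cards0, cards1).
have cardC1 : #|C| = #|C :\ i0|.+1 by rewrite (cardsD1 i0 C) i0C.
have dropsE b : (b \in drops) = (b \in B) && (c @: (B :\ b) == C :\ i0).
  by rewrite inE i0C.
have addsE i : (i \in adds) = (i \notin C) && (c @: B == i |: (C :\ i0)).
  rewrite !inE i0C orbT /=; have [|iC] := boolP (i \in C) => //=.
  congr (_ == _); apply/setP => j; rewrite !inE.
  by have [->|//] := eqVneq j i; rewrite /= andbT; apply: contraNneq iC => ->.
have [/set0Pn[b]|/negPn/eqP N0] := boolP (drops != set0); last first.
  rewrite N0 cards0 add0n.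
  have -> : adds = set0.
    apply/eqP; apply: contraT => /set0Pn[i]; rewrite addsE => /andP[iC /eqP e].
    have /imset_injP inj : #|c @: B| == #|B|.
      by rewrite e cardsU1 !inE (negbTE iC) andbF card cardC1.
    have /imsetP[b bB eb] : i \in c @: B by rewrite e !inE eqxx.
    suff : b \in drops by rewrite N0 inE.
    rewrite dropsE bB /=; apply/eqP/setP => j.
    have -> : (j \in C :\ i0) = (j \in c @: B) && (j != i).
      rewrite e !inE; have [->|//] := eqVneq j i; last by rewrite andbT.
      by rewrite (negbTE iC) andbF.
    apply/imsetP/andP => [[z + ->]|[/imsetP[z zB ->] ne]].
      rewrite !inE => /andP[zb zB]; split; first exact: imset_f.
      by apply: contraNneq zb; rewrite eb => /inj -> //.
    by exists z => //; rewrite !inE zB andbT; apply: contraNneq ne => ->; rewrite eb.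
  rewrite cards0; apply/esym/negP => /eqP e.
  have /imset_injP inj : #|c @: B| == #|B| by rewrite e card.
  have /imsetP[b bB eb] : i0 \in c @: B by rewrite e.
  suff : b \in drops by rewrite N0 inE.
  rewrite dropsE bB /=; apply/eqP/setP => j; rewrite -e.
  apply/imsetP/setD1P => [[z + ->]|[ne /imsetP[z zB ej]]].
    rewrite !inE => /andP[zb zB]; split; last exact: imset_f.
    by apply: contraNneq zb; rewrite eb => /inj -> //.
  by exists z => //; rewrite !inE zB andbT; apply: contraNneq ne => ez; rewrite ej ez eb.
rewrite dropsE => /andP[bB /eqP eb].
have cB : c @: B = c b |: (C :\ i0).
  rewrite -eb; apply/setP => j; rewrite !inE; apply/imsetP/orP.
    case=> z zB ->; have [->|ne] := eqVneq z b; first by left.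
    by right; apply: imset_f; rewrite !inE ne.
  by case=> [/eqP ->|/imsetP[z + ->]]; [exists b|rewrite !inE => /andP[_ zB]; exists z].
have /imset_injP inj : #|c @: (B :\ b)| == #|B :\ b|.
  by rewrite eb; have := cardsD1 b B; rewrite bB card cardC1 => -[->].
have bdrop : b \in drops by rewrite dropsE bB eb eqxx.
have uniq_drop : c b \notin C :\ i0 -> drops = [set b].
  move=> cb; apply/setP => z; rewrite inE; apply/idP/eqP => [|->//].
  rewrite dropsE => /andP[zB /eqP ez]; apply/eqP; apply: contraNT cb => ne.
  by rewrite -ez imset_f // !inE eq_sym ne bB.
(* Colour [i0]: all of [C] is shown, and dropping [b] is the only door. *)
have [cbi0|cbi0] := eqVneq (c b) i0.
  have -> : adds = set0.
    apply/setP => i; rewrite addsE inE; apply/negP => /andP[iC /eqP].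
    move=> /setP/(_ i0); rewrite cB cbi0 !inE eqxx /= orbF => /esym/eqP ei.
    by rewrite -ei i0C in iC.
  rewrite uniq_drop ?cards1 ?cards0 ?cB cbi0; last by rewrite !inE eqxx.
  by rewrite setD1K // eqxx.
(* Colour outside [C]: there are two doors, dropping [b] and adding its colour. *)
have [cbC|cbC] := boolP (c b \in C); last first.
  rewrite uniq_drop ?cards1; last by rewrite !inE (negbTE cbC) andbF.
  have -> : adds = [set c b].
    apply/setP => i; rewrite addsE inE; apply/andP/eqP => [[iC /eqP]|->].
      rewrite cB => /setP/(_ i); rewrite !inE eqxx (negbTE iC) andbF orbF /=.
      by move=> /eqP.
    by rewrite cbC cB eqxx.
  rewrite cards1; apply/esym/negP => /eqP /setP/(_ (c b)).
  by rewrite imset_f // (negbTE cbC).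
(* Colour in [C] but not [i0]: one other point [b'] repeats it, and the two doors drop [b] or
   [b']. *)
have cB' : c @: B = C :\ i0.
  by rewrite cB; apply/setUidPr; rewrite sub1set !inE cbi0.
have -> : adds = set0.
  apply/setP => i; rewrite addsE inE; apply/negP => /andP[iC /eqP].
  by rewrite cB' => /setP/(_ i); rewrite !inE eqxx (negbTE iC) andbF.
have /imsetP[b' + eb'] : c b \in c @: (B :\ b) by rewrite eb !inE cbi0.
rewrite !inE => /andP[nb b'B].
have -> : drops = [set b; b'].
  apply/setP => z; rewrite dropsE !inE; apply/andP/orP => [[zB /eqP ez]|].
    have [->|zb] := eqVneq z b; [by left|right].
    have : c z \in c @: (B :\ z) by rewrite ez -cB' imset_f.
    case/imsetP => y; rewrite !inE => /andP[yz yB] e.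
    have [eyb|yb] := eqVneq y b; last first.
      by move: yz; rewrite (inj z y) ?eqxx // !inE ?zb ?yb.
    by rewrite (inj z b') // ?inE ?zb ?nb // e eyb.
  case=> /eqP ->; first by rewrite bB eb eqxx.
  split => //; apply/eqP; rewrite -cB'; apply/setP => j; apply/imsetP/imsetP.
    by case=> y; rewrite !inE => /andP[_ yB] ->; exists y.
  case=> y yB ->; have [->|yb'] := eqVneq y b'.
    by exists b; rewrite ?inE ?bB 1?eq_sym ?nb.
  by exists y; rewrite // !inE yb'.
rewrite cards0 addn0 cards2 eq_sym nb; apply/esym/negP => /eqP; rewrite cB'.
by move=> /setP/(_ i0); rewrite !inE eqxx i0C.
Qed.
End Room.

(* Scarf's lemma in the form of Petri and Voorneveld: doors join two rooms, except
   for [(set0, [set i0])], which has one; a room has an odd number of doors exactly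
   when it is fully coloured. *)
Lemma scarf : exists (B : {set X}) (C : {set I}), dominant B C /\ c @: B = C.
Proof.
suff : odd #|[set r | room r & c @: r.1 == r.2]|.
  move=> o; have : [set r | room r & c @: r.1 == r.2] != set0.
    by apply: contraTneq o => ->; rewrite cards0.
  by case/set0Pn => -[B C]; rewrite inE => /andP[/andP[/= dom _] /eqP e]; exists B, C.
have e1 : odd #|[set r | room r & c @: r.1 == r.2]| =
    odd (\sum_(r | room r) #|[set e | door e & incident r e]|).
  rewrite -sum1_card (eq_bigl (fun r => room r && (c @: r.1 == r.2))); last first.
    by move=> r; rewrite inE.
  rewrite big_mkcondr /= !(big_morph odd oddD (erefl _)).
  apply: eq_bigr => -[B C] rBC; rewrite room_doors_odd //=.
  by case: ifP.
rewrite e1.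
have -> : \sum_(r | room r) #|[set e | door e & incident r e]| =
    \sum_(e | door e) #|[set r | room r & incident r e]|.
  transitivity (\sum_(r | room r) \sum_(e | door e) (incident r e : nat)).
    apply: eq_bigr => r _; rewrite -sum1_card -[in RHS]big_mkcondr /=.
    by apply: eq_bigl => e; rewrite inE.
  rewrite exchange_big /=; apply: eq_bigr => e _.
  rewrite -sum1_card -[in LHS]big_mkcondr /=.
  by apply: eq_bigl => r; rewrite inE.
have root : door (set0, [set i0]).
  rewrite /door /= !inE cards1 cards0 eqxx imset0 setDv eqxx !andbT.
  apply/dominantP => x; exists i0; rewrite ?inE // => b; by rewrite inE.
rewrite (bigD1 (set0, [set i0])) //= oddD root_door_rooms /=.
rewrite (big_morph odd oddD (erefl _)) big1 //.
move=> [D E] /andP[/and4P[/= dom i0E /eqP cD /eqP card] ne].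
have [d0|/set0Pn[d dD]] := eqVneq D set0; last by rewrite (door_rooms dD).
move: ne; rewrite d0 in card cD *; move: card; rewrite cards0 => /eqP/cards1P[i ei].
by move: i0E; rewrite ei inE => /eqP ->; rewrite eqxx.
Qed.
End Scarf.

From HB Require Import structures.
From mathcomp Require Import all_order all_algebra.
From mathcomp Require Import all_classical all_reals all_analysis.
From mathcomp Require Import measurable_realfun perm fingroup.
From mathcomp Require Import zify ring lra.
Import Order.TTheory GRing.Theory Num.Theory.
Import numFieldNormedType.Exports.
Local Open Scope classical_set_scope.
Local Open Scope ring_scope.

(** * Zeros of coercive continuous fields *)

Section Grid.
Local Open Scope nat_scope.
Variables (n m : nat) (c : {ffun 'I_n.+1 -> 'I_m.+1} -> 'I_n.+1).
Local Notation grid := {x : {ffun 'I_n.+1 -> 'I_m.+1} | \sum_i x i == m :> nat}.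

(** The coordinate is the leading digit and the enumeration rank the trailing one: ties are broken,
    so the ranking is injective and still monotone in the coordinate. *)
Definition grid_rank (i : 'I_n.+1) (x : grid) : nat := val x i * #|{: grid}| + enum_rank x.

Lemma grid_rank_inj i : injective (grid_rank i).
Proof.
move=> x y; rewrite /grid_rank => /(congr1 (modn^~ #|{: grid}|)).
by rewrite !modnMDl !modn_small ?ltn_ord // => /val_inj/enum_rank_inj.
Qed.

Lemma grid_rank_le i x y : grid_rank i x <= grid_rank i y -> val x i <= val y i.
Proof.
rewrite /grid_rank; apply: contraTT; rewrite -!ltnNge => lt.
apply: (@leq_trans ((val y i).+1 * #|{: grid}|)); last first.
  by apply: leq_trans (leq_addr _ _); rewrite leq_mul2r lt orbT.
by rewrite mulSn addnC ltn_add2r ltn_ord.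
Qed.

Lemma grid_of (v : 'I_n.+1 -> nat) : \sum_i v i = m ->
  exists x : grid, forall i, val x i = v i :> nat.
Proof.
move=> sv; pose f := [ffun i => inord (v i) : 'I_m.+1].
have fE i : f i = v i :> nat.
  by rewrite ffunE inordK // ltnS -sv (bigD1 i) //= leq_addr.
have P : \sum_i f i == m by rewrite (eq_bigr v) // sv.
by exists (exist _ f P).
Qed.

(** A grid point exceeding the minima of [B] in every coordinate of [C] would contradict dominance,
    so the minima raised by one sum to more than [m]. As [C] has at most [n.+1] indices, the minima
    themselves miss [m] by at most [n]; this slack bounds the oscillation on [C] and the size off
    [C]. *)
Lemma sperner_grid : exists (B : {set {ffun 'I_n.+1 -> 'I_m.+1}}) (C : {set 'I_n.+1}),
  [/\ forall b, b \in B -> \sum_i b i = m, c @: B = C, B != finset.set0,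
      forall b b' i, b \in B -> b' \in B -> b i <= b' i + n &
      forall b i, b \in B -> i \notin C -> b i <= n].
Proof.
have [x0 _] : exists x : grid, forall i, val x i = (if i == ord0 then m else 0) :> nat.
  by apply: grid_of; rewrite -big_mkcond /= big_pred1_eq.
have [B [C [/dominantP dom cB]]] := scarf (fun x : grid => c (val x)) ord0 x0 grid_rank_inj.
have [i1 i1C _] := dom x0.
have [b0 b0B _] : exists2 b0, b0 \in B & i1 = c (val b0).
  by move: i1C; rewrite -cB => /imsetP[b]; exists b.
pose mn i := val [arg min_(b < b0 in B) val b i] i : nat.
have mn_le i b : b \in B -> mn i <= val b i.
  by rewrite /mn; case: arg_minnP => // x _ H /H.
have mn_in i : exists2 b, b \in B & mn i = val b i.
  by rewrite /mn; case: arg_minnP => // x xB _; exists x.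
have big_mn : m < \sum_(i in C) (mn i).+1.
  rewrite ltnNge; apply/negP => le.
  (* What the raised minima leave of [m] is put on [i1], an index of [C], so [x] beats [B] in every
     ranking of [C]. *)
  have [x xE] : exists x : grid, forall i, val x i =
     (if i \in C then (mn i).+1 else 0) +
     (if i == i1 then m - \sum_(i in C) (mn i).+1 else 0) :> nat.
    by apply: grid_of; rewrite big_split /= -!big_mkcond /= big_pred1_eq subnKC.
  have [i iC H] := dom x; have [b bB eb] := mn_in i.
  have /grid_rank_le := H b bB; rewrite xE iC -eb; lia.
have cardC : #|C| <= n.+1 by rewrite -[X in _ <= X](card_ord n.+1) max_card.
have low : m <= \sum_(i in C) mn i + n.
  have : \sum_(i in C) (mn i).+1 = \sum_(i in C) mn i + #|C|.
    by rewrite -sum1_card -big_split /=; apply: eq_bigr => i _; rewrite addn1.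
  lia.
have key b : b \in B -> (forall i, i \in C -> val b i <= mn i + n) /\
    (forall i, i \notin C -> val b i <= n).
  move=> bB; have sb : \sum_i val b i = m by apply/eqP; exact: (valP b).
  have le : \sum_(i in C) mn i <= \sum_(i in C) val b i.
    by apply: leq_sum => i _; exact: mn_le.
  split=> i iC.
    have le' : \sum_(j in C | j != i) mn j <= \sum_(j in C | j != i) val b j.
      by apply: leq_sum => j _; exact: mn_le.
    have lb : \sum_(i in C) val b i <= m.
      by move: sb; rewrite (bigID (mem C)) /=; lia.
    rewrite -(leq_add2r (\sum_(j in C | j != i) val b j)).
    rewrite -(bigD1 i iC) /=; apply: (leq_trans lb); apply: (leq_trans low).
    by rewrite (bigD1 i iC) /= -!addnA leq_add2l addnC leq_add2l.
  have lb : val b i <= \sum_(j | j \notin C) val b j by rewrite (bigD1 i) //= leq_addr.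
  have sb' : \sum_(j in C) val b j + \sum_(j | j \notin C) val b j = m.
    by rewrite -[RHS]sb [RHS](bigID (mem C)).
  lia.
exists (val @: B), C; split.
- by move=> _ /imsetP[b bB ->]; apply/eqP; exact: (valP b).
- by rewrite -cB -imset_comp.
- by apply/set0Pn; exists (val b0); exact: imset_f.
- move=> _ _ i /imsetP[b bB ->] /imsetP[b' b'B ->].
  have [iC|iC] := boolP (i \in C).
    by apply: leq_trans ((key b bB).1 i iC) _; rewrite leq_add2r mn_le.
  by apply: leq_trans ((key b bB).2 i iC) _; rewrite leq_addl.
by move=> _ i /imsetP[b bB ->]; exact: (key b bB).2.
Qed.
End Grid.

Section Zero.
Variable R : realType.

Section ContinuousFun.
Variable T : topologicalType.
Implicit Types f g : T -> R.

Lemma continuous_add f g : continuous f -> continuous g -> continuous (fun t => f t + g t).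
Proof. by move=> cf cg t; apply: cvgD; [exact: cf|exact: cg]. Qed.

Lemma continuous_opp f : continuous f -> continuous (fun t => - f t).
Proof. by move=> cf t; apply: cvgN; exact: cf. Qed.

Lemma continuous_sub f g : continuous f -> continuous g -> continuous (fun t => f t - g t).
Proof. by move=> cf cg; apply: continuous_add => //; exact: continuous_opp. Qed.

Lemma continuous_mul f g : continuous f -> continuous g -> continuous (fun t => f t * g t).
Proof. by move=> cf cg t; apply: cvgM; [exact: cf|exact: cg]. Qed.

Lemma continuous_sum (J : Type) (r : seq J) (P : pred J) (F : J -> T -> R) :
  (forall j, continuous (F j)) -> continuous (fun t => \sum_(j <- r | P j) F j t).
Proof.
move=> cF; elim: r => [|j r IH].
  by under eq_fun do rewrite big_nil; exact: cst_continuous.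
under eq_fun do rewrite big_cons; case: (P j) => //; exact: continuous_add.
Qed.
End ContinuousFun.

Lemma rV_continuous (T : topologicalType) (n : nat) (f : T -> 'rV[R]_n) :
  (forall i, continuous (fun t => f t 0 i)) -> continuous f.
Proof.
move=> cf t A [P nP PA]; rewrite nbhs_filterE /=.
have : \forall z \near t, forall i, P 0 i (f z 0 i).
  apply: filter_forall => i; exact: (cf i t (P 0 i) (nP 0 i)).
by apply: filterS => z Pz; apply: PA => a i; rewrite ord1.
Qed.

Lemma rV_ball (n : nat) (x y : 'rV[R]_n) (e : R) : 0 < e ->
  (forall i, `|x 0 i - y 0 i| < e) -> ball x e y.
Proof. by move=> e0 H; split => // i j; rewrite ord1; exact: H. Qed.

(** A grid point is coloured by an index at which [H] is largest. On a grid of mesh [1/(m+1)],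
    [sperner_grid] gives a point each of whose coordinates is at most [n/(m+1)] or is the colour of
    some point within that distance. A cluster point of these as [m] grows is the solution. *)
Lemma simplex_complementarity (n : nat) (H : 'I_n.+1 -> 'rV[R]_n.+1 -> R) :
  (forall i, continuous (H i)) ->
  exists y : 'rV[R]_n.+1, [/\ forall i, 0 <= y 0 i, \sum_i y 0 i = 1 &
    forall i j, 0 < y 0 i -> H j y <= H i y].
Proof.
move=> cH.
pose col y : 'I_n.+1 := [arg max_(i > ord0) H i y]%O.
have colP y j : H j y <= H (col y) y by rewrite /col; case: arg_maxP => // i _; apply.
pose pt (m : nat) (b : {ffun 'I_n.+1 -> 'I_m.+2}) : 'rV[R]_n.+1 :=
  \row_i ((b i)%:R / m.+1%:R).
have ex (m : nat) : exists y : 'rV[R]_n.+1, [/\ forall i, 0 <= y 0 i, \sum_i y 0 i = 1 &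
    forall i, y 0 i <= n%:R / m.+1%:R \/ exists y' : 'rV[R]_n.+1,
      (forall j, `|y' 0 j - y 0 j| <= n%:R / m.+1%:R) /\ forall j, H j y' <= H i y'].
  have [B [C [sB cB /set0Pn[b bB] dB oB]]] := @sperner_grid n m.+1 (fun b => col (pt m b)).
  exists (pt m b); split.
  - by move=> i; rewrite mxE divr_ge0.
  - under eq_bigr do rewrite mxE.
    by rewrite -mulr_suml -natr_sum sB // divff // pnatr_eq0.
  move=> i; have [iC|iC] := boolP (i \in C); last first.
    by left; rewrite mxE ler_pM2r ?invr_gt0 ?ltr0Sn // ler_nat oB.
  right; move: iC; rewrite -cB => /imsetP[b' b'B ->]; exists (pt m b'); split; last exact: colP.
  move=> j; rewrite !mxE -mulrBl normrM (@ger0_norm _ (_^-1)) ?invr_ge0 //.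
  rewrite ler_pM2r ?invr_gt0 ?ltr0Sn // ler_norml.
  have := dB b b' j bB b'B; have := dB b' b j b'B bB; rewrite -!(ler_nat R) !natrD; lra.
pose u m := proj1_sig (cid (ex m)).
have uP m := proj2_sig (cid (ex m)); rewrite -/(u _) in uP.
have cpt : compact [set v : 'rV[R]_n.+1 | forall i, v ord0 i \in `[0, 1]].
  exact: (@rV_compact R n.+1 (fun=> `[0, 1]%classic) (fun _ => @segment_compact R 0 1)).
have [|y [yb cl]] := cpt (u @ \oo) _.
  exists 0%N => // m _ i; have [u0 u1 _] := uP m; rewrite in_itv /= u0 /= -u1.
  by rewrite (bigD1 i) //= lerDl sumr_ge0.
have near_y (A : set 'rV[R]_n.+1) (M : nat) : nbhs y A -> exists2 m, (M <= m)%N & A (u m).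
  move=> nA; have [|z [[m Mm <-] Az]] := cl (u @` [set m | (M <= m)%N]) A _ nA.
    by exists M => // m Mm /=; exists m.
  by exists m.
exists y; split.
- by move=> i; have := yb i; rewrite in_itv /= => /andP[].
- apply/eqP; apply: contraT => ne.
  have cs : continuous (fun z : 'rV[R]_n.+1 => \sum_i z 0 i : R).
    by apply: continuous_sum => i; exact: coord_continuous.
  have [m _] : exists2 m, (0 <= m)%N & \sum_i u m 0 i != 1.
    apply: (near_y [set z : 'rV[R]_n.+1 | \sum_i z 0 i != 1]).
    apply: (cs y [set t | t != 1]).
    by apply: open_nbhs_nbhs; split => //; exact: open_neq.
  by have [_ ->] := uP m; rewrite eqxx.
move=> i j yi; rewrite leNgt; apply/negP => lt.
have nA : nbhs y [set z : 'rV[R]_n.+1 | H i z < H j z].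
  have := continuous_sub (cH j) (cH i); move=> /(_ y [set t | 0 < t]) P.
  have : nbhs y ((fun z => H j z - H i z) @^-1` [set t | 0 < t]).
    by apply: P; apply: open_nbhs_nbhs; split; [exact: open_gt|rewrite /= subr_gt0].
  by apply: filterS => z /=; rewrite subr_gt0.
have nB : nbhs y [set z : 'rV[R]_n.+1 | y 0 i / 2 < z 0 i].
  have := @coord_continuous _ 1 n.+1 0 i y.
  move=> /(_ [set t | y 0 i / 2 < t]) P; apply: P.
  by apply: open_nbhs_nbhs; split; [exact: open_gt|rewrite /=; lra].
have /nbhs_ballP[e /= e0 eA] := nA.
(* Below [y 0 i / 2] the error excludes the alternative of a small coordinate; below [e / 2] it
   keeps the point coloured [i] where [H i < H j]. *)
have [M MP] : exists M : nat, forall m, (M <= m)%N -> n%:R / m.+1%:R < Num.min (e / 2) (y 0 i / 2).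
  have min0 : 0 < Num.min (e / 2) (y 0 i / 2) by rewrite lt_min !divr_gt0.
  exists (Num.truncn (n%:R / Num.min (e / 2) (y 0 i / 2))) => m Mm.
  rewrite ltr_pdivrMr ?ltr0Sn // mulrC -ltr_pdivrMr //.
  apply: lt_le_trans (truncnS_gt _) _; by rewrite ler_nat ltnS.
have [m Mm [um1 um2]] : exists2 m, (M <= m)%N &
    ([set z : 'rV[R]_n.+1 | ball y (e / 2) z] `&` [set z : 'rV[R]_n.+1 | y 0 i / 2 < z 0 i]) (u m).
  by apply: near_y; apply: filterI => //; apply: nbhsx_ballx; rewrite divr_gt0.
have := MP m Mm; rewrite lt_min => /andP[m1 m2].
have [_ _ /(_ i)[le|[y' [d H']]]] := uP m.
  by have := lt_trans (le_lt_trans le m2) um2; rewrite ltxx.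
have : [set z : 'rV[R]_n.+1 | H i z < H j z] y'.
  apply: eA; rewrite (splitr e); apply: (@ball_triangle _ _ (u m)) => //.
  apply: rV_ball; first by rewrite divr_gt0.
  move=> b; rewrite distrC; exact: le_lt_trans (d b) m1.
by rewrite /= ltNge H'.
Unshelve. all: by end_near.
Qed.

(** Complementarity is applied on a simplex containing the box of half-width [r], with [- F] at the
    coordinates and the value [0] at a slack vertex [ord0]. *)
Lemma coercive_zero (n : nat) (F : 'I_n -> 'rV[R]_n -> R) (r : R) : 0 < r ->
  (forall i, continuous (F i)) ->
  (forall x : 'rV[R]_n, (exists i, r <= `|x 0 i|) -> 0 <= \sum_i F i x * x 0 i) ->
  exists x, forall i, F i x = 0.
Proof.
move=> r0 cF coer.
(* As [s] exceeds [2 * r * n], a point with all [|X y 0 i| < r] has a positive slack coordinate. *)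
pose s := 2 * r * n%:R + 1.
have s0 : 0 < s by rewrite ltr_wpDl // !mulr_ge0 // ltW.
pose X (y : 'rV[R]_n.+1) : 'rV[R]_n := \row_i (s * y 0 (lift ord0 i) - r).
have cX : continuous X.
  apply: rV_continuous => i.
  have -> : (fun z : 'rV[R]_n.+1 => X z 0 i) = (fun z => s * z 0 (lift ord0 i) - r).
    by apply/funext => z; rewrite mxE.
  apply: continuous_sub; last exact: cst_continuous.
  by apply: continuous_mul; [exact: cst_continuous|exact: coord_continuous].
pose H (i : 'I_n.+1) (y : 'rV[R]_n.+1) : R := if unlift ord0 i is Some j then - F j (X y) else 0.
have cH i : continuous (H i).
  rewrite /H; case: unliftP => [j _|_]; last exact: cst_continuous.
  by apply: continuous_opp => y; apply: (@continuous_comp _ _ _ X); [exact: cX|exact: cF].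
have [y [y0 y1 yH]] := simplex_complementarity cH.
have H0 : H ord0 y = 0 by rewrite /H unlift_none.
have HS j : H (lift ord0 j) y = - F j (X y) by rewrite /H liftK.
have [i0 i0P] : exists i, 0 < y 0 i.
  apply: contrapT => /forallNP N; have : \sum_i y 0 i <= 0.
    by apply: sumr_le0 => i _; rewrite leNgt; exact/negP.
  by rewrite y1 ler10.
set M := H i0 y.
have HM i : H i y <= M by exact: yH.
have HMeq i : 0 < y 0 i -> H i y = M.
  by move=> yi; apply/eqP; rewrite eq_le HM yH.
have M0 : 0 <= M by rewrite -H0 HM.
have sH : \sum_i y 0 i * H i y = M.
  rewrite -[RHS]mul1r -y1 mulr_suml; apply: eq_bigr => i _.
  have [->|ne] := eqVneq (y 0 i) 0; first by rewrite !mul0r.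
  by rewrite HMeq // lt_neqAle eq_sym ne y0.
have FX : \sum_i F i (X y) * X y 0 i = - s * M + r * \sum_i H (lift ord0 i) y.
  rewrite -sH big_ord_recl H0 mulr0 add0r !mulr_sumr -big_split /=.
  by apply: eq_bigr => i _; rewrite HS !mxE; ring.
have sHle : \sum_i H (lift ord0 i) y <= n%:R * M.
  rewrite (le_trans (ler_sum _ (fun i _ => HM (lift ord0 i)))) //.
  by rewrite sumr_const card_ord mulr_natl.
have Mz : M = 0.
  (* A positive [M] makes the scalar product of [F] and [X y] negative, so by coercivity the point
     is inside the box. Its slack coordinate is then positive, which makes [M] equal to the slack
     value [0]. *)
  apply/eqP; apply: contraT => Mne.
  have Mpos : 0 < M by rewrite lt_neqAle eq_sym Mne.
  have neg : \sum_i F i (X y) * X y 0 i < 0.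
    have n0 : 0 <= n%:R :> R by [].
    have p : 0 <= r * (n%:R * M) by rewrite !mulr_ge0 // ltW.
    have -> : \sum_i F i (X y) * X y 0 i =
        r * \sum_i H (lift ord0 i) y - 2 * (r * (n%:R * M)) - M by rewrite FX /s; ring.
    have := ler_wpM2l (ltW r0) sHle; lra.
  have Xlt i : `|X y 0 i| < r.
    rewrite ltNge; apply/negP => le; have := coer (X y) (ex_intro _ i le).
    by rewrite leNgt neg.
  have ypos i : 0 < y 0 (lift ord0 i).
    have := Xlt i; rewrite ltr_norml mxE => /andP[+ _]; rewrite -subr_gt0 => h.
    by rewrite -(pmulr_rgt0 _ s0); lra.
  have yo : 0 < y 0 ord0.
    move: y1; rewrite big_ord_recl => /(canRL (addrK _)) ->; rewrite subr_gt0.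
    rewrite -(ltr_pM2l s0) mulr1 mulr_sumr.
    apply: (@le_lt_trans _ _ (\sum_(i < n) (2 * r))).
      apply: ler_sum => i _; have := Xlt i; rewrite ltr_norml mxE; lra.
    by rewrite sumr_const card_ord /s -[X in X < _]mulr_natr ltrDl.
  by have := HMeq _ yo; rewrite H0 => /esym/eqP; rewrite (negbTE Mne).
exists (X y) => i.
(* A nonzero component of [F] is now positive and pushes its coordinate to the wall [- r]. There
   coercivity asserts that [r] times the sum of all [- F j] is nonnegative, which is absurd. *)
have Fge j : 0 <= F j (X y) by rewrite -oppr_le0 -HS -Mz HM.
apply/eqP; apply: contraT => ne.
have yi : y 0 (lift ord0 i) = 0.
  apply/eqP; apply: contraNT ne => yne.
  by rewrite -oppr_eq0 -HS HMeq ?Mz // lt_neqAle eq_sym yne y0.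
have Xi : X y 0 i = - r by rewrite mxE yi mulr0 sub0r.
have := coer (X y); rewrite FX Mz mulr0 add0r => /(_ _)/wrap[].
  by exists i; rewrite Xi normrN ger0_norm // ltW.
rewrite pmulr_rge0 // (bigD1 i) //= leNgt => /negP[].
rewrite HS addrC -ltrBrDr sub0r opprK; apply: le_lt_trans (_ : 0 < _).
  by apply: sumr_le0 => j _; rewrite HS oppr_le0.
by rewrite lt_neqAle eq_sym ne Fge.
Unshelve. all: by end_near.
Qed.
End Zero.

(** * Galerkin systems with semidefinite forms *)

Definition subspace {R : realType} {E : lmodType R} (W : set E) :=
  W 0 /\ forall (a : R) u v, W u -> W v -> W (a *: u + v).
Definition linear_on {R : realType} {E : lmodType R} (W : set E) (f : E -> R) :=
  forall (a : R) u v, W u -> W v -> f (a *: u + v) = a * f u + f v.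

Section LinearOn.
Context {R : realType} {E : lmodType R}.
Variable W : set E.
Hypothesis sW : subspace W.

Lemma subspaceZ a u : W u -> W (a *: u).
Proof. by move=> Wu; have := sW.2 a u 0 Wu sW.1; rewrite addr0. Qed.

Lemma subspaceD u v : W u -> W v -> W (u + v).
Proof. by move=> Wu Wv; have := sW.2 1 u v Wu Wv; rewrite scale1r. Qed.

Lemma subspaceB u v : W u -> W v -> W (u - v).
Proof. by move=> Wu Wv; rewrite addrC -scaleN1r; exact: sW.2. Qed.

Lemma subspace_sum n (x : 'I_n -> R) (e : 'I_n -> E) :
  (forall i, W (e i)) -> W (\sum_i x i *: e i).
Proof. by move=> We; elim/big_ind: _ => [||i _]; [exact: sW.1|exact: subspaceD|exact: subspaceZ]. Qed.

Variable f : E -> R.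
Hypothesis lf : linear_on W f.

Lemma linear_on0 : f 0 = 0.
Proof. by have := lf (-1) sW.1 sW.1; rewrite scaler0 addr0 mulN1r addNr. Qed.

Lemma linear_onZ a u : W u -> f (a *: u) = a * f u.
Proof. by move=> Wu; have := lf a Wu sW.1; rewrite addr0 linear_on0 addr0. Qed.

Lemma linear_onD u v : W u -> W v -> f (u + v) = f u + f v.
Proof. by move=> Wu Wv; have := lf 1 Wu Wv; rewrite scale1r mul1r. Qed.

Lemma linear_on_sum n (x : 'I_n -> R) (e : 'I_n -> E) :
  (forall i, W (e i)) -> f (\sum_i x i *: e i) = \sum_i x i * f (e i).
Proof.
move=> We; elim: n x e We => [|n IH] x e We; first by rewrite !big_ord0 linear_on0.
rewrite !big_ord_recl linear_onD ?linear_onZ ?IH //; first exact: subspaceZ.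
exact: subspace_sum.
Qed.
End LinearOn.

(** * Orthonormal families for a semidefinite form *)

Section Orthonormal.
Context {R : realType} {E : lmodType R}.
Variables (W : set E) (B : E -> E -> R).
Hypothesis sW : subspace W.
Hypothesis lB : forall v, W v -> linear_on W (B ^~ v).
Hypothesis symB : forall u v, W u -> W v -> B u v = B v u.
Hypothesis psdB : forall u, W u -> 0 <= B u u.

Lemma psd_linear_r u : W u -> linear_on W (B u).
Proof. by move=> Wu a v w Wv Ww; rewrite symB ?lB // ?(symB Wu) //; exact: sW.2. Qed.

Lemma psd_null u v : W u -> W v -> B v v = 0 -> B u v = 0.
Proof.
move=> Wu Wv v0; apply/eqP; apply: contraT => ne.
have key t : 0 <= B u u + 2 * t * B u v.
  have Wtv : W (t *: v) := subspaceZ sW t Wv.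
  have Wx : W (t *: v + u) by exact: sW.2.
  have := psdB Wx; rewrite lB // !(psd_linear_r _ _ Wv Wu) // v0 (symB Wv Wu).
  by congr (0 <= _); ring.
(* This [t] turns the expression in [key] into [-1]. *)
have := key (- (B u u + 1) / (2 * B u v)).
have -> : 2 * (- (B u u + 1) / (2 * B u v)) * B u v = - (B u u + 1) by field.
lra.
Qed.

Definition orthonormal n (e : 'I_n -> E) :=
  (forall i, W (e i)) /\ forall i j, B (e i) (e j) = (i == j)%:R.

Lemma orthonormal_norm n (e : 'I_n -> E) (x y : 'I_n -> R) : orthonormal e ->
  B (\sum_i x i *: e i) (\sum_i y i *: e i) = \sum_i x i * y i.
Proof.
move=> [We oe]; rewrite (linear_on_sum sW (lB (subspace_sum sW y We))) //.
apply: eq_bigr => i _; rewrite (linear_on_sum sW (psd_linear_r (We i))) //; congr (_ * _).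
rewrite (bigD1 i) //= oe eqxx mulr1 big1 ?addr0 // => j ne.
by rewrite oe eq_sym (negbTE ne) mulr0.
Qed.

Variables (N : nat) (phi : 'I_N -> E -> R).
Hypothesis lphi : forall j, linear_on W (phi j).
Hypothesis phi0 : forall u, W u -> (forall j, phi j u = 0) -> B u u = 0.

(** With more vectors than functionals, some nontrivial combination is killed by all [phi] and so is
    null, while orthonormality makes its form value the sum of the squares of its coefficients. *)
Lemma orthonormal_bound n (e : 'I_n -> E) : orthonormal e -> (n <= N)%N.
Proof.
move=> oe; rewrite leqNgt; apply/negP => lt.
pose M : 'M[R]_(n, N) := \matrix_(i, j) phi j (e i).
have : kermx M != 0.
  by rewrite -mxrank_eq0 mxrank_ker subn_eq0 -ltnNge (leq_ltn_trans (rank_leq_col _)).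
case/rowV0Pn => x /sub_kermxP xM /eqP xne; apply: xne.
pose z := \sum_i x 0 i *: e i.
have z0 : B z z = 0.
  apply: phi0; first by apply: (subspace_sum sW); exact: oe.1.
  move=> j; rewrite (linear_on_sum sW (lphi j)) //; last exact: oe.1.
  have := congr1 (fun A : 'rV_N => A 0 j) xM; rewrite !mxE => h; rewrite -[RHS]h.
  by apply: eq_bigr => i _; rewrite mxE.
have /eqP := z0; rewrite orthonormal_norm // psumr_eq0; last by move=> i _; rewrite -expr2 sqr_ge0.
move=> /allP xi; apply/rowP => i; rewrite mxE.
by have := xi i (mem_index_enum _); rewrite mulf_eq0 orbb => /eqP.
Qed.

(** By [orthonormal_bound] a family of maximal length exists. The remainder of a vector after
    projection is null, as it could otherwise be normalised and appended. *)
Lemma orthonormal_basis : exists n (e : 'I_n -> E), orthonormal e /\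
  forall u, W u -> exists2 v, W v /\ B v v = 0 & u = \sum_i B u (e i) *: e i + v.
Proof.
pose P n := `[< exists e : 'I_n -> E, orthonormal e >].
have P0 : exists n, P n.
  exists 0%N; apply/asboolP; exists (fun=> 0); split => //; [|by case].
  by move=> i; exact: sW.1.
have Pb n : P n -> (n <= N)%N by move=> /asboolP[e /orthonormal_bound].
case: (ex_maxnP P0 Pb) => n /asboolP[e oe] nmax; exists n, e; split => // u Wu.
set p := \sum_i _; have Wp : W p := subspace_sum sW _ (proj1 oe).
exists (u - p); last by rewrite addrC subrK.
have Wv := subspaceB sW Wu Wp; split => //; apply/eqP; apply: contraT => ne.
have vpos : 0 < B (u - p) (u - p) by rewrite lt_neqAle eq_sym ne psdB.
have ve j : B (u - p) (e j) = 0.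
  have We := oe.1 j; rewrite -scaleN1r addrC lB // (linear_on_sum sW (lB We)) //; last exact: oe.1.
  rewrite (bigD1 j) //= oe.2 eqxx mulr1 big1 ?addr0; first by rewrite mulN1r addNr.
  by move=> i ij; rewrite oe.2 (negbTE ij) mulr0.
set v := u - p in Wv ne vpos ve.
pose s := (Num.sqrt (B v v))^-1.
pose e' (i : 'I_n.+1) := if unlift ord0 i is Some j then e j else s *: v.
suff /nmax : P n.+1 by rewrite ltnn.
apply/asboolP; exists e'; split => [i|i j]; rewrite /e'.
  by case: unliftP => [k _|_]; [exact: oe.1|exact: subspaceZ].
case: unliftP => [k ->|->]; case: unliftP => [k' ->|->].
- by rewrite oe.2 (inj_eq (@lift_inj _ _)).
- rewrite (symB (oe.1 k)) ?(linear_onZ sW (lB (oe.1 k))) ?ve ?mulr0 //; exact: subspaceZ.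
- by rewrite (linear_onZ sW (lB (oe.1 k'))) // ve mulr0.
have Wsv := subspaceZ sW s Wv.
rewrite (linear_onZ sW (lB Wsv)) // (linear_onZ sW (psd_linear_r Wv)) // eqxx /s.
rewrite mulrA -expr2 exprVn sqr_sqrtr ?ltW // mulVf //.
Qed.

Lemma riesz (ell : E -> R) : linear_on W ell -> (forall v, W v -> B v v = 0 -> ell v = 0) ->
  exists2 g, W g & forall v, W v -> B g v = ell v.
Proof.
move=> lell ell0; have [n [e [oe He]]] := orthonormal_basis.
exists (\sum_i ell (e i) *: e i); first by apply: (subspace_sum sW); exact: oe.1.
move=> v Wv; rewrite (linear_on_sum sW (lB Wv)); last exact: oe.1.
have [w [Ww w0] {2}->] := He v Wv.
have Ws : W (\sum_i B v (e i) *: e i) by apply: (subspace_sum sW); exact: oe.1.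
rewrite (linear_onD lell Ws Ww) (ell0 w) // addr0.
rewrite (linear_on_sum sW lell); last exact: oe.1.
by apply: eq_bigr => i _; rewrite mulrC (symB (oe.1 i)).
Qed.
End Orthonormal.

Section Galerkin.
Context {R : realType} {E1 E2 : lmodType R}.
Variables (W1 : set E1) (W2 : set E2).
Variables (a1 : E1 -> E1 -> R) (a2 : E2 -> E2 -> R).
Variables (c1 : E1 -> E1 -> E1 -> R) (c2 : E1 -> E2 -> E2 -> R) (D : E2 -> E1 -> R).
Variables (f : E1 -> R) (g : E2 -> R).
Hypotheses (sW1 : subspace W1) (sW2 : subspace W2).
Hypothesis la1 : forall v, W1 v -> linear_on W1 (a1 ^~ v).
Hypothesis la2 : forall v, W2 v -> linear_on W2 (a2 ^~ v).
Hypothesis sa1 : forall u v, W1 u -> W1 v -> a1 u v = a1 v u.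
Hypothesis sa2 : forall u v, W2 u -> W2 v -> a2 u v = a2 v u.
Hypothesis pa1 : forall u, W1 u -> 0 <= a1 u u.
Hypothesis pa2 : forall u, W2 u -> 0 <= a2 u u.
Variables (N1 N2 : nat) (phi1 : 'I_N1 -> E1 -> R) (phi2 : 'I_N2 -> E2 -> R).
Hypothesis lphi1 : forall j, linear_on W1 (phi1 j).
Hypothesis lphi2 : forall j, linear_on W2 (phi2 j).
Hypothesis phi10 : forall u, W1 u -> (forall j, phi1 j u = 0) -> a1 u u = 0.
Hypothesis phi20 : forall u, W2 u -> (forall j, phi2 j u = 0) -> a2 u u = 0.
Hypothesis lc1w : forall u v, W1 u -> W1 v -> linear_on W1 (fun w => c1 w u v).
Hypothesis lc1u : forall w v, W1 w -> W1 v -> linear_on W1 (fun u => c1 w u v).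
Hypothesis lc1v : forall w u, W1 w -> W1 u -> linear_on W1 (c1 w u).
Hypothesis lc2w : forall u v, W2 u -> W2 v -> linear_on W1 (fun w => c2 w u v).
Hypothesis lc2u : forall w v, W1 w -> W2 v -> linear_on W2 (fun u => c2 w u v).
Hypothesis lc2v : forall w u, W1 w -> W2 u -> linear_on W2 (c2 w u).
Hypothesis lDT : forall v, W1 v -> linear_on W2 (D ^~ v).
Hypothesis lDv : forall T, W2 T -> linear_on W1 (D T).
Hypothesis lf : linear_on W1 f.
Hypothesis lg : linear_on W2 g.
Hypothesis skew1 : forall w u, W1 w -> W1 u -> c1 w u u = 0.
Hypothesis skew2 : forall w T, W1 w -> W2 T -> c2 w T T = 0.
Hypothesis null1 : forall v, W1 v -> a1 v v = 0 ->
  [/\ forall w u, W1 w -> W1 u -> c1 w u v = 0, forall T, W2 T -> D T v = 0 & f v = 0].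
Hypothesis null2 : forall s, W2 s -> a2 s s = 0 ->
  (forall w T, W1 w -> W2 T -> c2 w T s = 0) /\ g s = 0.

(* The temperature equations are weighted by [lam] so that the coupling [D] is
   absorbed by the two diagonal forms. *)
Theorem galerkin_solution : exists u T, [/\ W1 u, W2 T,
  forall v, W1 v -> a1 u v + c1 u u v - D T v = f v &
  forall s, W2 s -> a2 T s + c2 u T s = g s].
Proof.
have [n1 [e1 [on1 b1]]] := orthonormal_basis sW1 la1 sa1 pa1 lphi1 phi10.
have [n2 [e2 [on2 b2]]] := orthonormal_basis sW2 la2 sa2 pa2 lphi2 phi20.
have [We1 _] := on1; have [We2 _] := on2.
pose SD := \sum_i \sum_j D (e2 j) (e1 i) ^+ 2.
pose C := n2.+1%:R * SD.
(* In the bound for [D], the squared temperature coefficients carry the factor [C]; with this weight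
   that term is at most a quarter of the weighted temperature diffusion. *)
pose lam := 4 * C + 1.
have SD0 : 0 <= SD by apply: sumr_ge0 => i _; apply: sumr_ge0 => j _; exact: sqr_ge0.
have C0 : 0 <= C by rewrite mulr_ge0.
have lam0 : 0 < lam by rewrite /lam; lra.
pose U (z : 'rV[R]_(n1 + n2)) := \sum_i z 0 (lshift n2 i) *: e1 i.
pose T (z : 'rV[R]_(n1 + n2)) := \sum_i z 0 (rshift n1 i) *: e2 i.
have WU z : W1 (U z) by apply: (subspace_sum sW1); exact: We1.
have WT z : W2 (T z) by apply: (subspace_sum sW2); exact: We2.
pose G1 z v := a1 (U z) v + c1 (U z) (U z) v - D (T z) v - f v.
pose G2 z s := a2 (T z) s + c2 (U z) (T z) s - g s.
pose F (k : 'I_(n1 + n2)) z := match fintype.split k with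
  | inl i => G1 z (e1 i) | inr j => lam * G2 z (e2 j) end.
have cU h : linear_on W1 h -> continuous (fun z => h (U z)).
  move=> lh; under eq_fun do rewrite (linear_on_sum sW1 lh) //.
  by apply: continuous_sum => i; apply: continuous_mul; [exact: coord_continuous|exact: cst_continuous].
have cT h : linear_on W2 h -> continuous (fun z => h (T z)).
  move=> lh; under eq_fun do rewrite (linear_on_sum sW2 lh) //.
  by apply: continuous_sum => i; apply: continuous_mul; [exact: coord_continuous|exact: cst_continuous].
have cF k : continuous (F k).
  rewrite /F; case: (fintype.split k) => [i|j].
    rewrite /G1; apply: continuous_sub; last exact: cst_continuous.
    apply: continuous_sub; last by apply: (cT (D ^~ _)); exact: lDT.
    apply: continuous_add; first by apply: (cU (a1 ^~ _)); exact: la1.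
    under eq_fun do rewrite [X in c1 X]/U (linear_on_sum sW1 (lc1w (WU _) (We1 i))) //.
    apply: continuous_sum => i'; apply: continuous_mul; first exact: coord_continuous.
    by apply: (cU (fun u => c1 _ u _)); exact: lc1u.
  rewrite /G2; apply: continuous_mul; first exact: cst_continuous.
  apply: continuous_sub; last exact: cst_continuous.
  apply: continuous_add; first by apply: (cT (a2 ^~ _)); exact: la2.
  under eq_fun do rewrite [X in c2 X]/U (linear_on_sum sW1 (lc2w (WT _) (We2 j))) //.
  apply: continuous_sum => i'; apply: continuous_mul; first exact: coord_continuous.
  by apply: (cT (fun u => c2 _ u _)); exact: lc2u.
have lG1 z : linear_on W1 (fun v => G1 z v + f v).
  move=> a u v Wu Wv; rewrite /G1.
  rewrite (psd_linear_r sW1 la1 sa1 (WU z)) // lc1v // lDv // lf //; ring.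
have lG2 z : linear_on W2 (fun v => G2 z v + g v).
  move=> a u v Wu Wv; rewrite /G2.
  rewrite (psd_linear_r sW2 la2 sa2 (WT z)) // lc2v // lg //; ring.
have lG1' z : linear_on W1 (G1 z).
  move=> a u v Wu Wv; have := lG1 z a u v Wu Wv; rewrite lf // => h.
  apply: (addIr (a * f u + f v)); rewrite h; ring.
have lG2' z : linear_on W2 (G2 z).
  move=> a u v Wu Wv; have := lG2 z a u v Wu Wv; rewrite lg // => h.
  apply: (addIr (a * g u + g v)); rewrite h; ring.
pose K := \sum_i f (e1 i) ^+ 2 + lam * \sum_j g (e2 j) ^+ 2.
have K0 : 0 <= K.
  rewrite addr_ge0 ?mulr_ge0 ?(ltW lam0) //; apply: sumr_ge0 => *; exact: sqr_ge0.
have FL z i : F (lshift n2 i) z = G1 z (e1 i).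
  by rewrite /F -[lshift _ _]/(unsplit (inl i)) unsplitK.
have FR z j : F (rshift n1 j) z = lam * G2 z (e2 j).
  by rewrite /F -[rshift _ _]/(unsplit (inr j)) unsplitK.
have energy (z : 'rV[R]_(n1 + n2)) : \sum_k F k z * z 0 k >=
    2^-1 * (\sum_i z 0 (lshift n2 i) ^+ 2 + \sum_j z 0 (rshift n1 j) ^+ 2) - K.
  rewrite big_split_ord /=.
  have -> : \sum_i F (lshift n2 i) z * z 0 (lshift n2 i) =
      \sum_i z 0 (lshift n2 i) * G1 z (e1 i).
    by apply: eq_bigr => i _; rewrite FL mulrC.
  have -> : \sum_i F (rshift n1 i) z * z 0 (rshift n1 i) =
      \sum_i lam * (z 0 (rshift n1 i) * G2 z (e2 i)).
    by apply: eq_bigr => i _; rewrite FR mulrC mulrCA.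
  rewrite -mulr_sumr -(linear_on_sum sW1 (lG1' z)) // -(linear_on_sum sW2 (lG2' z)) //.
  rewrite -/(U z) -/(T z) /G1 /G2 skew1 // skew2 // !addr0.
  have -> := orthonormal_norm sW1 la1 sa1 (fun i => z 0 (lshift n2 i)) (fun i => z 0 (lshift n2 i)) on1.
  have -> := orthonormal_norm sW2 la2 sa2 (fun i => z 0 (rshift n1 i)) (fun i => z 0 (rshift n1 i)) on2.
  set X := \sum_i z 0 (lshift n2 i) ^+ 2; set Y := \sum_j z 0 (rshift n1 j) ^+ 2.
  have Y0 : 0 <= Y by apply: sumr_ge0 => *; exact: sqr_ge0.
  have X0 : 0 <= X by apply: sumr_ge0 => *; exact: sqr_ge0.
  have fU : f (U z) <= 4^-1 * X + \sum_i f (e1 i) ^+ 2.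
    rewrite (linear_on_sum sW1 lf) // mulr_sumr -big_split /=; apply: ler_sum => i _.
    have := sqr_ge0 (2^-1 * z 0 (lshift n2 i) - f (e1 i)); nra.
  have gT : g (T z) <= 4^-1 * Y + \sum_j g (e2 j) ^+ 2.
    rewrite (linear_on_sum sW2 lg) // mulr_sumr -big_split /=; apply: ler_sum => i _.
    have := sqr_ge0 (2^-1 * z 0 (rshift n1 i) - g (e2 i)); nra.
  have DTU : D (T z) (U z) <= 4^-1 * X + C * Y.
    rewrite (linear_on_sum sW1 (lDv (WT z))) //.
    have n2p : 0 < n2.+1%:R :> R by [].
    (* Each square is cut into one share per basis temperature and a spare one, so that the division
       makes sense even for [n2 = 0]; the spare share is dropped below. *)
    have -> : 4^-1 * X = \sum_i \sum_(j < n2.+1) (4 * n2.+1%:R)^-1 * z 0 (lshift n2 i) ^+ 2.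
      rewrite mulr_sumr; apply: eq_bigr => i _; rewrite sumr_const card_ord -[RHS]mulr_natr; field.
      by rewrite gt_eqF.
    rewrite /C /SD [_ * Y]mulrAC mulr_sumr -big_split /=; apply: ler_sum => i _.
    rewrite (linear_on_sum sW2 (lDT (We1 i))) // mulr_sumr mulr_sumr.
    rewrite big_ord_recl -addrA ler_wpDl //.
      by apply: mulr_ge0; [rewrite invr_ge0 mulr_ge0|exact: sqr_ge0].
    rewrite -big_split /=; apply: ler_sum => j _.
    set x := z 0 (lshift n2 i); set d := D _ _.
    have yY : z 0 (rshift n1 j) ^+ 2 <= Y.
      by rewrite /Y (bigD1 j) //= lerDl sumr_ge0 // => *; exact: sqr_ge0.
    set y := z 0 (rshift n1 j) in yY *.
    apply: (@le_trans _ _ ((4 * n2.+1%:R)^-1 * x ^+ 2 + n2.+1%:R * y ^+ 2 * d ^+ 2)).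
      rewrite -subr_ge0.
      have -> : (4 * n2.+1%:R)^-1 * x ^+ 2 + n2.+1%:R * y ^+ 2 * d ^+ 2 - x * (y * d) =
        n2.+1%:R * ((2 * n2.+1%:R)^-1 * x - y * d) ^+ 2 by field; rewrite gt_eqF.
      by apply: mulr_ge0; [exact: ltW|exact: sqr_ge0].
    by rewrite lerD2l ler_wpM2r ?sqr_ge0 // ler_wpM2l.
  have lY : C * Y <= 4^-1 * (lam * Y).
    by rewrite /lam mulrA ler_wpM2r //; lra.
  have lYge : Y <= lam * Y by rewrite ler_peMl // /lam; lra.
  have := ler_wpM2l (ltW lam0) gT; rewrite /K !mulrDr mulrCA; lra.
(* Half the square of [2 * K + 1] exceeds [K], so [energy] is nonnegative as soon as one coordinate
   reaches this size. *)
have r0 : 0 < 2 * K + 1 by lra.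
have [|z Fz] := coercive_zero r0 cF.
  move=> z [k rk]; apply: le_trans (energy z).
  have : (2 * K + 1) ^+ 2 <= \sum_i z 0 (lshift n2 i) ^+ 2 + \sum_j z 0 (rshift n1 j) ^+ 2.
    have -> : \sum_i z 0 (lshift n2 i) ^+ 2 + \sum_j z 0 (rshift n1 j) ^+ 2 = \sum_k z 0 k ^+ 2.
      by rewrite [RHS]big_split_ord.
    rewrite (bigD1 k) //=.
    rewrite ler_wpDr ?sumr_ge0 // => [*|]; first exact: sqr_ge0.
    rewrite -(@ger0_norm _ (z 0 k ^+ 2)) ?sqr_ge0 // normrX.
    by rewrite ler_sqr ?nnegrE // ltW.
  nra.
exists (U z), (T z); split => // [v Wv|s Ws].
  suff : G1 z v = 0 by move/eqP; rewrite /G1 subr_eq0 => /eqP.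
  (* A test function is a combination of basis vectors, for which the equations are [Fz], plus a
     null vector, on which every term vanishes. *)
  have [w [Ww w0] ->] := b1 v Wv.
  have [n1c n1D n1f] := null1 Ww w0.
  rewrite (linear_onD (lG1' z)) //; last by apply: (subspace_sum sW1); exact: We1.
  rewrite {2}/G1 n1c // n1D // n1f (psd_null sW1 la1 sa1 pa1) // !subr0 !addr0.
  rewrite (linear_on_sum sW1 (lG1' z)) // big1 // => i _.
  by have := Fz (lshift n2 i); rewrite FL => ->; rewrite mulr0.
suff : G2 z s = 0 by move/eqP; rewrite /G2 subr_eq0 => /eqP.
have [w [Ww w0] ->] := b2 s Ws.
have [n2c n2g] := null2 Ww w0.
rewrite (linear_onD (lG2' z)) //; last by apply: (subspace_sum sW2); exact: We2.
rewrite {2}/G2 n2c // n2g (psd_null sW2 la2 sa2 pa2) // !subr0 !addr0.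
rewrite (linear_on_sum sW2 (lG2' z)) // big1 // => i _.
have /eqP := Fz (rshift n1 i); rewrite FR mulf_eq0 (gt_eqF lam0) /= => /eqP ->.
by rewrite mulr0.
Qed.
End Galerkin.

(** * Lebesgue measure in coordinates *)

Definition scales {R : realType} d (T : measurableType d) (mu : set T -> \bar R)
    (phi : T -> T) (c : R) :=
  measurable_fun setT phi /\
  forall A, measurable A -> mu (phi @^-1` A) = (c%:E * mu A)%E.

(* [pt] transports [mu] to a measure on R^n sharing these properties with Lebesgue measure:
   the integrals live on iterated products of R, not on row vectors. *)
Record coord_measure {R : realType} (n : nat) d (T : measurableType d)
    (mu : set T -> \bar R) (pt : T -> 'rV[R]_n) : Prop := {
  cm_bij : bijective pt ;
  cm_coord : forall i, measurable_fun setT (fun t => pt t 0 i) ;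
  cm_gen : forall d' (S : measurableType d') (phi : S -> T),
    (forall i, measurable_fun setT (fun s => pt (phi s) 0 i)) -> measurable_fun setT phi ;
  cm_affine : forall (M : 'M[R]_n) b, M \in unitmx ->
    exists2 phi, forall t, pt (phi t) = pt t *m M + b & scales mu phi `|\det M|^-1 ;
  cm_box : forall (c : 'rV[R]_n) r, 0 < r ->
    (0 < mu [set t | forall i, (`|pt t 0 i - c 0 i| < r)%R] < +oo)%E ;
  cm_hyperplane : forall (a : 'cV[R]_n) b, a != 0 ->
    mu [set t | (pt t *m a) 0 0 = b] = 0%E }.

Section Scales.
Context {R : realType} d (T : measurableType d) (mu : set T -> \bar R).

Lemma measurable_preimage (phi : T -> T) A :
  measurable_fun setT phi -> measurable A -> measurable (phi @^-1` A).
Proof. by move=> mphi mA; rewrite -[X in measurable X]setTI; exact: mphi. Qed.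

Lemma scales_comp (phi psi : T -> T) c c' :
  scales mu phi c -> scales mu psi c' -> scales mu (psi \o phi) (c * c').
Proof.
move=> [mp sp] [mq sq]; split; first exact: measurableT_comp.
move=> A mA; rewrite comp_preimage sp; last exact: measurable_preimage.
by rewrite sq // muleA EFinM.
Qed.
End Scales.

Section LebesgueAffine.
Context {R : realType}.
Local Notation leb := (@lebesgue_measure R).

Lemma measurable_affine (a b : R) : measurable_fun [set: R] (fun z => a * z + b).
Proof. by apply: measurable_funD => //; exact: measurable_funM. Qed.

(** By uniqueness of Lebesgue measure only half-open intervals need be compared. A negative slope
    exchanges the open and the closed end, which leaves the length unchanged. *)
Lemma scales_lebesgue (a b : R) : a != 0 ->
  @scales R _ (measurableTypeR R) leb (fun z => a * z + b) `|a|^-1.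
Proof.
move=> a0; split; first exact: measurable_affine.
pose k : {nonneg R} := NngNum (normr_ge0 a).
pose nu : {measure set (measurableTypeR R) -> \bar R} :=
  mscale k (measure_function_pushforward__canonical__measure_function_Measure
    leb (measurable_affine a b : @measurable_fun _ _ (measurableTypeR R) (measurableTypeR R) _ _)).
have key A : measurable A -> leb A = nu A.
  apply: lebesgue_measure_unique => X /ocitvP[->|[[x y] /= xy ->]]; first by rewrite !measure0.
  rewrite /nu /mscale /= /pushforward lebesgue_measure_itv /= lte_fin xy.
  have [ap|an|/eqP] := ltgtP a 0; last by rewrite (negbTE a0).
    have -> : (fun z => a * z + b) @^-1` `]x, y] = `[((y - b) / a), ((x - b) / a)[%classic.
      apply/seteqP; split => z /=; rewrite !in_itv /= ler_ndivrMr // ltr_ndivlMr //;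
        rewrite [z * a]mulrC; lra.
    rewrite lebesgue_measure_itv /= lte_fin ltr_nM2r ?invr_lt0 // ltrD2r xy.
    by rewrite -!EFinB -EFinM ltr0_norm //; congr (_%:E); field.
  have -> : (fun z => a * z + b) @^-1` `]x, y] = `]((x - b) / a), ((y - b) / a)]%classic.
    apply/seteqP; split => z /=; rewrite !in_itv /= ltr_pdivrMr // ler_pdivlMr //;
      rewrite [z * a]mulrC; lra.
  rewrite lebesgue_measure_itv /= lte_fin ltr_pM2r ?invr_gt0 // ltrD2r xy.
  by rewrite -!EFinB -EFinM gtr0_norm //; congr (_%:E); field; rewrite gt_eqF.
move=> A mA; rewrite [in RHS](key A mA) /nu /mscale /= /pushforward muleA -EFinM mulVf ?mul1e //.
by rewrite normr_eq0.
Qed.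

Lemma coord_measure1 : @coord_measure R 1 _ (measurableTypeR R) leb pt1.
Proof.
split.
- exists (fun x : 'rV[R]_1 => x 0 0); first by move=> t; rewrite mxE.
  by move=> x; apply/rowP => i; rewrite mxE ord1.
- by move=> i; under eq_fun do rewrite mxE; exact: measurable_id.
- move=> d' S phi /(_ ord0); by under eq_fun do rewrite mxE.
- move=> M b; rewrite unitmxE det_mx11 unitfE => M0.
  exists (fun t => M 0 0 * t + b 0 0); last exact: scales_lebesgue.
  move=> t; apply/rowP => i; rewrite ord1 !mxE big_ord1 !mxE mulrC //.
- move=> c r r0.
  have -> : [set t | forall i, `|pt1 t 0 i - c 0 i| < r] = `](c 0 0 - r), (c 0 0 + r)[%classic.
    apply/seteqP; split => z /=; rewrite in_itv /=.
      by move=> /(_ ord0); rewrite mxE ltr_distl.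
    by move=> h i; rewrite ord1 mxE ltr_distl.
  rewrite lebesgue_measure_itv /= lte_fin.
  have -> : c 0 0 - r < c 0 0 + r by lra.
  rewrite -EFinB lte_fin ltry andbT; lra.
- move=> a b a0.
  have a00 : a 0 0 != 0.
    by apply: contraNneq a0 => h; apply/eqP/colP => i; rewrite ord1 h mxE.
  have -> : [set t | (pt1 t *m a) 0 0 = b] = [set b / a 0 0].
    apply/seteqP; split => z /=; rewrite mxE big_ord1 mxE.
      by move=> <-; rewrite mulfK.
    by move=> ->; rewrite divfK.
  exact: lebesgue_measure_set1.
Qed.
End LebesgueAffine.

Lemma xsection_set (T1 T2 : Type) (A : set (T1 * T2)) x : xsection A x = [set y | A (x, y)].
Proof. by apply/seteqP; split => y; rewrite /xsection /= in_setE. Qed.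

Lemma ysection_set (T1 T2 : Type) (A : set (T1 * T2)) y : ysection A y = [set x | A (x, y)].
Proof. by apply/seteqP; split => x; rewrite /ysection /= in_setE. Qed.

(** * Adding one coordinate by a product with the line *)

Section Product.
Context {R : realType} d (T : measurableType d) (mu : {sigma_finite_measure set T -> \bar R}).
Local Notation leb := (@lebesgue_measure R).
Local Notation TR := (T * measurableTypeR R)%type.
Local Notation muR := (mu \x leb)%E.

(** It allows slicing along either factor. *)
Lemma product_measure12 A : measurable A -> muR A = (mu \x^ leb)%E A.
Proof.
move=> mA; apply: product_measure_unique => // B C mB mC.
by rewrite /= product_measure2E.
Qed.

Lemma scales_fiber1 (psi : R -> T -> T) c :
  measurable_fun [set: TR] (fun x : TR => (psi x.2 x.1, x.2) : TR) ->
  (forall z, scales mu (psi z) c) -> 0 <= c ->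
  scales muR (fun x : TR => (psi x.2 x.1, x.2) : TR) c.
Proof.
move=> mphi sc c0; split=> // A mA.
have mB : measurable ((fun x : TR => (psi x.2 x.1, x.2) : TR) @^-1` A) by exact: measurable_preimage.
rewrite !product_measure12 // /product_measure2.
rewrite -ge0_integralZl //=; last exact: measurable_fun_ysection.
apply: eq_integral => z _ /=.
have <- := (sc z).2 _ (measurable_ysection z mA).
by rewrite /= !ysection_set.
Qed.

Lemma scales_fiber2 (chi : T -> R -> R) c :
  measurable_fun [set: TR] (fun x : TR => (x.1, chi x.1 x.2) : TR) ->
  (forall p, scales leb (chi p : measurableTypeR R -> measurableTypeR R) c) -> 0 <= c ->
  scales muR (fun x : TR => (x.1, chi x.1 x.2) : TR) c.
Proof.
move=> mphi sc c0; split=> // A mA.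
have mB : measurable ((fun x : TR => (x.1, chi x.1 x.2) : TR) @^-1` A) by exact: measurable_preimage.
rewrite /product_measure1.
rewrite -ge0_integralZl //=; last exact: measurable_fun_xsection.
apply: eq_integral => z _ /=.
have <- := (sc z).2 _ (measurable_xsection z mA).
by rewrite /= !xsection_set.
Qed.

Variables (n : nat) (pt : T -> 'rV[R]_n).
Hypothesis cm : coord_measure mu pt.

(** The factor multiplied last becomes coordinate zero, so that matrices split into blocks with a
    scalar in the upper left corner, ready for elimination. *)
Definition cons_pt (x : TR) : 'rV[R]_(1 + n) := row_mx (x.2)%:M (pt x.1).

Let mcoord (S : Type) (f : S -> T) i s : cons_pt (f s, 0) 0 (rshift 1 i) = pt (f s) 0 i.
Proof. by rewrite /cons_pt row_mxEr. Qed.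

Lemma cons_pt_gen d' (S : measurableType d') (phi : S -> TR) :
  (forall i, measurable_fun setT (fun s => cons_pt (phi s) 0 i)) -> measurable_fun setT phi.
Proof.
move=> H; apply/measurable_fun_pairP; split.
  apply: (cm_gen cm) => i; have := H (rshift 1 i).
  by under eq_fun do rewrite /cons_pt row_mxEr.
have := H (lshift n 0); under eq_fun do rewrite /cons_pt row_mxEl mxE eqxx mulr1n.
by [].
Qed.

Lemma cons_pt_coord i : measurable_fun setT (fun t => cons_pt t 0 i).
Proof.
rewrite /cons_pt; case: (split_ordP i) => j ->.
  by under eq_fun do rewrite row_mxEl ord1 mxE eqxx mulr1n; exact: measurable_snd.
under eq_fun do rewrite row_mxEr.
by apply: (measurableT_comp (cm_coord cm j)); exact: measurable_fst.
Qed.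

Definition affine_ok (M : 'M[R]_(1 + n)) b :=
  exists2 phi, forall t, cons_pt (phi t) = cons_pt t *m M + b & scales muR phi `|\det M|^-1.

Lemma affine_ok_comp M b M' b' : affine_ok M b -> affine_ok M' b' ->
  affine_ok (M *m M') (b *m M' + b').
Proof.
move=> [phi e s] [psi e' s']; exists (psi \o phi).
  by move=> t; rewrite /= e' e mulmxDl mulmxA addrA.
by rewrite det_mulmx normrM invfM; exact: scales_comp.
Qed.

Lemma measurable_row_affine d' (S : measurableType d') m (f : S -> 'rV[R]_m) p
    (M : 'M[R]_(m, p)) (b : 'rV[R]_p) :
  (forall i, measurable_fun setT (fun s => f s 0 i)) ->
  forall i, measurable_fun setT (fun s => (f s *m M + b) 0 i).
Proof.
move=> mf i; under eq_fun do rewrite !mxE.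
apply: measurable_funD => //; apply: measurable_sum => j; exact: measurable_funM.
Qed.

Lemma affine_ok_measurable (phi : TR -> TR) M b :
  (forall t, cons_pt (phi t) = cons_pt t *m M + b) -> measurable_fun setT phi.
Proof.
move=> e; apply: cons_pt_gen => i; under eq_fun do rewrite e.
by apply: (measurable_row_affine M b); exact: cons_pt_coord.
Qed.

Lemma affine_ok_upper (u : 'rV[R]_n) (B : 'M[R]_n) (b : 'rV[R]_n) : B \in unitmx ->
  affine_ok (block_mx 1%:M u 0 B) (row_mx 0 b).
Proof.
move=> uB; have [g gK Kg] := cm_bij cm.
have e (t : TR) : cons_pt (g (pt t.1 *m B + (t.2 *: u + b)), t.2) =
    cons_pt t *m block_mx 1%:M u 0 B + row_mx 0 b.
  rewrite /cons_pt /= Kg mul_row_block mulmx1 mulmx0 addr0 add_row_mx addr0.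
  by rewrite mul_scalar_mx addrA [_ + t.2 *: u]addrC.
exists (fun t : TR => (g (pt t.1 *m B + (t.2 *: u + b)), t.2)) => //.
rewrite det_ublock det1 mul1r.
apply: (@scales_fiber1 (fun z p => g (pt p *m B + (z *: u + b)))).
- exact: affine_ok_measurable e.
- move=> z; have [phi ep sp] := cm_affine cm (z *: u + b) uB.
  suff -> : (fun p => g (pt p *m B + (z *: u + b))) = phi by [].
  by apply/funext => p; rewrite -ep gK.
- by rewrite invr_ge0.
Qed.

Lemma affine_ok_lower (a : R) (v : 'cV[R]_n) (b : R) : a != 0 ->
  affine_ok (block_mx a%:M 0 v 1%:M) (row_mx b%:M 0).
Proof.
move=> a0.
have e (t : TR) : cons_pt (t.1, a * t.2 + ((pt t.1 *m v) 0 0 + b)) =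
    cons_pt t *m block_mx a%:M 0 v 1%:M + row_mx b%:M 0.
  rewrite /cons_pt /= mul_row_block mulmx1 mulmx0 add0r add_row_mx addr0; congr row_mx.
  apply/rowP => i; rewrite ord1 -scalar_mxM !mxE eqxx !mulr1n.
  by rewrite mulrC addrA; congr (_ + _ + _).
exists (fun t : TR => (t.1, a * t.2 + ((pt t.1 *m v) 0 0 + b))) => //.
rewrite det_lblock det1 mulr1 det_scalar1.
apply: (@scales_fiber2 (fun p z => a * z + ((pt p *m v) 0 0 + b))).
- exact: affine_ok_measurable e.
- by move=> p; exact: scales_lebesgue.
- by rewrite invr_ge0.
Qed.

(** One step of Gaussian elimination, with Schur complement [B]. Each triangular factor moves only
    one component of the product, so slicing reduces it to a scaling already known. *)
Lemma affine_ok_pivot (a : R) u v A (b : 'rV[R]_(1 + n)) : a != 0 ->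
  block_mx a%:M u v A \in unitmx -> affine_ok (block_mx a%:M u v A) b.
Proof.
move=> a0; set B := A - v *m (a^-1 *: u).
have e : block_mx a%:M u v A = block_mx a%:M 0 v 1%:M *m block_mx 1%:M (a^-1 *: u) 0 B.
  rewrite mulmx_block !mulmx1 !mulmx0 !mul0mx !addr0 !mul1mx mul_scalar_mx.
  by rewrite scalerA divff // scale1r /B addrC subrK.
rewrite e unitmx_mul => /andP[_].
rewrite unitmxE det_ublock det1 mul1r -unitmxE => uB.
set b0 := b 0 (lshift n 0).
have -> : b = row_mx b0%:M 0 *m block_mx 1%:M (a^-1 *: u) 0 B +
    row_mx 0 (rsubmx b - b0%:M *m (a^-1 *: u)).
  rewrite mul_row_block mulmx1 !mul0mx !addr0 add_row_mx addr0.
  rewrite addrC subrK -[LHS]hsubmxK; congr row_mx.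
  by apply/rowP => i; rewrite ord1 !mxE eqxx mulr1n.
by apply: affine_ok_comp; [exact: affine_ok_lower|exact: affine_ok_upper].
Qed.

(** If the pivot vanishes, another entry of the first column does not, and the transvection [S 1]
    adds its row to the first one. Transvections are covered by [affine_ok_upper]. *)
Lemma affine_okP M b : M \in unitmx -> affine_ok M b.
Proof.
move=> uM; have [a0|a0] := eqVneq (M (lshift n 0) (lshift n 0)) 0; last first.
  rewrite -[M]submxK [ulsubmx M]mx11_scalar in uM *.
  by apply: affine_ok_pivot => //; rewrite !mxE.
have [j vj] : exists j : 'I_n, M (rshift 1 j) (lshift n 0) != 0.
  apply: contrapT => /forallNP N; move: uM; rewrite unitmxE unitfE => /negP; apply.
  apply/eqP; have := expand_det_col M (lshift n 0); rewrite big_split_ord /= big_ord1.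
  rewrite a0 mul0r add0r => ->; apply: big1 => i _.
  by have /negP/negPn/eqP -> := N i; rewrite mul0r.
pose S (z : R) := block_mx 1%:M (z *: delta_mx 0 j) 0 1%:M : 'M[R]_(1 + n).
have -> : M = S (-1) *m (S 1 *m M).
  rewrite mulmxA /S mulmx_block !mulmx1 !mulmx0 !mul0mx !mul1mx !addr0 add0r.
  by rewrite scaleN1r scale1r subrr -scalar_mx_block mul1mx.
set M' := S 1 *m M.
have uM' : M' \in unitmx.
  by rewrite unitmx_mul uM andbT unitmxE det_ublock !det1 mulr1 unitr1.
have : affine_ok M' b.
  have M'0 : ulsubmx M' 0 0 = M (rshift 1 j) (lshift n 0).
    have -> : ulsubmx M' = ulsubmx M + delta_mx 0 j *m dlsubmx M.
      by rewrite /M' /S -{1}[M]submxK mulmx_block block_mxKul mul1mx scale1r.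
    rewrite -rowE !mxE a0 add0r //.
  have := uM'; rewrite -[M']submxK [ulsubmx M']mx11_scalar => uM''.
  by apply: affine_ok_pivot => //; rewrite M'0.
have : affine_ok (S (-1)) (row_mx 0 0) by apply: affine_ok_upper; exact: unitmx1.
move=> h1 h2; have := affine_ok_comp h1 h2.
by rewrite row_mx0 mul0mx add0r.
Qed.

Lemma coord_measure_cons : coord_measure muR cons_pt.
Proof.
split.
- have [g gK Kg] := cm_bij cm.
  exists (fun x => (g (rsubmx x), x 0 (lshift n 0))).
    move=> [p z]; rewrite /cons_pt row_mxKr gK row_mxEl mxE eqxx mulr1n //.
  move=> x; rewrite /cons_pt Kg /= -[RHS]hsubmxK; congr row_mx.
  by apply/rowP => i; rewrite ord1 !mxE eqxx mulr1n.
- exact: cons_pt_coord.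
- exact: cons_pt_gen.
- exact: affine_okP.
- move=> c r r0.
  have -> : [set t | forall i, `|cons_pt t 0 i - c 0 i| < r] =
     [set p | forall i, `|pt p 0 i - (rsubmx c) 0 i| < r] `*`
     [set z : measurableTypeR R | forall i, `|pt1 z 0 i - (lsubmx c) 0 i| < r].
    apply/seteqP; split => [[p z] /= H|[p z] /= [H1 H2] i].
      split=> i; first by have := H (rshift 1 i); rewrite /cons_pt row_mxEr mxE.
      by have := H (lshift n 0); rewrite /cons_pt row_mxEl ord1 !mxE eqxx mulr1n.
    case: (split_ordP i) => j ->; last by rewrite /cons_pt row_mxEr; have := H1 j; rewrite mxE.
    by rewrite /cons_pt row_mxEl; have := H2 j; rewrite ord1 !mxE eqxx mulr1n.
  have mbox d' (S : measurableType d') m (f : S -> 'rV[R]_m) (c' : 'rV[R]_m) :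
      (forall i, measurable_fun setT (fun t => f t 0 i)) ->
      measurable [set t | forall i, `|f t 0 i - c' 0 i| < r].
    move=> mf.
    have -> : [set t | forall i, `|f t 0 i - c' 0 i| < r] =
       \bigcap_(i in [set: 'I_m]) ((fun t => `|f t 0 i - c' 0 i|) @^-1` `]-oo, r[).
      apply/seteqP; split => t H i; first by move=> _ /=; rewrite in_itv /= H.
      by have := H i I; rewrite /= in_itv.
    apply: fin_bigcap_measurable => // i _; rewrite -[X in measurable X]setTI.
    have : measurable_fun setT (fun t => `|f t 0 i - c' 0 i|).
      by apply: measurableT_comp => //; exact: measurable_funB.
    by apply => //; exact: measurable_itv.
  rewrite product_measure1E; last 2 first.
  + exact/mbox/(cm_coord cm).
  + by apply: mbox; exact: (cm_coord coord_measure1).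
  have /andP[l1 u1] := cm_box cm (rsubmx c) r0.
  have /andP[l2 u2] := cm_box coord_measure1 (lsubmx c) r0.
  by rewrite mule_gt0 // lte_mul_pinfty // ?(ltW l1) // ge0_fin_numE // ltW.
- move=> a b a0.
  have mH : measurable [set t | (cons_pt t *m a) 0 0 = b].
    have mf : measurable_fun setT (fun t => (cons_pt t *m a + 0) 0 0).
      exact: (measurable_row_affine _ _ cons_pt_coord).
    have -> : [set t | (cons_pt t *m a) 0 0 = b] = setT `&` (fun t => (cons_pt t *m a + 0) 0 0) @^-1` [set b].
      by rewrite setTI; apply/seteqP; split => t /=; rewrite addr0.
    exact: mf.
  have eqn t : (cons_pt t *m a) 0 0 = t.2 * a (lshift n 0) 0 + (pt t.1 *m dsubmx a) 0 0.
    rewrite /cons_pt -{1}[a]vsubmxK mul_row_col !mxE; congr (_ + _).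
    by rewrite big_ord1 !mxE eqxx mulr1n.
  (* If the equation does not involve the new coordinate, its slices are hyperplanes of [T];
     otherwise every line in the new direction meets it in one point. *)
  have [al|al] := eqVneq (a (lshift n 0) 0) 0.
    have a'0 : dsubmx a != 0.
      apply: contraNneq a0 => h; apply/eqP; rewrite -[a]vsubmxK h.
      have -> : usubmx a = 0 by apply/colP => i; rewrite ord1 !mxE.
      by rewrite col_mx0.
    rewrite product_measure12 // /product_measure2 integral0_eq // => z _ /=.
    rewrite -(cm_hyperplane cm b a'0); congr (mu _).
    by rewrite ysection_set; apply/seteqP; split => p /=; rewrite eqn al mulr0 add0r.
  rewrite /product_measure1 integral0_eq // => p _ /=.
  rewrite -(lebesgue_measure_set1 ((b - (pt p *m dsubmx a) 0 0) / a (lshift n 0) 0)).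
  congr (leb _); rewrite xsection_set; apply/seteqP; split => z /=; rewrite eqn /=.
    by move=> <-; rewrite addrK mulfK.
  by move=> ->; rewrite divfK // subrK.
Qed.
End Product.

Section Permute.
Context {R : realType} d (T : measurableType d) (mu : {measure set T -> \bar R}).
Variables (n : nat) (pt pt' : T -> 'rV[R]_n) (s : {perm 'I_n}).
Hypothesis cm : coord_measure mu pt.
Hypothesis pt'E : forall t, pt' t = col_perm s (pt t).

(** It reconciles [pt2] and [pt3], which list the factors in the order of multiplication, with
    [cons_pt], which puts the latest first. *)
Lemma coord_measure_perm : coord_measure mu pt'.
Proof.
have pt'P t : pt' t = pt t *m perm_mx s^-1 by rewrite pt'E col_permE.
have K1 : perm_mx s^-1 *m perm_mx s = 1%:M :> 'M[R]_n by rewrite -perm_mxM mulVg perm_mx1.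
have K2 : perm_mx s *m perm_mx s^-1 = 1%:M :> 'M[R]_n by rewrite -perm_mxM mulgV perm_mx1.
have coordE t i : pt' t 0 i = pt t 0 (s i) by rewrite pt'E mxE.
split.
- have [g gK Kg] := cm_bij cm; exists (fun x => g (x *m perm_mx s)).
    by move=> t; rewrite pt'P -mulmxA K1 mulmx1 gK.
  by move=> x; rewrite pt'P Kg -mulmxA K2 mulmx1.
- by move=> i; under eq_fun do rewrite coordE; exact: (cm_coord cm).
- move=> d' S phi H; apply: (cm_gen cm) => i.
  by have := H (s^-1%g i); under eq_fun do rewrite coordE permKV.
- move=> M b uM.
  have uM' : perm_mx s^-1 *m M *m perm_mx s \in unitmx.
    by rewrite !unitmx_mul !unitmx_perm uM.
  have [phi e sp] := cm_affine cm (b *m perm_mx s) uM'.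
  exists phi; last first.
    by move: sp; rewrite !det_mulmx mulrAC -det_mulmx K1 det1 mul1r.
  move=> t; rewrite !pt'P e mulmxDl -!mulmxA K2 !mulmx1 //.
- move=> c r r0.
  have -> : [set t | forall i, `|pt' t 0 i - c 0 i| < r] =
      [set t | forall i, `|pt t 0 i - col_perm s^-1 c 0 i| < r].
    apply/seteqP; split => t /= H i.
      by have := H (s^-1%g i); rewrite coordE mxE permKV.
    by have := H (s i); rewrite coordE mxE permK.
  exact: cm_box cm _ _ r0.
- move=> a b a0.
  have a'0 : perm_mx s^-1 *m a != 0.
    apply: contraNneq a0 => h; apply/eqP.
    by rewrite -[a]mul1mx -K2 -mulmxA h mulmx0.
  rewrite -(cm_hyperplane cm b a'0); congr (mu _).
  by apply/seteqP; split => t /=; rewrite pt'P mulmxA.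
Qed.
End Permute.

(** * Polynomial functions *)

Section Polynomials.
Context {R : realType}.

Lemma poly_zero_near (q : {poly R}) (e : R) : 0 < e ->
  (forall t, 0 < t < e -> q.[t] = 0) -> q = 0.
Proof.
move=> e0 H; apply/eqP; apply: contraT => q0.
(* One root more than the degree allows; starting the denominators at two keeps them strictly below
   [e]. *)
pose rs := [seq e / i.+2%:R | i <- iota 0 (size q)].
have : (size rs < size q)%N.
  apply: max_poly_roots => //.
    apply/allP => _ /mapP[i _ ->]; rewrite /root H // divr_gt0 //=.
    by rewrite ltr_pdivrMr // ltr_pMr // ltr1n.
  rewrite map_inj_uniq ?iota_uniq // => i j /(mulfI (lt0r_neq0 e0))/invr_inj/eqP.
  by rewrite eqr_nat => /eqP[].
by rewrite size_map size_iota ltnn.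
Qed.

(** Polynomial functions without record of a degree: integrability, differentiation and identity
    theorems are all inductions over these four rules. Degrees are tracked by [poly_le] only. *)
Inductive polyf (n : nat) : ('rV[R]_n -> R) -> Prop :=
| polyf_cst c : polyf (fun _ => c)
| polyf_coord i : polyf (fun x => x 0 i)
| polyf_add f g of polyf f & polyf g : polyf (fun x => f x + g x)
| polyf_mul f g of polyf f & polyf g : polyf (fun x => f x * g x).

Section Closure.
Variable n : nat.
Implicit Types f g : 'rV[R]_n -> R.

Lemma polyf_opp f : polyf f -> polyf (fun x => - f x).
Proof. by move=> pf; under eq_fun do rewrite -mulN1r; apply: polyf_mul => //; exact: polyf_cst. Qed.

Lemma polyf_sub f g : polyf f -> polyf g -> polyf (fun x => f x - g x).
Proof. by move=> pf pg; apply: polyf_add => //; exact: polyf_opp. Qed.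

Lemma polyf_exp f k : polyf f -> polyf (fun x => f x ^+ k).
Proof.
move=> pf; elim: k => [|k IH]; first by under eq_fun do rewrite expr0; exact: polyf_cst.
by under eq_fun do rewrite exprS; exact: polyf_mul.
Qed.

Lemma polyf_sum (J : Type) (r : seq J) (P : pred J) (F : J -> 'rV[R]_n -> R) :
  (forall j, polyf (F j)) -> polyf (fun x => \sum_(j <- r | P j) F j x).
Proof.
move=> pF; elim: r => [|j r IH]; first by under eq_fun do rewrite big_nil; exact: polyf_cst.
under eq_fun do rewrite big_cons; case: (P j) => //; exact: polyf_add.
Qed.

Lemma polyf_prod (J : Type) (r : seq J) (P : pred J) (F : J -> 'rV[R]_n -> R) :
  (forall j, polyf (F j)) -> polyf (fun x => \prod_(j <- r | P j) F j x).
Proof.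
move=> pF; elim: r => [|j r IH]; first by under eq_fun do rewrite big_nil; exact: polyf_cst.
under eq_fun do rewrite big_cons; case: (P j) => //; exact: polyf_mul.
Qed.

Lemma polyf_comp m f (A : 'rV[R]_m -> 'rV[R]_n) :
  polyf f -> (forall i, polyf (fun x => A x 0 i)) -> polyf (fun x => f (A x)).
Proof.
move=> pf pA; elim: pf => [c|i|f' g' _ h1 _ h2|f' g' _ h1 _ h2];
  [exact: polyf_cst|exact: pA|exact: polyf_add|exact: polyf_mul].
Qed.

Lemma polyf_affine m (M : 'M[R]_(n, m)) (b : 'rV[R]_m) i : polyf (fun x => (x *m M + b) 0 i).
Proof.
under eq_fun do rewrite !mxE; apply: polyf_add; last exact: polyf_cst.
by apply: polyf_sum => j; apply: polyf_mul; [exact: polyf_coord|exact: polyf_cst].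
Qed.

Lemma polyf_mulmx m (M : 'M[R]_(n, m)) i : polyf (fun x => (x *m M) 0 i).
Proof. by have := polyf_affine M 0 i; under eq_fun do rewrite addr0. Qed.

Lemma polyf_continuous f : polyf f -> continuous f.
Proof.
elim=> [c|i|f' g' _ h1 _ h2|f' g' _ h1 _ h2];
  [exact: cst_continuous|exact: coord_continuous|exact: continuous_add|exact: continuous_mul].
Qed.

Lemma polyf_bounded f r : polyf f ->
  exists M, forall x : 'rV[R]_n, (forall i, `|x 0 i| <= r) -> `|f x| <= M.
Proof.
elim=> [c|i|f' g' _ [M1 h1] _ [M2 h2]|f' g' _ [M1 h1] _ [M2 h2]].
- by exists `|c|.
- by exists r.
- exists (M1 + M2) => x xr; apply: le_trans (ler_normD _ _) _; apply: lerD; [exact: h1|exact: h2].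
- exists (M1 * M2) => x xr; rewrite normrM; apply: ler_pM => //; [exact: h1|exact: h2].
Qed.

(** On a line the function is a univariate polynomial, so its directional derivative is found
    algebraically and is again polynomial in the base point. *)
Lemma polyf_derivative f (v : 'rV[R]_n) : polyf f -> exists2 g, polyf g &
  forall x, exists2 q : {poly R}, (forall t, f (x + t *: v) = q.[t]) & q^`().[0] = g x.
Proof.
elim=> [c|i|f1 f2 p1 [g1 pg1 h1] p2 [g2 pg2 h2]|f1 f2 p1 [g1 pg1 h1] p2 [g2 pg2 h2]].
- exists (fun=> 0); first exact: polyf_cst.
  by move=> x; exists c%:P; rewrite ?derivC ?hornerE // => t; rewrite hornerC.
- exists (fun=> v 0 i); first exact: polyf_cst.
  move=> x; exists ((x 0 i)%:P + (v 0 i) *: 'X); first by move=> t; rewrite !mxE !hornerE mulrC.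
  by rewrite derivD derivC derivZ derivX !hornerE.
- exists (fun x => g1 x + g2 x); first exact: polyf_add.
  move=> x; have [q1 e1 d1] := h1 x; have [q2 e2 d2] := h2 x.
  by exists (q1 + q2); [move=> t; rewrite hornerD e1 e2|rewrite derivD hornerD d1 d2].
exists (fun x => g1 x * f2 x + f1 x * g2 x); first by apply: polyf_add; exact: polyf_mul.
move=> x; have [q1 e1 d1] := h1 x; have [q2 e2 d2] := h2 x.
exists (q1 * q2); first by move=> t; rewrite hornerM e1 e2.
by rewrite derivM hornerD !hornerM d1 d2 -e1 -e2 scale0r addr0.
Qed.

Lemma is_derive_line f x v (q : {poly R}) : (forall t, f (x + t *: v) = q.[t]) ->
  is_derive x v f q^`().[0].
Proof.
move=> fq.
have E : (fun h : R => h^-1 *: ((f \o shift x) (h *: v) - f x)) =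
    (fun h : R => h^-1 *: ((horner q \o shift 0) (h *: (1 : R)) - q.[0])).
  apply/funext => h /=; have := fq 0; rewrite scale0r addr0 => ->.
  by rewrite [h *: v + x]addrC fq addr0 -[h *: 1]/(h * 1) mulr1.
have dq : derivable (horner q) 0 1 by exact: derivable_horner.
split; first by rewrite /derivable E.
by rewrite /derive E; have := derivE q => ->; rewrite derive1E.
Qed.

Lemma polyf_is_derive f v : polyf f -> exists2 g, polyf g & forall x, is_derive x v f (g x).
Proof.
move=> /(polyf_derivative v)[g pg H]; exists g => // x.
by have [q e <-] := H x; exact: is_derive_line.
Qed.

Lemma polyf_derivable f x v : polyf f -> derivable f x v.
Proof. by move=> /(polyf_is_derive v)[g _ /(_ x) []]. Qed.

Lemma polyf_derive f v : polyf f -> polyf (fun x => derive f x v).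
Proof.
move=> /(polyf_is_derive v)[g pg H].
suff -> : (fun x => derive f x v) = g by [].
by apply/funext => x; have [_] := H x.
Qed.

Lemma polyf_line f x v : polyf f -> exists q : {poly R}, forall t, f (x + t *: v) = q.[t].
Proof. by move=> /(polyf_derivative v)[g _ /(_ x) [q]]; exists q. Qed.

Lemma polyf_line_derive f x v (q : {poly R}) t : polyf f -> (forall t, f (x + t *: v) = q.[t]) ->
  derive f (x + t *: v) v = q^`().[t].
Proof.
move=> pf fq.
have h : forall u, f (x + t *: v + u *: v) = (q \Po ('X + t%:P)).[u].
  by move=> u; rewrite -addrA -scalerDl fq horner_comp !hornerE addrC.
have [_ ->] := is_derive_line h.
by rewrite deriv_comp derivD derivX derivC addr0 mulr1 horner_comp !hornerE.
Qed.

(** The derivative is built, by induction on [f], as an explicit linear function [L] of the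
    direction. *)
Lemma derive_linear f x (u v : 'rV[R]_n) (a : R) : polyf f ->
  derive f x (a *: u + v) = a * derive f x u + derive f x v.
Proof.
move=> pf.
suff [L LL HL] : exists2 L : 'rV[R]_n -> R, (forall a u v, L (a *: u + v) = a * L u + L v) &
  forall v, is_derive x v f (L v).
  by have [_ ->] := HL u; have [_ ->] := HL v; have [_ ->] := HL (a *: u + v).
suff [L LL HL] : exists2 L : 'rV[R]_n -> R, (forall a u v, L (a *: u + v) = a * L u + L v) &
  forall v, exists2 q : {poly R}, (forall t, f (x + t *: v) = q.[t]) & q^`().[0] = L v.
  exists L => // w; have [q e <-] := HL w; exact: is_derive_line.
elim: pf => [c|i|f1 f2 p1 [g1 pg1 h1] p2 [g2 pg2 h2]|f1 f2 p1 [g1 pg1 h1] p2 [g2 pg2 h2]].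
- exists (fun=> 0) => [*|w]; first by rewrite mulr0 addr0.
  by exists c%:P; rewrite ?derivC ?hornerE // => t; rewrite hornerC.
- exists (fun w => w 0 i) => [*|w]; first by rewrite !mxE.
  exists ((x 0 i)%:P + (w 0 i) *: 'X); first by move=> t; rewrite !mxE !hornerE mulrC.
  by rewrite derivD derivC derivZ derivX !hornerE.
- exists (fun w => g1 w + g2 w) => [*|w]; first by rewrite pg1 pg2; ring.
  have [q1 e1 d1] := h1 w; have [q2 e2 d2] := h2 w.
  by exists (q1 + q2); [move=> t; rewrite hornerD e1 e2|rewrite derivD hornerD d1 d2].
exists (fun w => g1 w * f2 x + f1 x * g2 w) => [*|w]; first by rewrite pg1 pg2; ring.
have [q1 e1 d1] := h1 w; have [q2 e2 d2] := h2 w.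
exists (q1 * q2); first by move=> t; rewrite hornerM e1 e2.
have := e1 0; have := e2 0; rewrite scale0r addr0 => -> ->.
by rewrite derivM hornerD !hornerM d1 d2.
Qed.

(** On the line from [x] to any [y] the function vanishes along an initial segment, hence
    identically. *)
Lemma polyf_zero_box f (x : 'rV[R]_n) e : polyf f -> 0 < e ->
  (forall y : 'rV[R]_n, (forall i, `|y 0 i - x 0 i| < e) -> f y = 0) -> forall y, f y = 0.
Proof.
move=> pf e0 H y; have [q hq] := polyf_line x (y - x) pf.
suff q0 : q = 0 by have := hq 1; rewrite scale1r addrC subrK q0 horner0.
pose M := 1 + \sum_i `|y 0 i - x 0 i|.
have M0 : 0 < M by rewrite ltr_pwDl // sumr_ge0.
apply: (@poly_zero_near _ (e / M)); first by rewrite divr_gt0.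
move=> t /andP[t0 tM]; rewrite -hq H // => i; rewrite !mxE addrAC subrr add0r normrM gtr0_norm //.
apply: (@le_lt_trans _ _ (t * M)); last by rewrite -ltr_pdivlMr.
rewrite ler_wpM2l ?(ltW t0) // /M (bigD1 i) //= addrCA lerDl.
by rewrite addr_ge0 // sumr_ge0.
Qed.
End Closure.

Section PolyLe.
Variable d : nat.
Implicit Types (p q : 'rV[R]_d -> R) (a : 'I_d -> nat).

Definition mono a (x : 'rV[R]_d) : R := \prod_(i < d) x 0 i ^+ a i.

Lemma poly_le_mono n a : (\sum_(i < d) a i <= n)%N -> poly_le n (mono a).
Proof.
move=> an; have lt i : (a i < n.+1)%N by rewrite ltnS (leq_trans _ an) // (bigD1 i) //= leq_addr.
pose b : {ffun 'I_d -> 'I_n.+1} := [ffun i => Ordinal (lt i)].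
exists [ffun b' => (b' == b)%:R] => x.
rewrite (bigD1 b) /=; last by rewrite (eq_bigr a) // => i _; rewrite ffunE.
rewrite ffunE eqxx mul1r [X in _ + X]big1 ?addr0; last first.
  by move=> b' /andP[_ /negbTE ne]; rewrite ffunE ne mul0r.
by apply: eq_bigr => i _; rewrite ffunE.
Qed.

Lemma poly_le0 n : poly_le n (fun _ : 'rV[R]_d => 0).
Proof. by exists [ffun=> 0] => x; rewrite big1 // => a _; rewrite ffunE mul0r. Qed.

Lemma poly_leD n p q : poly_le n p -> poly_le n q -> poly_le n (fun x => p x + q x).
Proof.
move=> [c hc] [c' hc']; exists [ffun a => c a + c' a] => x.
by rewrite hc hc' -big_split /=; apply: eq_bigr => a _; rewrite ffunE mulrDl.
Qed.

Lemma poly_leZ n (k : R) p : poly_le n p -> poly_le n (fun x => k * p x).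
Proof.
move=> [c hc]; exists [ffun a => k * c a] => x.
by rewrite hc mulr_sumr; apply: eq_bigr => a _; rewrite ffunE mulrA.
Qed.

Lemma poly_le_sum n (J : Type) (r : seq J) (P : pred J) (F : J -> 'rV[R]_d -> R) :
  (forall j, P j -> poly_le n (F j)) -> poly_le n (fun x => \sum_(j <- r | P j) F j x).
Proof.
move=> pF; elim: r => [|j r IH]; first by under eq_fun do rewrite big_nil; exact: poly_le0.
under eq_fun do rewrite big_cons; case Pj: (P j) => //; apply: poly_leD => //; exact: pF.
Qed.

Lemma poly_le_ind n (P : ('rV[R]_d -> R) -> Prop) : P (fun=> 0) ->
  (forall f g, P f -> P g -> P (fun x => f x + g x)) ->
  (forall (c : R) a, (\sum_(i < d) a i <= n)%N -> P (fun x => c * mono a x)) ->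
  forall p, poly_le n p -> P p.
Proof.
move=> P0 PD PM p [c hc].
have -> : p = (fun x => \sum_(a : {ffun 'I_d -> 'I_n.+1} | (\sum_(i < d) (a i : nat) <= n)%N)
            c a * mono (fun i => a i) x) by apply/funext.
elim: (index_enum _) => [|a r IH]; first by under eq_fun do rewrite big_nil.
under eq_fun do rewrite big_cons.
by case an: (\sum_(i < d) a i <= n)%N; [apply: PD => //; exact: PM|exact: IH].
Qed.

Lemma polyf_mono a : polyf (mono a).
Proof. by apply: polyf_prod => i; apply: polyf_exp; exact: polyf_coord. Qed.

Lemma poly_le_polyf n p : poly_le n p -> polyf p.
Proof.
apply: poly_le_ind => [|f g|c a _]; [exact: polyf_cst|exact: polyf_add|].
by apply: polyf_mul; [exact: polyf_cst|exact: polyf_mono].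
Qed.

Lemma poly_le_widen n n' p : (n <= n')%N -> poly_le n p -> poly_le n' p.
Proof.
move=> nn'; apply: poly_le_ind => [|f g|c a an]; [exact: poly_le0|exact: poly_leD|].
by apply: poly_leZ; apply: poly_le_mono; exact: leq_trans nn'.
Qed.

Lemma poly_le_cst n (c : R) : poly_le n (fun _ : 'rV[R]_d => c).
Proof.
have -> : (fun _ => c) = (fun x => c * mono (fun=> 0%N) x).
  by apply/funext => x; rewrite /mono big1 ?mulr1.
by apply: poly_leZ; apply: poly_le_mono; rewrite big1.
Qed.

Lemma mono_derive a x c : derive (mono a) x (ecoord c) =
  (a c)%:R * mono (fun i => if i == c then (a c).-1 else a i) x.
Proof.
pose C := \prod_(i < d | i != c) x 0 i ^+ a i.
pose q : {poly R} := C *: ((x 0 c)%:P + 'X) ^+ a c.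
have hq t : mono a (x + t *: ecoord c) = q.[t].
  rewrite /mono (bigD1 c) //= !mxE eqxx mulr1 /q !hornerE mulrC; congr (_ * _).
  by apply: eq_bigr => i ic; rewrite !mxE (negbTE ic) mulr0 addr0.
have [_ ->] := is_derive_line hq.
rewrite /q derivZ deriv_exp derivD derivC derivX add0r mul1r hornerZ hornerMn horner_exp.
rewrite hornerD hornerC hornerX addr0 mulrnAr -[LHS]mulr_natl; congr (_ * _).
rewrite /mono (bigD1 c) //= eqxx mulrC; congr (_ * _).
by apply: eq_bigr => i ic; rewrite (negbTE ic).
Qed.

Lemma poly_le_derive n p c : poly_le n p -> poly_le n.-1 (fun x => derive p x (ecoord c)).
Proof.
move=> pp; suff [] : polyf p /\ poly_le n.-1 (fun x => derive p x (ecoord c)) by [].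
move: p pp; apply: poly_le_ind => [|f g [pf hf] [pg hg]|k a an].
- split; first exact: polyf_cst.
  by under eq_fun do rewrite (derive_cst (0 : R)); exact: poly_le0.
- split; first exact: polyf_add.
  have -> : (fun x => derive (fun x => f x + g x) x (ecoord c)) =
      (fun x => derive f x (ecoord c) + derive g x (ecoord c)).
    by apply/funext => x; apply: (@deriveD _ _ _ f g); exact: polyf_derivable.
  exact: poly_leD.
split; first by apply: polyf_mul; [exact: polyf_cst|exact: polyf_mono].
have -> : (fun x => derive (fun x => k * mono a x) x (ecoord c)) =
    (fun x => k * ((a c)%:R * mono (fun i => if i == c then (a c).-1 else a i) x)).
  apply/funext => x; rewrite -mono_derive.
  by apply: (@deriveZ _ _ _ (mono a)); exact/polyf_derivable/polyf_mono.
apply: poly_leZ; have [->|ac] := eqVneq (a c) 0%N.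
  by under eq_fun do rewrite mul0r; exact: poly_le0.
apply: poly_leZ; apply: poly_le_mono.
have -> : (\sum_(i < d) (if i == c then (a c).-1 else a i) =
    (a c).-1 + \sum_(i < d | i != c) a i)%N.
  rewrite (bigD1 c) //= eqxx; congr addn.
  by apply: eq_bigr => i /negbTE ->.
move: an; rewrite (bigD1 c) //=; case: (a c) ac => // b _.
by rewrite addSn /=; case: n => // n; rewrite ltnS.
Qed.
End PolyLe.
End Polynomials.

(** * Integrals of polynomials *)

Section Integration.
Context {R : realType} dT (T : measurableType dT) (mu : {measure set T -> \bar R}).
Variables (n : nat) (pt : T -> 'rV[R]_n).
Hypothesis cm : coord_measure mu pt.
Implicit Types (A : set 'rV[R]_n) (f g : 'rV[R]_n -> R).

Definition cint A f : R := Rintegral mu (pt @^-1` A) (f \o pt).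

Definition region A := measurable (pt @^-1` A) /\
  exists r, forall x : 'rV[R]_n, A x -> forall i, `|x 0 i| <= r.

Lemma measurable_polyf f : polyf f -> measurable_fun setT (f \o pt).
Proof.
elim=> [c|i|f' g' _ h1 _ h2|f' g' _ h1 _ h2];
  [exact: measurable_cst|exact: (cm_coord cm)|exact: measurable_funD|exact: measurable_funM].
Qed.

Lemma measurable_polyf_le f c : polyf f -> measurable (pt @^-1` [set x | f x <= c]).
Proof.
move=> pf; have := measurable_polyf pf measurableT (measurable_itv `]-oo, c]).
by rewrite setTI; congr measurable; apply/seteqP; split => t /=; rewrite in_itv.
Qed.

Lemma measurable_polyf_lt f c : polyf f -> measurable (pt @^-1` [set x | f x < c]).
Proof.
move=> pf; have := measurable_polyf pf measurableT (measurable_itv `]-oo, c[).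
by rewrite setTI; congr measurable; apply/seteqP; split => t /=; rewrite in_itv.
Qed.

Lemma measurable_all (J : finType) (A : J -> set 'rV[R]_n) :
  (forall j, measurable (pt @^-1` A j)) -> measurable (pt @^-1` [set x | forall j, A j x]).
Proof.
move=> mA.
have -> : pt @^-1` [set x | forall j, A j x] = \bigcap_(j in [set: J]) (pt @^-1` A j).
  by apply/seteqP; split => t H j => [_|]; exact: H.
by apply: fin_bigcap_measurable => // j _; exact: mA.
Qed.

Lemma measurable_box (c : 'rV[R]_n) r :
  measurable (pt @^-1` [set x | forall i, `|x 0 i - c 0 i| < r]).
Proof.
apply: (measurable_all (A := fun i => [set x | `|x 0 i - c 0 i| < r])) => i.
have -> : pt @^-1` [set x : 'rV[R]_n | `|x 0 i - c 0 i| < r] =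
    (pt @^-1` [set x | x 0 i < c 0 i + r]) `&` (pt @^-1` [set x | - x 0 i < r - c 0 i]).
  apply/seteqP; split => t /=; rewrite ltr_distl; first by move=> /andP[? ?]; split; lra.
  by move=> [? ?]; apply/andP; split; lra.
by apply: measurableI; apply: measurable_polyf_lt;
  [exact: polyf_coord|apply: polyf_opp; exact: polyf_coord].
Qed.

Lemma region_finite A : region A -> (mu (pt @^-1` A) < +oo)%E.
Proof.
move=> [mA [r Ar]]; have r1 : 0 < `|r| + 1 by rewrite ltr_wpDl.
have /andP[_ fin] := cm_box cm 0 r1; apply: le_lt_trans fin.
apply: le_measure; [exact: mem_set|exact: mem_set (measurable_box 0 _)|].
move=> t /= At i; rewrite mxE subr0; apply: le_lt_trans (Ar _ At i) _.
by apply: le_lt_trans (ler_norm _) _; rewrite ltrDl.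
Qed.

Lemma integrable_polyf A f : region A -> polyf f ->
  mu.-integrable (pt @^-1` A) (EFin \o (f \o pt)).
Proof.
move=> rA pf; have [mA [r Ar]] := rA; apply: measurable_bounded_integrable => //.
- exact: region_finite.
- by apply: measurable_funTS; exact: measurable_polyf.
have [M HM] := polyf_bounded r pf.
exists M; split; first exact: num_real.
move=> M' MM' t /= At; apply: le_trans (ltW MM'); exact/HM/Ar.
Qed.

Lemma cint_linear A a f g : region A -> polyf f -> polyf g ->
  cint A (fun x => a * f x + g x) = a * cint A f + cint A g.
Proof.
move=> rA pf pg; have mA := rA.1; rewrite /cint -RintegralZl //; last exact: integrable_polyf.
rewrite -RintegralD //; last exact: integrable_polyf.
by apply: (@integrable_polyf A (fun x => a * f x)) => //; apply: polyf_mul => //; exact: polyf_cst.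
Qed.

Lemma cint_ge0 A f : (forall x, A x -> 0 <= f x) -> 0 <= cint A f.
Proof. by move=> f0; apply: Rintegral_ge0 => t /= /f0. Qed.

Lemma eq_cint A f g : (forall x, A x -> f x = g x) -> cint A f = cint A g.
Proof. by move=> fg; apply: eq_Rintegral => t /set_mem /fg. Qed.

(** Around a positive value [f] stays above half of it on a box inside [A], and boxes have positive
    measure. *)
Lemma cint_eq0 A f (x : 'rV[R]_n) e : region A -> polyf f -> (forall y, A y -> 0 <= f y) ->
  cint A f = 0 -> 0 < e -> (forall y : 'rV[R]_n, (forall i, `|y 0 i - x 0 i| < e) -> A y) -> f x = 0.
Proof.
move=> rA pf f0 int0 e0 bA; have [mA _] := rA.
apply/eqP; apply: contraT => fx0.
have Ax : A x by apply: bA => i; rewrite subrr normr0.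
have fx : 0 < f x by rewrite lt_neqAle eq_sym fx0 f0.
have [e' e'0 near] : exists2 e', 0 < e' & forall y : 'rV[R]_n, (forall i, `|y 0 i - x 0 i| < e') -> f x / 2 < f y.
  have : nbhs x (f @^-1` [set z | f x / 2 < z]).
    apply: (polyf_continuous pf); apply: open_nbhs_nbhs; split; first exact: open_gt.
    by rewrite /=; lra.
  move=> /nbhs_ballP[e' /= e'0 H]; exists e' => // y yx; apply: H.
  by apply: rV_ball => // i; rewrite distrC.
pose r := Num.min e e'; have r0 : 0 < r by rewrite lt_min e0.
pose Q := [set y : 'rV[R]_n | forall i, `|y 0 i - x 0 i| < r].
have QA : Q `<=` A.
  by move=> y Qy; apply: bA => i; apply: lt_le_trans (Qy i) _; rewrite /r ge_min lexx.
have Qf y : Q y -> f x / 2 <= f y.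
  move=> Qy; apply/ltW/near => i; apply: lt_le_trans (Qy i) _.
  by rewrite /r ge_min lexx orbT.
have mQ : measurable (pt @^-1` Q) by exact: measurable_box.
have /andP[Qpos Qfin] := cm_box cm x r0.
have intA := integrable_polyf rA pf.
have le1 : (\int[mu]_(t in pt @^-1` Q) (f x / 2)%:E <= \int[mu]_(t in pt @^-1` A) (f (pt t))%:E)%E.
  apply: (@le_trans _ _ (\int[mu]_(t in pt @^-1` Q) (f (pt t))%:E)%E).
    apply: ge0_le_integral => //.
    - by move=> t _; rewrite lee_fin; lra.
    - by apply/measurable_EFinP; apply: measurable_funTS; exact: measurable_polyf.
    - by move=> t /= /Qf; rewrite lee_fin.
  apply: ge0_subset_integral => //.
  - by apply/measurable_EFinP; apply: measurable_funTS; exact: measurable_polyf.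
  - by move=> t /= /f0; rewrite lee_fin.
  - by move=> t /= /QA.
have fin := @integrable_fin_num _ _ _ _ _ mA _ intA.
have int0' : (\int[mu]_(t in pt @^-1` A) (f (pt t))%:E = 0)%E.
  by rewrite -[LHS](fineK fin); congr EFin.
move: le1; rewrite int0' integral_cst // leNgt => /negP[].
by rewrite mule_gt0 // lte_fin; lra.
Qed.

(** The pushforward of [mu] under [phi] is [c] times [mu], which settles nonnegative functions;
    integrable ones are split into positive and negative parts. *)
Lemma scales_integral (phi : T -> T) c (D : set T) (g : T -> \bar R) :
  scales mu phi c -> 0 <= c -> measurable D -> measurable_fun setT g -> mu.-integrable D g ->
  (\int[mu]_(t in phi @^-1` D) g (phi t) = c%:E * \int[mu]_(t in D) g t)%E.
Proof.
move=> [mphi sphi] c0 mD mg intg.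
have key h : measurable_fun setT h -> (forall t, (0 <= h t)%E) ->
    (\int[mu]_(t in phi @^-1` D) h (phi t) = c%:E * \int[mu]_(t in D) h t)%E.
  move=> mh h0; have mhD : measurable_fun D h by exact: measurable_funTS.
  have := @ge0_integral_pushforward _ _ _ _ _ phi mphi mu D h mD mhD (fun t _ => h0 t).
  move=> /= <-.
  have -> : (c = (NngNum c0)%:num)%R by [].
  rewrite -ge0_integral_mscale //; apply: eq_measure_integral => A mA _.
  by rewrite /= /mscale /= /pushforward sphi.
rewrite [LHS](integralE mu (phi @^-1` D) (g \o phi)) funepos_comp funeneg_comp.
rewrite [in RHS]integralE.
rewrite !key //; [|exact: measurable_funeneg|exact: measurable_funepos].
have := integrable_fin_num mD (integrable_funepos mD intg) => /fineK <-.
have := integrable_fin_num mD (integrable_funeneg mD intg) => /fineK <-.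
exact: (congr1 EFin (esym (mulrBr _ _ _))).
Qed.

Lemma cint_affine A f (M : 'M[R]_n) b : region A -> polyf f -> M \in unitmx ->
  cint A f = `|\det M| * cint [set y | A (y *m M + b)] (fun y => f (y *m M + b)).
Proof.
move=> rA pf uM; have [phi e sp] := cm_affine cm b uM.
have -> : cint [set y | A (y *m M + b)] (fun y => f (y *m M + b)) =
    Rintegral mu (phi @^-1` (pt @^-1` A)) (fun t => f (pt (phi t))).
  rewrite /cint.
  have -> : pt @^-1` [set y | A (y *m M + b)] = phi @^-1` (pt @^-1` A).
    by apply/seteqP; split => t /=; rewrite e.
  by apply: eq_Rintegral => t _ /=; rewrite e.
rewrite /Rintegral (@scales_integral phi _ _ (fun t => (f (pt t))%:E) sp) //; last 3 first.
- exact: rA.1.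
- by apply/measurable_EFinP; exact: measurable_polyf.
- exact: integrable_polyf.
rewrite fineM //; last exact: (@integrable_fin_num _ _ _ _ _ rA.1 _ (integrable_polyf rA pf)).
rewrite /= mulrA divff ?mul1r // normr_eq0.
by move: uM; rewrite unitmxE unitfE.
Qed.
End Integration.

(** * Discarding null sets *)

Section NullBoundary.
Context {R : realType} dT (T : measurableType dT) (mu : {measure set T -> \bar R}).
Import HBNNSimple.

(** For an arbitrary [g] the integral is a supremum over the simple functions below it; each of
    these is cut off on the null difference of [D] and [D'] without changing its own integral. *)
Lemma ge0_integral_null (D D' : set T) (g : T -> \bar R) :
  measurable D -> measurable D' -> D' `<=` D -> mu (D `\` D') = 0%E -> (forall t, (0 <= g t)%E) ->
  (\int[mu]_(t in D) g t = \int[mu]_(t in D') g t)%E.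
Proof.
move=> mD mD' D'D mu0 g0; have mN : measurable (D `\` D') by exact: measurableD.
rewrite !ge0_integralE //; apply/eqP; rewrite eq_le; apply/andP; split; last first.
  apply: le_ereal_sup => _ [h hg <-]; exists h => // t; apply: le_trans (hg t) _.
  rewrite !patchE; case: ifPn => // tD'; first by rewrite mem_set //; exact/D'D/set_mem.
  by case: ifPn.
apply: ge_ereal_sup => _ [h /= hg <-].
pose h' : {nnsfun T >-> R} := mul_nnsfun h (indic_nnsfun R (measurableC mN)).
have mh : measurable_fun setT (EFin \o h) by exact/measurable_EFinP.
have mh' : measurable_fun setT (EFin \o h') by exact/measurable_EFinP.
have -> : sintegral mu h = sintegral mu h'.
  rewrite -!integralT_nnsfun; apply: ge0_ae_eq_integral => //.
  - by move=> t _; rewrite lee_fin.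
  - by move=> t _; rewrite lee_fin.
  exists (D `\` D'); split => // t /= ne; apply: contrapT => tN; apply: ne => _.
  by rewrite /h' /= /mindic indicE mem_set // mulr1.
apply: ereal_sup_ubound; exists h' => // t.
rewrite /h' /= /mindic indicE patchE; have := hg t; rewrite patchE.
case: ifPn => tD; last first.
  move=> h0; have -> : (t \in D') = false.
    by apply: contraNF tD => /set_mem/D'D/mem_set.
  apply: le_trans h0; rewrite lee_fin ler_piMr //; by case: (_ \in _).
case: ifPn => tD'.
  by apply: le_trans; rewrite lee_fin ler_piMr //; case: (_ \in _).
move=> _; rewrite memNset ?mulr0 //= => /(_ _)[]; split; first exact: set_mem.
by move=> /mem_set; rewrite (negbTE tD').
Qed.

Lemma Rintegral_null (D D' : set T) (g : T -> R) :
  measurable D -> measurable D' -> D' `<=` D -> mu (D `\` D') = 0%E ->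
  Rintegral mu D g = Rintegral mu D' g.
Proof.
move=> mD mD' D'D mu0; rewrite /Rintegral integralE [in RHS]integralE.
by rewrite !(ge0_integral_null mD mD' D'D mu0).
Qed.
End NullBoundary.

(** * The standard simplex *)

Section StandardSimplex.
Context {R : realType}.

Definition bary n (y : 'rV[R]_n) : 'rV[R]_(1 + n) := row_mx (1 - \sum_i y 0 i)%:M y.
Definition refset n : set 'rV[R]_n := [set y | (forall i, 0 <= y 0 i) /\ \sum_i y 0 i <= 1].
Definition stdsimplex n : set 'rV[R]_n := [set y | (forall i, 0 <= y 0 i) /\ \sum_i y 0 i = 1].
Definition unbary n (x : 'rV[R]_(1 + n)) : 'rV[R]_n := rsubmx x.

Lemma bary0 n (y : 'rV[R]_n) : bary y 0 (lshift n 0) = 1 - \sum_i y 0 i.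
Proof. by rewrite row_mxEl mxE eqxx. Qed.

Lemma baryS n (y : 'rV[R]_n) i : bary y 0 (rshift 1 i) = y 0 i.
Proof. by rewrite row_mxEr. Qed.

Lemma sum_bary n (y : 'rV[R]_n) : \sum_i bary y 0 i = 1.
Proof.
rewrite big_split_ord /= big_ord1 bary0.
by rewrite (eq_bigr (fun i => y 0 i)) ?subrK // => i _; rewrite baryS.
Qed.

Lemma unbaryK n (x : 'rV[R]_(1 + n)) : \sum_i x 0 i = 1 -> bary (unbary x) = x.
Proof.
rewrite big_split_ord /= big_ord1 => sx; rewrite /bary /unbary -[RHS]hsubmxK; congr row_mx.
apply/rowP => i; rewrite ord1 !mxE eqxx mulr1n -sx.
have -> : \sum_i rsubmx x 0 i = \sum_i x 0 (rshift 1 i) by apply: eq_bigr => j _; rewrite mxE.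
by rewrite addrK.
Qed.

Lemma baryK n (y : 'rV[R]_n) : unbary (bary y) = y.
Proof. by rewrite /unbary /bary row_mxKr. Qed.

Lemma unbaryE n (x : 'rV[R]_(1 + n)) i : unbary x 0 i = x 0 (rshift 1 i).
Proof. by rewrite mxE. Qed.

Lemma refset_bary n (y : 'rV[R]_n) : refset y <-> stdsimplex (bary y).
Proof.
split=> [[y0 y1]|[b0 _]].
  split; last exact: sum_bary.
  by move=> i; case: (split_ordP i) => j ->; rewrite ?ord1 ?bary0 ?subr_ge0 // baryS.
split=> [i|]; first by rewrite -baryS.
by have := b0 (lshift n 0); rewrite bary0 subr_ge0.
Qed.

Lemma polyf_bary n (F : 'rV[R]_(1 + n) -> R) : polyf F -> polyf (fun y : 'rV[R]_n => F (bary y)).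
Proof.
move=> pF; apply: polyf_comp => // i; case: (split_ordP i) => j ->.
  rewrite (ord1 j); under eq_fun do rewrite bary0.
  apply: polyf_sub; first exact: polyf_cst.
  by apply: polyf_sum => k; exact: polyf_coord.
by under eq_fun do rewrite baryS; exact: polyf_coord.
Qed.

Lemma bary_affine n (y : 'rV[R]_n) :
  bary y = y *m row_mx (const_mx (-1)) 1%:M + row_mx 1%:M 0.
Proof.
rewrite /bary mul_mx_row mulmx1 add_row_mx addr0; congr row_mx.
apply/rowP => i; rewrite ord1 !mxE eqxx !mulr1n addrC; congr (_ + _).
by rewrite -sumrN; apply: eq_bigr => j _; rewrite mxE mulrN1.
Qed.

Lemma stdsimplex_perm n (s : {perm 'I_n}) (x : 'rV[R]_n) :
  stdsimplex (col_perm s x) <-> stdsimplex x.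
Proof.
have key (t : {perm 'I_n}) (z : 'rV[R]_n) : stdsimplex z -> stdsimplex (col_perm t z).
  move=> [z0 z1]; split=> [i|]; first by rewrite mxE.
  rewrite -z1 [RHS](reindex_inj (@perm_inj _ t)) /=.
  by apply: eq_bigr => i _; rewrite mxE.
split; last exact: key.
move=> /(key s^-1%g); suff -> : col_perm s^-1 (col_perm s x) = x by [].
by apply/rowP => i; rewrite !mxE permKV.
Qed.

Definition centroid n : 'rV[R]_n := const_mx n%:R^-1.

Lemma stdsimplex_centroid n : stdsimplex (centroid n.+1).
Proof.
split=> [i|]; first by rewrite mxE invr_ge0.
under eq_bigr do rewrite mxE.
by rewrite sumr_const card_ord -(mulr_natr n.+1%:R^-1) mulVf // pnatr_eq0.
Qed.
End StandardSimplex.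

Section SimplexIntegral.
Context {R : realType} dT (T : measurableType dT) (mu : {measure set T -> \bar R}).
Variables (n : nat) (pt : T -> 'rV[R]_n).
Hypothesis cm : coord_measure mu pt.
Implicit Types F G : 'rV[R]_(1 + n) -> R.

Definition simplex_int F : R := cint mu pt (refset (n := n)) (fun y => F (bary y)).

Lemma region_refset : region pt (refset (n := n)).
Proof.
split.
  have -> : pt @^-1` (refset (n := n)) = (pt @^-1` [set x | forall i, - x 0 i <= 0]) `&`
      (pt @^-1` [set x | \sum_i x 0 i <= 1]).
    by apply/seteqP; split => t /= [H1 H2]; split => // i; have := H1 i; rewrite oppr_le0.
  apply: measurableI.
    apply: (measurable_all (A := fun i => [set x : 'rV[R]_n | - x 0 i <= 0])) => i.
    by apply: (measurable_polyf_le cm); apply: polyf_opp; exact: polyf_coord.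
  by apply: (measurable_polyf_le cm); apply: polyf_sum => i; exact: polyf_coord.
exists 1 => x [x0 x1] i; rewrite ger0_norm //; apply: le_trans x1.
by rewrite (bigD1 i) //= lerDl sumr_ge0.
Qed.

Lemma simplex_int_linear a F G : polyf F -> polyf G ->
  simplex_int (fun x => a * F x + G x) = a * simplex_int F + simplex_int G.
Proof.
move=> pF pG; apply: (cint_linear cm a region_refset); exact: polyf_bary.
Qed.

Lemma eq_simplex_int F G : (forall x, stdsimplex x -> F x = G x) -> simplex_int F = simplex_int G.
Proof. by move=> FG; apply: eq_cint => y /refset_bary; exact: FG. Qed.

Lemma simplex_int_ge0 F : (forall x, stdsimplex x -> 0 <= F x) -> 0 <= simplex_int F.
Proof. by move=> F0; apply: cint_ge0 => y /refset_bary; exact: F0. Qed.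

(** Points with positive coordinates are centres of boxes in the simplex, so [cint_eq0] applies to
    them. Any other point is the end of a segment from the centroid on which the polynomial
    vanishes. *)
Lemma simplex_int_eq0 F x : polyf F -> (forall x, stdsimplex x -> 0 <= F x) ->
  simplex_int F = 0 -> stdsimplex x -> F x = 0.
Proof.
move=> pF F0 int0 Dx.
pose c : 'rV[R]_(1 + n) := centroid n.+1.
have Dc : stdsimplex c by exact: stdsimplex_centroid.
have n1 : 0 < n.+1%:R :> R by [].
have [q hq] := polyf_line c (x - c) pF.
suff q0 : q = 0 by have := hq 1; rewrite q0 horner0 scale1r addrC subrK.
apply: (@poly_zero_near _ _ 1) => // t /andP[t0 t1]; rewrite -hq.
set z := c + t *: (x - c).
have zE i : z 0 i = (1 - t) * n.+1%:R^-1 + t * x 0 i by rewrite !mxE; ring.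
(* All coordinates of [z] are at least [eta]. In a box of half-width [eta / n.+1] the zeroth one
   loses at most [n] times that width and stays nonnegative. *)
pose eta := (1 - t) * n.+1%:R^-1 : R.
have eta0 : 0 < eta by rewrite mulr_gt0 ?invr_gt0 // subr_gt0.
have zeta i : eta <= z 0 i by rewrite zE lerDl mulr_ge0 // ?(ltW t0) // Dx.1.
have sz : \sum_i z 0 i = 1.
  have -> : \sum_i z 0 i = \sum_(i < 1 + n) (1 - t) * n.+1%:R^-1 + t * \sum_i x 0 i.
    by rewrite mulr_sumr -big_split /=; apply: eq_bigr => i _.
  rewrite Dx.2 sumr_const card_ord -(mulr_natr ((1 - t) / n.+1%:R)).
  by rewrite mulfVK ?gt_eqF // mulr1 subrK.
have zb := unbaryK sz.
rewrite -zb; apply: (@cint_eq0 _ _ _ _ _ _ cm _ (fun y => F (bary y)) _ (eta / n.+1%:R) region_refset).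
- exact: polyf_bary.
- by move=> y /refset_bary; exact: F0.
- exact: int0.
- by rewrite divr_gt0.
move=> y yz; have le1 : eta / n.+1%:R <= eta by rewrite ler_pdivrMr // ler_peMr ?ler1n // ltW.
split=> [i|].
  have := yz i; rewrite ltr_distl => /andP[h _]; have := zeta (rshift 1 i).
  by move=> zi; apply/ltW; apply: le_lt_trans h; rewrite unbaryE subr_ge0 (le_trans le1).
have h0 := zeta (lshift n 0); move: sz; rewrite big_split_ord big_ord1 /= => sz.
apply: (@le_trans _ _ (\sum_i (z 0 (rshift 1 i) + eta / n.+1%:R))).
  by apply: ler_sum => i _; have := yz i; rewrite ltr_distl unbaryE => /andP[_ /ltW].
rewrite big_split /= sumr_const card_ord.
have : eta / n.+1%:R *+ n <= eta.
  by rewrite -mulr_natr mulrAC ler_pdivrMr // ler_pM2l // ler_nat.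
move=> le2; apply: (@le_trans _ _ (\sum_(i < n) z 0 (rshift 1 i) + z 0 (lshift n ord0))).
  by rewrite lerD2l; apply: (le_trans le2); exact: zeta.
by rewrite addrC sz.
Qed.

Lemma simplex_int1_gt0 : 0 < simplex_int (fun=> 1).
Proof.
rewrite lt_neqAle simplex_int_ge0 // andbT eq_sym; apply/eqP => h.
have := simplex_int_eq0 (polyf_cst _ 1) (fun _ _ => ler01) h (stdsimplex_centroid n).
by apply/eqP; rewrite oner_eq0.
Qed.

(** A permutation of the vertices is an affine bijection of the reference simplex. The modulus of
    its determinant is found without computation: the change of variables applied to the constant
    [1], whose integral is positive, forces it to be one. *)
Lemma simplex_int_perm (s : {perm 'I_(1 + n)}) F : polyf F ->
  simplex_int (fun x => F (col_perm s x)) = simplex_int F.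
Proof.
pose B : 'M[R]_(n, 1 + n) := row_mx (const_mx (-1)) 1%:M.
pose e0 : 'rV[R]_(1 + n) := row_mx 1%:M 0.
pose M (s : {perm 'I_(1 + n)}) : 'M[R]_n := rsubmx (B *m perm_mx s^-1).
pose b (s : {perm 'I_(1 + n)}) : 'rV[R]_n := rsubmx (e0 *m perm_mx s^-1).
have alpha (t : {perm 'I_(1 + n)}) (y : 'rV[R]_n) : bary (y *m M t + b t) = col_perm t (bary y).
  have -> : y *m M t + b t = unbary (col_perm t (bary y)).
    rewrite /M /b /unbary col_permE bary_affine mulmxDl -mulmxA.
    by rewrite mulmx_rsub -linearD.
  apply: unbaryK; rewrite -(sum_bary y) [RHS](reindex_inj (@perm_inj _ t)) /=.
  by apply: eq_bigr => i _; rewrite mxE.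
have uM : M s \in unitmx.
  have comp y : (y *m M s^-1%g + b s^-1%g) *m M s + b s = y.
    rewrite -[LHS]baryK alpha alpha -[RHS]baryK; congr unbary.
    by rewrite -col_permM mulgV col_perm1.
  have b0 : b s^-1%g *m M s + b s = 0 by have := comp 0; rewrite mul0mx add0r.
  have MM : M s^-1%g *m M s = 1%:M.
    apply/row_matrixP => i; rewrite rowE [RHS]rowE mulmx1.
    have := comp (delta_mx 0 i); rewrite mulmxDl -addrA b0 addr0 => {2}<-.
    by rewrite mulmxA.
  by have [] := mulmx1_unit MM.
have main G : polyf G -> simplex_int G = `|\det (M s)| * simplex_int (fun x => G (col_perm s x)).
  move=> pG; rewrite /simplex_int (cint_affine cm (b s) region_refset (polyf_bary pG) uM).
  congr (_ * _).
  have -> : [set y | refset (y *m M s + b s)] = refset (n := n).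
    have E y : refset (y *m M s + b s) <-> refset y.
      by rewrite (refset_bary (_ + _)) alpha stdsimplex_perm -refset_bary.
    by apply/seteqP; split => y /= /E.
  by apply: eq_cint => y _; rewrite alpha.
move=> pF; rewrite (main _ pF).
have -> : `|\det (M s)| = 1; last by rewrite mul1r.
have /esym := main _ (polyf_cst _ 1).
rewrite -[X in _ = X -> _]mul1r; apply: mulIf; exact: lt0r_neq0 simplex_int1_gt0.
Qed.
End SimplexIntegral.

(** * Integrating a derivative along an edge of the reference simplex *)

Section SimplexFubini.
Context {R : realType} dT (T : measurableType dT) (mu : {sigma_finite_measure set T -> \bar R}).
Local Notation leb := (@lebesgue_measure R).
Local Notation muR := (mu \x leb)%E.
Variables (n : nat) (pt : T -> 'rV[R]_n).
Hypothesis cm : coord_measure mu pt.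

Definition ins0 m (x : 'rV[R]_(1 + m)) : 'rV[R]_(1 + (1 + m)) := row_mx 0 x.
Definition ins1 m (x : 'rV[R]_(1 + m)) : 'rV[R]_(1 + (1 + m)) :=
  row_mx (lsubmx x) (row_mx 0 (rsubmx x)).

Lemma horner_FTC (q : {poly R}) (c : R) : 0 <= c ->
  (\int[leb]_(z in `[0%R, c]) (q^`().[z])%:E = (q.[c] - q.[0])%:E)%E.
Proof.
rewrite le_eqVlt => /predU1P[<-|c0].
  by rewrite subrr set_itv1 integral_set1.
have cq (p : {poly R}) : continuous (horner p) by exact: continuous_horner.
rewrite (@continuous_FTC2 _ _ (horner q)) //.
- by apply: continuous_subspaceT; exact: cq.
- split; [by move=> x _; exact: derivable_horner|
    exact/cvg_at_right_filter/cq|exact/cvg_at_left_filter/cq].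
by move=> x _; rewrite -derivE.
Qed.

(** The direction points from vertex zero to vertex one. With the other coordinates fixed, the
    simplex is cut in the segment from [ins1 (bary y)] to [ins0 (bary y)], whose ends lie on the
    faces opposite to vertices one and zero; the inner integral is that of a univariate
    derivative. *)
Lemma simplex_fubini (H : 'rV[R]_(1 + (1 + n)) -> R) : polyf H ->
  simplex_int muR (cons_pt pt) (fun x => derive H x (row_mx (-1)%:M (row_mx 1%:M 0))) =
  simplex_int mu pt (fun x => H (ins0 x)) - simplex_int mu pt (fun x => H (ins1 x)).
Proof.
move=> pH; set v := row_mx _ _.
have cmR := coord_measure_cons cm.
have pH' := polyf_derive v pH.
pose D := (cons_pt pt) @^-1` (refset (n := 1 + n)).
have rD := region_refset cmR.
pose phi (t : T * measurableTypeR R) := derive H (bary (cons_pt pt t)) v.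
have iphi : muR.-integrable D (EFin \o phi) by exact: (integrable_polyf cmR rD (polyf_bary pH')).
have iphiD : muR.-integrable setT ((EFin \o phi) \_ D).
  exact: (proj1 (integrable_mkcond _ (proj1 rD)) iphi).
have pi0 : polyf (fun x : 'rV[R]_(1 + n) => H (ins0 x)).
  apply: polyf_comp => // i; rewrite /ins0; case: (split_ordP i) => j ->.
    by under eq_fun do rewrite row_mxEl mxE; exact: polyf_cst.
  by under eq_fun do rewrite row_mxEr; exact: polyf_coord.
have pi1 : polyf (fun x : 'rV[R]_(1 + n) => H (ins1 x)).
  apply: polyf_comp => // i; rewrite /ins1; case: (split_ordP i) => j ->.
    by under eq_fun do rewrite row_mxEl mxE; exact: polyf_coord.
  under eq_fun do rewrite row_mxEr; case: (split_ordP j) => k ->.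
    by under eq_fun do rewrite row_mxEl mxE; exact: polyf_cst.
  by under eq_fun do rewrite row_mxEr mxE; exact: polyf_coord.
have rT := region_refset cm.
have -> : simplex_int mu pt (fun x => H (ins0 x)) - simplex_int mu pt (fun x => H (ins1 x)) =
    cint mu pt (refset (n := n)) (fun y => H (ins0 (bary y)) - H (ins1 (bary y))).
  have := simplex_int_linear cm (-1) pi1 pi0.
  rewrite mulN1r addrC => <-; apply: eq_cint => y _; rewrite mulN1r addrC //.
rewrite /simplex_int {1}/cint /Rintegral integral_mkcond.
rewrite -(integral12_prod_meas1 iphiD) /cint /Rintegral [in RHS]integral_mkcond.
congr fine; apply: eq_integral => p _; rewrite /fubini_F.
set y := pt p; set s := \sum_i y 0 i.
have sumE (z : R) : \sum_i (cons_pt pt (p, z)) 0 i = z + s.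
  rewrite big_split_ord /= big_ord1 row_mxEl mxE eqxx mulr1n; congr (_ + _).
  by apply: eq_bigr => i _; rewrite row_mxEr.
have DE (z : R) : D (p, z) <-> [/\ 0 <= z, forall i, 0 <= y 0 i & z <= 1 - s].
  rewrite /D /refset /= sumE; split=> [[H1 H2]|[H1 H2 H3]].
    split; last by lra.
      by have := H1 (lshift n 0); rewrite row_mxEl mxE eqxx mulr1n.
    by move=> i; have := H1 (rshift 1 i); rewrite row_mxEr.
  split; last by lra.
  by move=> i; case: (split_ordP i) => j ->; rewrite ?row_mxEr // row_mxEl ord1 mxE eqxx.
rewrite patchE; case: ifPn => [/set_mem yr|/negP yr]; last first.
  apply: integral0_eq => z _; rewrite patchE memNset // => /DE[z0 y0 zs].
  by apply: yr; apply: mem_set; split => //; rewrite -/y -/s; lra.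
have [y0 s1] := yr; rewrite -/y in y0; rewrite -/y -/s in s1.
have lineE (z : R) : bary (cons_pt pt (p, z)) = ins1 (bary y) + z *: v.
  rewrite /bary sumE /ins1 row_mxKl row_mxKr /v scale_row_mx add_row_mx.
  congr row_mx.
    by apply/rowP => i; rewrite ord1 !mxE eqxx !mulr1n -/s; ring.
  rewrite scale_row_mx add_row_mx scaler0 addr0 add0r; congr row_mx.
  by apply/rowP => i; rewrite ord1 !mxE eqxx !mulr1n mulr1.
have [q hq] := polyf_line (ins1 (bary y)) v pH.
transitivity (\int[leb]_(z in `[0%R, (1 - s)%R]) (q^`().[z])%:E)%E.
  rewrite [RHS]integral_mkcond; apply: eq_integral => z _; rewrite !patchE.
  have -> : ((p, z) \in D) = (z \in `[0, 1 - s]%classic).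
    apply/idP/idP => [/set_mem/DE[z0 _ zs]|/set_mem].
      by apply: mem_set; rewrite /= in_itv /= z0.
    by rewrite /= in_itv /= => /andP[z0 zs]; apply: mem_set; apply/DE.
  case: ifP => // _; rewrite /phi /= lineE (polyf_line_derive z pH hq) //.
rewrite horner_FTC ?subr_ge0 //=; congr (_%:E).
rewrite -!hq scale0r addr0; congr (H _ - _).
rewrite /ins1 /ins0 /bary row_mxKl row_mxKr /v scale_row_mx add_row_mx; congr row_mx.
  by apply/rowP => i; rewrite ord1 !mxE eqxx !mulr1n -/s; ring.
rewrite scale_row_mx add_row_mx scaler0 addr0 add0r; congr row_mx.
by apply/rowP => i; rewrite ord1 !mxE eqxx !mulr1n mulr1.
Qed.
End SimplexFubini.

(** * Convex hulls and determinants *)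

Section Convex.
Context {R : realType} {d : nat}.
Local Notation pt := 'rV[R]_d.

(** Each weight moves to an index of the second family carrying the same point, and weights that
    meet are added. This makes hulls insensitive to order and repetition in vertex lists. *)
Lemma convex_transfer m k (p : 'I_m -> pt) (q : 'I_k -> pt) (P : 'I_k -> Prop) (lam : 'I_m -> R) :
  (forall i, 0 <= lam i) -> (forall i, lam i != 0 -> exists2 j, q j = p i & P j) ->
  exists mu : 'I_k -> R, [/\ forall j, 0 <= mu j, \sum_j mu j = \sum_i lam i,
    \sum_j mu j *: q j = \sum_i lam i *: p i & forall j, ~ P j -> mu j = 0].
Proof.
move=> lam0 H.
have ex i : exists o : option 'I_k, if o is Some j then q j = p i /\ P j else lam i = 0.
  by have [e|/H[j qj Pj]] := eqVneq (lam i) 0; [exists None|exists (Some j)].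
pose g i := proj1_sig (cid (ex i)).
have gP i : if g i is Some j then q j = p i /\ P j else lam i = 0 := proj2_sig (cid (ex i)).
pose mu j := \sum_(i | g i == Some j) lam i; exists mu; split.
- by move=> j; exact: sumr_ge0.
- rewrite /mu (exchange_big_dep xpredT) //=; apply: eq_bigr => i _.
  have := gP i; case: (g i) => [j _|->].
    by rewrite (big_pred1 j) // => j'; rewrite eq_sym; apply/eqP/eqP => [->|[]].
  by rewrite big_pred0 // => j.
- rewrite /mu; under eq_bigr do rewrite scaler_suml.
  rewrite (exchange_big_dep xpredT) //=; apply: eq_bigr => i _.
  have := gP i; case: (g i) => [j [<- _]|->].
    by rewrite (big_pred1 j) // => j'; rewrite eq_sym; apply/eqP/eqP => [->|[]].
  by rewrite big_pred0 ?scale0r // => j.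
move=> j nP; rewrite /mu big1 // => i /eqP gi; have := gP i; rewrite gi => -[_ /nP] //.
Qed.

Lemma conv_rows m (s : seq pt) (W : 'M[R]_(m, d)) x : (forall v, v \in s -> exists i, v = row i W) ->
  Defs.conv s x -> exists lam : 'rV[R]_m, [/\ stdsimplex lam, x = lam *m W &
    forall i, row i W \notin s -> lam 0 i = 0].
Proof.
move=> sW [l [l0 [l1 ->]]].
have [|mu [mu0 mu1 <- muP]] := @convex_transfer _ m (fun j : 'I_(size s) => nth 0 s j)
    (fun i => row i W) (fun i => row i W \in s) l l0.
  move=> j _; have [i e] := sW _ (mem_nth 0 (ltn_ord j)).
  by exists i; rewrite -e // mem_nth.
exists (\row_i mu i); split.
- by split=> [i|]; [rewrite mxE|rewrite -l1 -mu1; apply: eq_bigr => i _; rewrite mxE].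
- by rewrite mulmx_sum_row; apply: eq_bigr => i _; rewrite mxE.
by move=> i /negP/muP; rewrite mxE.
Qed.

Lemma rows_conv m (s : seq pt) (W : 'M[R]_(m, d)) (lam : 'rV[R]_m) : stdsimplex lam ->
  (forall i, lam 0 i != 0 -> row i W \in s) -> Defs.conv s (lam *m W).
Proof.
move=> [l0 l1] H; have [|mu [mu0 mu1 e _]] := @convex_transfer _ (size s) (fun i => row i W)
    (fun j => nth 0 s j) (fun=> True) (fun i => lam 0 i) l0.
  move=> i /H Hi; have lt : (index (row i W) s < size s)%N by rewrite index_mem.
  by exists (Ordinal lt) => //=; rewrite nth_index.
by exists mu; split => //; split; [rewrite mu1|rewrite e mulmx_sum_row].
Qed.

Lemma conv_mem (s s' : seq pt) : (s =i s') -> Defs.conv s = Defs.conv s'.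
Proof.
suff key (u v : seq pt) : u =i v -> Defs.conv u `<=` Defs.conv v.
  by move=> e; apply/seteqP; split; apply: key => // x; rewrite e.
move=> uv x [l [l0 [l1 ->]]].
have -> : \sum_j l j *: nth 0 u j = (\row_j l j) *m (\matrix_(j < size u) nth 0 u j).
  by rewrite mulmx_sum_row; apply: eq_bigr => j _; rewrite mxE rowK.
apply: rows_conv => [|j _]; last by rewrite rowK -uv mem_nth.
by split=> [j|]; [rewrite mxE|rewrite -l1; apply: eq_bigr => j _; rewrite mxE].
Qed.

Lemma vertsP (K : 'M[R]_(d.+1, d)) v : reflect (exists i, v = row i K) (v \in verts K).
Proof.
apply: (iffP mapP) => [[i _ ->]|[i ->]]; first by exists i.
by exists i => //; rewrite mem_enum.
Qed.

Lemma face_vertsP (K : 'M[R]_(d.+1, d)) i v :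
  reflect (exists2 j, j != i & v = row j K) (v \in face_verts K i).
Proof.
apply: (iffP mapP) => [[j]|[j ji ->]].
  by rewrite mem_filter => /andP[ji _] ->; exists j.
by exists j => //; rewrite mem_filter ji mem_enum.
Qed.

Lemma hullP (K : 'M[R]_(d.+1, d)) x :
  hull K x <-> exists2 lam : 'rV[R]_d.+1, stdsimplex lam & x = lam *m K.
Proof.
split=> [/(@conv_rows _ (verts K) K)[v /vertsP//|lam [H -> _]]|[lam Dl ->]].
  by exists lam.
by apply: rows_conv => // i _; apply/vertsP; exists i.
Qed.

Lemma faceP (K : 'M[R]_(d.+1, d)) i x :
  face K i x <-> exists lam : 'rV[R]_d.+1, [/\ stdsimplex lam, lam 0 i = 0 & x = lam *m K].
Proof.
split=> [H|[lam [Dl li ->]]].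
  have [|lam [Dl e sup]] := @conv_rows _ (face_verts K i) (row' i K) x _ H.
    move=> v /face_vertsP[j ji ->]; have [k ->|/eqP] := unliftP i j; last by rewrite (negbTE ji).
    by exists k; apply/rowP => c; rewrite !mxE.
  exists (\row_j if unlift i j is Some k then lam 0 k else 0); split.
  - split=> [j|]; first by rewrite mxE; case: unliftP => // k _; exact: Dl.1.
    rewrite (bigD1_ord i) //= mxE unlift_none add0r -Dl.2.
    by apply: eq_bigr => k _; rewrite mxE liftK.
  - by rewrite mxE unlift_none.
  rewrite e !mulmx_sum_row (bigD1_ord i) //= mxE unlift_none scale0r add0r.
  by apply: eq_bigr => k _; rewrite mxE liftK; congr (_ *: _); apply/rowP => c; rewrite !mxE.
apply: rows_conv => // j lj; apply/face_vertsP; exists j => //.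
by apply: contraNneq lj => ->; rewrite li.
Qed.

Lemma filter_neq_lift m (i : 'I_m.+1) :
  [seq j <- enum 'I_m.+1 | j != i] = [seq lift i k | k <- enum 'I_m].
Proof.
apply: (inj_map val_inj); apply: (irr_sorted_eq ltn_trans ltnn).
- rewrite sorted_map; apply: sorted_filter; first by move=> x y z; exact: ltn_trans.
  by rewrite -sorted_map val_enum_ord iota_ltn_sorted.
- rewrite -map_comp sorted_map; apply: (sub_sorted (e := relpre val ltn)).
    move=> x y /= xy; by rewrite ltnNge leq_bump2 -ltnNge.
  by rewrite -sorted_map val_enum_ord iota_ltn_sorted.
move=> x; apply/mapP/mapP => -[j].
  rewrite mem_filter => /andP[ji _] ->; have [k|] := unliftP i j; last by move/eqP: ji.
  by move=> ->; exists (lift i k) => //; apply: map_f; rewrite mem_enum.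
move=> /mapP[k _ ->] ->; exists (lift i k) => //.
by rewrite mem_filter eq_sym neq_lift mem_enum.
Qed.

Lemma face_verts_nth (K : 'M[R]_(d.+1, d)) i (k : 'I_d) :
  nth 0 (face_verts K i) k = row k (row' i K).
Proof.
rewrite /face_verts filter_neq_lift -map_comp (nth_map k) ?size_enum_ord //=.
by rewrite nth_ord_enum; apply/rowP => c; rewrite !mxE.
Qed.
End Convex.

Section Edges.
Context {R : realType}.

Definition edges m d (W : 'M[R]_(m.+1, d)) : 'M[R]_(m, d) :=
  \matrix_(j, c) (W (lift ord0 j) c - W ord0 c).

Lemma lift0_rshift m (j : 'I_m) : lift ord0 j = rshift 1 j :> 'I_(1 + m).
Proof. exact/val_inj. Qed.

Lemma bary_mulmx m d (W : 'M[R]_(m.+1, d)) (y : 'rV[R]_m) :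
  (bary y : 'rV[R]_m.+1) *m W = row ord0 W + y *m edges W.
Proof.
apply/rowP => c; rewrite !mxE (big_split_ord _ (m := 1)) /= big_ord1.
have -> : lshift m ord0 = ord0 :> 'I_(1 + m) by exact/val_inj.
have := bary0 y; rewrite (_ : lshift m 0 = ord0) => [->|]; last exact/val_inj.
rewrite mulrBl mul1r -addrA; congr (_ + _).
rewrite mulr_suml -sumrN -big_split /=; apply: eq_bigr => j _.
by rewrite baryS mxE lift0_rshift; ring.
Qed.

(** Subtracting the first row from the others clears the column of ones. The bordered determinant
    treats all vertices alike, so its modulus does not depend on their order. *)
Lemma edges_det_aug d (K : 'M[R]_(d.+1, d)) :
  \det (edges K) = \det (row_mx (const_mx 1) K : 'M[R]_(1 + d)).
Proof.
have -> : (row_mx (const_mx 1) K : 'M[R]_(1 + d)) =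
  block_mx 1%:M 0 (const_mx 1) 1%:M *m block_mx 1%:M (row ord0 K) 0 (edges K).
  rewrite mulmx_block !mulmx1 !mul1mx !mulmx0 !mul0mx !addr0.
  apply/matrixP => i j; case: (split_ordP j) => j' ->.
    rewrite row_mxEl mxE; case: (split_ordP i) => i' ->.
      by rewrite block_mxEul !mxE !ord1 eqxx.
    by rewrite block_mxEdl mxE.
  rewrite row_mxEr; case: (split_ordP i) => i' ->.
    by rewrite block_mxEur mxE (ord1 i'); congr (K _ _); exact/val_inj.
  rewrite block_mxEdr !mxE big_ord1 !mxE mul1r lift0_rshift addrC subrK //.
by rewrite det_mulmx det_lblock det_ublock !det1 !mul1r.
Qed.

Lemma edges_det_perm d (s : {perm 'I_d.+1}) (K : 'M[R]_(d.+1, d)) :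
  `|\det (edges (row_perm s K))| = `|\det (edges K)|.
Proof.
rewrite !edges_det_aug.
have rpE p q (A : 'M[R]_(p, q)) (t : {perm 'I_p}) a b : row_perm t A a b = A (t a) b by rewrite mxE.
have -> : (row_mx (const_mx 1) (row_perm s K) : 'M[R]_(1 + d)) =
    row_perm s (row_mx (const_mx 1) K : 'M[R]_(1 + d)).
  apply/matrixP => i j; case: (split_ordP j) => j' ->.
    by rewrite row_mxEl rpE row_mxEl !mxE.
  by rewrite row_mxEr !rpE row_mxEr.
by rewrite row_permE det_mulmx det_perm normrM normrX normrN normr1 expr1n mul1r.
Qed.

Lemma edges_front d (K : 'M[R]_(d.+1, d)) (i : 'I_d.+1) :
  `|\det (\matrix_(k, c) (row' i K k c - K i c))| = `|\det (edges K)|.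
Proof.
rewrite -(edges_det_perm (lift_perm ord0 i 1)); congr (`|\det _|).
apply/matrixP => k c; rewrite !mxE lift_perm_lift lift_perm_id perm1 //.
Qed.

Lemma perm_lift m (p : {perm 'I_m.+1}) (i : 'I_m.+1) :
  exists s : {perm 'I_m}, forall k, p (lift i k) = lift (p i) (s k).
Proof.
have ex k : exists k', p (lift i k) = lift (p i) k'.
  have [k' e|] := unliftP (p i) (p (lift i k)); first by exists k'.
  by move/perm_inj => e; have := neq_lift i k; rewrite e eqxx.
pose f k := proj1_sig (cid (ex k)).
have fP k : p (lift i k) = lift (p i) (f k) := proj2_sig (cid (ex k)).
have finj : injective f.
  by move=> x y e; apply: (@lift_inj _ i); apply: (@perm_inj _ p); rewrite !fP e.
by exists (perm finj) => k; rewrite permE.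
Qed.
End Edges.

(** * Barycentric coordinates and normals *)

Lemma near_gt0 {R : realType} (T : topologicalType) (f : T -> R) x :
  continuous f -> 0 < f x -> \forall y \near x, 0 < f y.
Proof.
move=> cf f0; have := cf x [set y | 0 < y]; apply.
by apply: open_nbhs_nbhs; split; [exact: open_gt|exact: f0].
Qed.

Section Barycentric.
Context {R : realType} {d : nat}.
Variable K : 'M[R]_(d.+1, d).
Hypothesis nK : nondeg K.
Local Notation pt := 'rV[R]_d.

Lemma edges_unit : edges K \in unitmx.
Proof. by rewrite unitmxE unitfE. Qed.

Definition bc (x : pt) : 'rV[R]_d.+1 := bary ((x - row ord0 K) *m invmx (edges K)).
(** The linear part of [bc]: the rates of change of the barycentric coordinates in direction [w]. *)
Definition dbc (w : pt) : 'rV[R]_d.+1 :=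
  w *m invmx (edges K) *m (row_mx (const_mx (-1)) 1%:M : 'M[R]_(d, 1 + d)).

Lemma bc_mulmx x : bc x *m K = x.
Proof. by rewrite bary_mulmx mulmxKV ?edges_unit // addrC subrK. Qed.

Lemma sum_bc x : \sum_i bc x 0 i = 1.
Proof. exact: sum_bary. Qed.

Lemma bcK (lam : 'rV[R]_d.+1) : \sum_i lam 0 i = 1 -> bc (lam *m K) = lam.
Proof.
move=> l1; rewrite -{1}(@unbaryK _ d lam l1) bary_mulmx /bc addrC addKr mulmxK ?edges_unit //.
exact: unbaryK.
Qed.

Lemma bc_line x w t : bc (x + t *: w) = bc x + t *: dbc w.
Proof.
rewrite /bc !bary_affine /dbc [in RHS]addrAC; congr (_ + _).
by rewrite addrAC !mulmxDl -!scalemxAl.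
Qed.

Lemma bc_row j : bc (row j K) = delta_mx 0 j.
Proof.
rewrite rowE bcK // (bigD1 j) //= mxE !eqxx big1 ?addr0 // => i ij.
by rewrite mxE (negbTE ij) andbF.
Qed.

Lemma dbc_edge i j : dbc (row j K - row i K) = delta_mx 0 j - delta_mx 0 i.
Proof.
have := bc_line (row i K) (row j K - row i K) 1.
by rewrite !scale1r [row i K + _]addrC subrK !bc_row => ->; rewrite [RHS]addrC addKr.
Qed.

Lemma hull_bc x : hull K x <-> forall i, 0 <= bc x 0 i.
Proof.
rewrite hullP; split=> [[lam [l0 l1] -> i]|H]; first by rewrite bcK.
by exists (bc x); [split => //; exact: sum_bc|rewrite bc_mulmx].
Qed.

Lemma face_bc i x : face K i x <-> hull K x /\ bc x 0 i = 0.
Proof.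
rewrite faceP hull_bc; split=> [[lam [[l0 l1] li ->]]|[H bi]]; first by rewrite bcK.
by exists (bc x); split => //; [split => //; exact: sum_bc|rewrite bc_mulmx].
Qed.

Lemma polyf_bc i : polyf (fun x => bc x 0 i).
Proof.
apply: (polyf_comp (f := fun y => bary y 0 i)).
  by apply: (@polyf_bary _ _ (fun z => z 0 i)); exact: polyf_coord.
by move=> j; under eq_fun do rewrite mulmxBl; exact: polyf_affine.
Qed.

Definition strict_hull : set pt := [set x | forall i, 0 < bc x 0 i].

Lemma strict_hull_nbhs x : strict_hull x -> nbhs x strict_hull.
Proof.
move=> H; apply: (@filter_forall _ _ _ (nbhs x) (nbhs_filter x)) => i.
exact: (near_gt0 (polyf_continuous (polyf_bc i))).
Qed.

Lemma strict_hull_sub : strict_hull `<=` hull K.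
Proof. by move=> x H; apply/hull_bc => i; exact: ltW. Qed.

Lemma strict_hull_interior : strict_hull `<=` interior (hull K).
Proof. by move=> x /strict_hull_nbhs; apply: filterS; exact: strict_hull_sub. Qed.

Lemma strict_hull_centroid : strict_hull ((centroid d.+1 : 'rV[R]_d.+1) *m K).
Proof.
have [_ c1] := stdsimplex_centroid (R := R) d.
by move=> i; rewrite bcK // mxE invr_gt0.
Qed.

Lemma hull_bounded : exists r, forall x, hull K x -> forall i : 'I_d, `|x 0 i| <= r.
Proof.
exists (\sum_i \sum_j `|K i j|) => x /hullP[lam [l0 l1] ->] c; rewrite mxE.
apply: le_trans (ler_norm_sum _ _ _) _; apply: ler_sum => i _; rewrite normrM.
have li : `|lam 0 i| <= 1.
  by rewrite ger0_norm // -l1 (bigD1 i) //= lerDl sumr_ge0.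
apply: le_trans (ler_wpM2r (normr_ge0 _) li) _; rewrite mul1r.
by rewrite (bigD1 c) //= lerDl sumr_ge0.
Qed.

Lemma polyf_hull_ext f g : polyf f -> polyf g -> (forall x, hull K x -> f x = g x) ->
  forall x, f x = g x.
Proof.
move=> pf pg fg x; apply/eqP; rewrite -subr_eq0; apply/eqP; move: x.
have /nbhs_ballP[e /= e0 H] := strict_hull_nbhs strict_hull_centroid.
apply: (polyf_zero_box (polyf_sub pf pg) e0) => y yc; rewrite fg ?subrr //.
by apply/strict_hull_sub/H; apply: rV_ball => // i; rewrite distrC.
Qed.
End Barycentric.

Section Normals.
Context {R : realType} {d : nat}.
Local Notation pt := 'rV[R]_d.

Lemma dotvE (u v : pt) : dotv u v = (u *m v^T) 0 0.
Proof. by rewrite mxE; apply: eq_bigr => i _; rewrite mxE. Qed.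

Lemma dotvC (u v : pt) : dotv u v = dotv v u.
Proof. by apply: eq_bigr => i _; rewrite mulrC. Qed.

Lemma dotv_linear a (u v w : pt) : dotv (a *: u + v) w = a * dotv u w + dotv v w.
Proof. by rewrite !dotvE mulmxDl -scalemxAl !mxE. Qed.

Lemma dotvZr a (u w : pt) : dotv u (a *: w) = a * dotv u w.
Proof. by have := dotv_linear a w 0 u; rewrite addr0 !(dotvC _ u) => ->; rewrite [dotv u 0]dotvE trmx0 mulmx0 mxE addr0. Qed.

Lemma dotvv_ge0 (u : pt) : 0 <= dotv u u.
Proof. by apply: sumr_ge0 => i _; rewrite -expr2 sqr_ge0. Qed.

Lemma dotvv_eq0 (u : pt) : dotv u u = 0 -> u = 0.
Proof.
move/eqP; rewrite psumr_eq0 => [/allP H|i _]; last by rewrite -expr2 sqr_ge0.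
by apply/rowP => i; have := H i (mem_index_enum _); rewrite mulf_eq0 orbb mxE => /eqP.
Qed.

Lemma ecoord_sum (w : pt) : w = \sum_c w 0 c *: ecoord c.
Proof.
apply/rowP => c; rewrite summxE (bigD1 c) //= big1 ?addr0 => [|c' ne]; rewrite !mxE.
  by rewrite eqxx mulr1.
by rewrite eq_sym (negbTE ne) mulr0.
Qed.

Lemma dotvZl a (u w : pt) : dotv (a *: u) w = a * dotv u w.
Proof. by rewrite dotvC dotvZr dotvC. Qed.

Lemma dotv_suml (J : Type) (r : seq J) (P : pred J) (F : J -> pt) w :
  dotv (\sum_(j <- r | P j) F j) w = \sum_(j <- r | P j) dotv (F j) w.
Proof. by rewrite dotvE mulmx_suml summxE; apply: eq_bigr => j _; rewrite dotvE. Qed.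
End Normals.

(** * Normals, heights and Gram determinants *)

Section FaceNormal.
Context {R : realType} {n : nat}.
Local Notation pt := 'rV[R]_n.+1.
Variable K : 'M[R]_(n.+2, n.+1).
Hypothesis nK : nondeg K.

Lemma dbc_mulmx w : dbc K w *m K = w.
Proof.
have := bc_line K 0 w 1; rewrite !scale1r add0r => e.
by have := bc_mulmx nK w; rewrite e mulmxDl (bc_mulmx nK) add0r.
Qed.

Lemma sum_dbc w : \sum_i dbc K w 0 i = 0.
Proof.
have := bc_line K 0 w 1; rewrite !scale1r add0r => e.
have := sum_bc K w; rewrite e.
under eq_bigr do rewrite mxE.
by rewrite big_split /= sum_bc => /(canRL (addKr _)); rewrite addNr.
Qed.

Lemma dbc_dotv i : exists a : pt, forall w, dbc K w 0 i = dotv w a.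
Proof.
exists (\row_c dbc K (ecoord c) 0 i) => w.
rewrite {1}[w]ecoord_sum /dbc !mulmx_suml summxE; apply: eq_bigr => c _.
by rewrite [in RHS]mxE -!scalemxAl mxE.
Qed.

Lemma lift_neq i : exists j : 'I_n.+2, j != i.
Proof. by exists (lift i ord0); rewrite eq_sym neq_lift. Qed.

(** The normal is a negative multiple of the gradient [a] of barycentric coordinate [i], and [h],
    the inverse of the length of [a], is the height of vertex [i] above the face. Exhibiting this
    vector also shows that the choice in [nrm] succeeds. *)
Lemma nrmP i : enorm (nrm K i) = 1 /\
  exists2 h, 0 < h & forall w, dotv w (nrm K i) = - h * dbc K w 0 i.
Proof.
have [e1 [eq gt]] : [set m : pt | enorm m = 1 /\
     (forall j j', j != i -> j' != i -> dotv m (row j K - row j' K) = 0) /\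
     (forall j, j != i -> 0 < dotv m (row j K - row i K))] (nrm K i).
  apply: xgetPex; have [a ha] := dbc_dotv i; have [j0 j0i] := lift_neq i.
  have a0 : a != 0.
    apply: contraTneq (oner_neq0 R) => a0; have := ha (row i K - row j0 K).
    rewrite a0 dotvE trmx0 mulmx0 [RHS]mxE dbc_edge // !mxE !eqxx [i == j0]eq_sym (negbTE j0i).
    by move=> /= /eqP; rewrite subr0 oner_eq0.
  have aa : 0 < dotv a a.
    by rewrite lt_neqAle dotvv_ge0 andbT; apply: contra_neq a0 => /esym; exact: dotvv_eq0.
  pose h := (enorm a)^-1; have h0 : 0 < h by rewrite invr_gt0 sqrtr_gt0.
  exists (- h *: a); split.
    rewrite /enorm dotvZl dotvZr mulrA mulrNN -expr2 sqrtrM ?sqr_ge0 // sqrtr_sqr.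
    by rewrite gtr0_norm // mulVf // gt_eqF // sqrtr_gt0.
  have E j j' : dotv (- h *: a) (row j K - row j' K) = - h * ((i == j)%:R - (i == j')%:R).
    by rewrite dotvZl dotvC -ha dbc_edge // !mxE !eqxx.
  split=> [j j' ji j'i|j ji]; rewrite E.
    by rewrite !(eq_sym i) (negbTE ji) (negbTE j'i) subrr mulr0.
  by rewrite eqxx eq_sym (negbTE ji) sub0r mulrN mulr1 opprK.
split => //; have [j0 j0i] := lift_neq i.
exists (dotv (nrm K i) (row j0 K - row i K)); first exact: gt.
move=> w; rewrite -{1}(dbc_mulmx w) mulmx_sum_row.
have -> : \sum_j dbc K w 0 j *: row j K = \sum_j dbc K w 0 j *: (row j K - row j0 K).
  under [RHS]eq_bigr do rewrite scalerBr.
  by rewrite sumrB -scaler_suml sum_dbc scale0r subr0.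
rewrite dotv_suml (bigD1 i) //= big1 => [|j ji].
  by rewrite addr0 dotvZl -opprB dotvC -scaleN1r dotvZr; ring.
by rewrite dotvZl dotvC eq // mulr0.
Qed.

(** Volume is base times height, up to factorials. Row operations reduce the edge matrix to one edge
    [y0] from the apex and the edges [G] of the face. Multiplied by the transpose of [N], which is
    [G] bordered by the unit normal, it becomes block triangular with corner [h]; and [det N]
    squared is the Gram determinant. *)
Lemma gram_height i h : (forall w, dotv w (nrm K i) = - h * dbc K w 0 i) -> 0 < h ->
  h * Num.sqrt (\det (edges (row' i K) *m (edges (row' i K))^T)) = `|\det (edges K)|.
Proof.
move=> hn h0; have [n1 _] := nrmP i; set m := nrm K i in hn n1 *.
pose G := edges (row' i K); pose N : 'M[R]_(1 + n) := col_mx m G.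
have Gm : G *m m^T = 0.
  apply/matrixP => a b; rewrite ord1.
  have -> : (G *m m^T) a 0 = dotv (row (lift i (lift ord0 a)) K - row (lift i ord0) K) m.
    by rewrite dotvE !mxE; apply: eq_bigr => c _; rewrite !mxE.
  rewrite hn dbc_edge // !mxE !eqxx.
  by rewrite !(negbTE (neq_lift _ _)) subrr mulr0.
have NN : N *m N^T = block_mx 1%:M 0 0 (G *m G^T).
  rewrite tr_col_mx mul_col_row Gm; congr block_mx.
    rewrite [LHS]mx11_scalar -dotvE; congr (_%:M).
    by rewrite -[dotv _ _]sqr_sqrtr ?dotvv_ge0 // -/(enorm m) n1 expr1n.
  by apply: trmx_inj; rewrite trmx_mul trmxK Gm trmx0.
have dN : \det (G *m G^T) = \det N ^+ 2.
  have := congr1 determinant NN; rewrite det_lblock det_scalar1 mul1r det_mulmx det_tr => <-.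
  by rewrite expr2.
rewrite -/G dN sqrtr_sqr.
have uN : \det N != 0.
  rewrite -det_tr; apply/negP => /det0P[v /eqP v0].
  rewrite tr_col_mx mul_mx_row -[RHS]row_mx0 => /eq_row_mx[vm vG]; apply: v0.
  have di : dbc K v 0 i = 0.
    apply: (mulfI (lt0r_neq0 h0)); apply: oppr_inj.
    by rewrite mulr0 oppr0 -mulNr -hn dotvE vm mxE.
  apply: dotvv_eq0; rewrite -{1}(dbc_mulmx v) mulmx_sum_row.
  have -> : \sum_j dbc K v 0 j *: row j K = \sum_j dbc K v 0 j *: (row j K - row (lift i ord0) K).
    under [RHS]eq_bigr do rewrite scalerBr.
    by rewrite sumrB -scaler_suml sum_dbc scale0r subr0.
  rewrite dotv_suml big1 // => j _; rewrite dotvZl.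
  have [k ->|->] := unliftP i j; last by rewrite di mul0r.
  have [c ->|->] := unliftP ord0 k; last by rewrite subrr dotvE mul0mx [X in _ * X]mxE mulr0.
  have e : dotv v (row (lift i (lift ord0 c)) K - row (lift i ord0) K) = (v *m G^T) 0 c.
    by rewrite dotvE [LHS]mxE [RHS]mxE; apply: eq_bigr => x _; rewrite /G /edges !mxE.
  by rewrite dotvC e vG [X in _ * X]mxE mulr0.
rewrite -(edges_front K i).
set Y := \matrix_(_, _) _.
pose L : 'M[R]_(1 + n) := block_mx 1%:M 0 (const_mx (-1)) 1%:M.
pose y0 : pt := row (lift i ord0) K - row i K.
pose Y' : 'M[R]_(1 + n, n.+1) := Y.
have YE : Y' = col_mx y0 (G + const_mx 1 *m y0).
  apply/matrixP => a c; case: (split_ordP a) => b ->.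
    rewrite col_mxEu ord1 /Y' /Y /y0 !mxE; congr (K _ c - _).
    by congr lift; apply/val_inj.
  rewrite col_mxEd /Y' /Y /G /edges /y0 !mxE big_ord1 !mxE mul1r.
  have -> : rshift 1 b = lift ord0 b :> 'I_n.+1 by exact/val_inj.
  by rewrite addrA subrK.
have LY : L *m Y' = col_mx y0 G.
  rewrite YE mul_block_col mul1mx mul0mx addr0 mul1mx; congr col_mx.
  rewrite addrC -addrA -mulmxDl [X in X *m _](_ : _ = 0) ?mul0mx ?addr0 //.
  by apply/matrixP => a b; rewrite !mxE subrr.
have LYN : L *m Y' *m N^T = block_mx (h%:M) (y0 *m G^T) 0 (G *m G^T).
  rewrite LY tr_col_mx mul_col_row Gm; congr block_mx.
  rewrite [LHS]mx11_scalar -dotvE; congr (_%:M).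
  by rewrite /y0 hn dbc_edge // !mxE !eqxx (negbTE (neq_lift _ _)) sub0r mulrNN mulr1.
have := congr1 (fun z : 'M[R]_(1 + n) => \det z) LYN.
rewrite det_ublock det_scalar1 dN !det_mulmx det_lblock !det_scalar !expr1n !mul1r det_tr.
rewrite expr2 mulrA => /(mulIf uN) ->.
by rewrite normrM (gtr0_norm h0).
Qed.
End FaceNormal.

(** * Element and face integrals *)

Section OpenMeasurable.
Context {R : realType} dT (T : measurableType dT) (mu : {measure set T -> \bar R}).
Variables (n : nat) (pt : T -> 'rV[R]_n).
Hypothesis cm : coord_measure mu pt.

(** The set is the countable union of the boxes with rational centre and radius that it contains. *)
Lemma measurable_open (U : set 'rV[R]_n) : (forall x, U x -> nbhs x U) -> measurable (pt @^-1` U).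
Proof.
move=> oU.
pose box (c : 'rV[rat]_n) (r : rat) : set 'rV[R]_n :=
  [set x | forall i, `|x 0 i - (map_mx ratr c : 'rV[R]_n) 0 i| < ratr r].
pose F k := match unpickle k : option ('rV[rat]_n * rat) with
  | Some p => if `[< box p.1 p.2 `<=` U >] then pt @^-1` box p.1 p.2 else set0
  | None => set0 end.
have -> : pt @^-1` U = \bigcup_k F k.
  apply/seteqP; split => t /=; last first.
    move=> [k _]; rewrite /F; case: unpickle => // p.
    by case: asboolP => // sub; exact: sub.
  move=> Ut; have /nbhs_ballP[e /= e0 eU] := oU _ Ut.
  have [r] := rat_in_itvoo (divr_gt0 e0 (ltr0n R 2)); rewrite in_itv /= => /andP[r0 re].
  have /all_sig[c hc] i : {q : rat | `|pt t 0 i - ratr q| < ratr r}.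
    apply: cid; have [|q] := @rat_in_itvoo R (pt t 0 i - ratr r) (pt t 0 i + ratr r); first by lra.
    by rewrite in_itv /= => /andP[a b]; exists q; rewrite ltr_norml; apply/andP; split; lra.
  exists (pickle (\row_i c i, r)) => //; rewrite /F pickleK /=.
  have bU : box (\row_i c i) r `<=` U.
    move=> x xb; apply: eU; apply: rV_ball => // i.
    have := xb i; have := hc i; rewrite !mxE => h1 h2.
    have := ler_distD (ratr (c i) : R) (pt t 0 i) (x 0 i).
    rewrite [`|ratr (c i) - _|]distrC => h3.
    apply: le_lt_trans h3 _; lra.
  by case: asboolP => // _ i; rewrite !mxE; exact: hc.
apply: bigcupT_measurable => k; rewrite /F; case: unpickle => // p.
by case: asboolP => // _; exact: (measurable_box cm).
Qed.
End OpenMeasurable.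

(* Everything the weak Galerkin argument needs to know about integration. *)
Record integral_calculus {R : realType} (n : nat) : Prop := {
  el_int_linear : forall (K : 'M[R]_(n.+2, n.+1)), nondeg K -> forall a f g, polyf f -> polyf g ->
    el_int K (fun x => a * f x + g x) = a * el_int K f + el_int K g ;
  eq_el_int : forall (K : 'M[R]_(n.+2, n.+1)) f g, (forall x, hull K x -> f x = g x) ->
    el_int K f = el_int K g ;
  el_int_ge0 : forall (K : 'M[R]_(n.+2, n.+1)) f, (forall x, hull K x -> 0 <= f x) -> 0 <= el_int K f ;
  el_int_eq0 : forall (K : 'M[R]_(n.+2, n.+1)), nondeg K -> forall f, polyf f ->
    (forall x, hull K x -> 0 <= f x) -> el_int K f = 0 -> forall x, hull K x -> f x = 0 ;
  face_int_linear : forall (K : 'M[R]_(n.+2, n.+1)) i a f g, polyf f -> polyf g ->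
    face_int K i (fun x => a * f x + g x) = a * face_int K i f + face_int K i g ;
  eq_face_int : forall (K : 'M[R]_(n.+2, n.+1)) i f g, (forall x, face K i x -> f x = g x) ->
    face_int K i f = face_int K i g ;
  face_int_ge0 : forall (K : 'M[R]_(n.+2, n.+1)) i f, (forall x, face K i x -> 0 <= f x) ->
    0 <= face_int K i f ;
  face_int_eq0 : forall (K : 'M[R]_(n.+2, n.+1)) i, nondeg K -> forall f, polyf f ->
    (forall x, face K i x -> 0 <= f x) -> face_int K i f = 0 -> forall x, face K i x -> f x = 0 ;
  gauss_int : forall (K : 'M[R]_(n.+2, n.+1)) f v, nondeg K -> polyf f ->
    el_int K (fun x => derive f x v) = \sum_i dotv v (nrm K i) * face_int K i f ;
  el_int_L2 : forall (K : 'M[R]_(n.+2, n.+1)) A N (f : 'I_N -> 'rV[R]_n.+1 -> R), nondeg K -> open A ->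
    (forall c, L2 A (f c)) -> strict_hull K `<=` A ->
    forall a (p q : 'I_N -> 'rV[R]_n.+1 -> R), (forall c, polyf (p c)) -> (forall c, polyf (q c)) ->
    el_int K (fun x => \sum_c f c x * (a * p c x + q c x)) =
      a * el_int K (fun x => \sum_c f c x * p c x) + el_int K (fun x => \sum_c f c x * q c x) }.

(** * The integral calculus of simplices *)

Section Calculus.
Context {R : realType} dT (T : measurableType dT) (mu : {sigma_finite_measure set T -> \bar R}).
Local Notation leb := (@lebesgue_measure R).
Local Notation muR := (mu \x leb)%E.
Variables (n : nat) (pt : T -> 'rV[R]_n) (s : {perm 'I_(1 + n)}).
Variable ptR : T * measurableTypeR R -> 'rV[R]_n.+1.
Hypothesis cm : coord_measure mu pt.
Hypothesis ptRE : forall t, ptR t = col_perm s (cons_pt pt t).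
Hypothesis volE : forall A F, vol_int A F = cint muR ptR A F.
Hypothesis refE : forall F, ref_int F = cint mu pt (refset (n := n)) F.
Hypothesis L2E : forall A F, L2 A F -> measurable_fun (ptR @^-1` A) (F \o ptR) /\
  muR.-integrable (ptR @^-1` A) (fun p => ((F (ptR p)) ^+ 2)%:E).
Local Notation simplex := 'M[R]_(n.+2, n.+1).

Let cmc : coord_measure muR (cons_pt pt) := coord_measure_cons cm.
Let cmR : coord_measure muR ptR := coord_measure_perm cmc ptRE.

Lemma measurable_bc (K : simplex) : measurable (ptR @^-1` (strict_hull K)).
Proof.
apply: (measurable_all (A := fun i => [set x | 0 < bc K x 0 i])) => i.
have -> : [set x | 0 < bc K x 0 i] = [set x | - bc K x 0 i < 0].
  by apply/seteqP; split => x /=; rewrite oppr_lt0.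
by apply: (measurable_polyf_lt cmR); apply: polyf_opp; exact: polyf_bc.
Qed.

Lemma region_hull (K : simplex) : nondeg K -> region ptR (hull K).
Proof.
move=> nK; split; last exact: hull_bounded.
have -> : hull K = [set x | forall i, - bc K x 0 i <= 0].
  by apply/seteqP; split => x /=; rewrite hull_bc // => H i; have := H i; rewrite oppr_le0.
apply: (measurable_all (A := fun i => [set x | - bc K x 0 i <= 0])) => i.
by apply: (measurable_polyf_le cmR); apply: polyf_opp; exact: polyf_bc.
Qed.

(** Permuting the coordinates of the reference simplex permutes its vertices, vertex zero being
    fixed; this is [s']. *)
Lemma simplex_int_ptR F : polyf F -> simplex_int muR ptR F = simplex_int muR (cons_pt pt) F.
Proof.
move=> pF; pose s' : {perm 'I_(1 + (1 + n))} := lift_perm ord0 ord0 s.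
have E (y : 'rV[R]_(1 + n)) : bary (col_perm s y) = col_perm s' (bary y).
  apply/rowP => i; rewrite [RHS]mxE; case: (split_ordP i) => j ->.
    have -> : s' (lshift (1 + n) j) = lshift _ 0.
      rewrite -[lshift _ 0]/(lshift (1 + n) (ord0 : 'I_1)).
      have -> : lshift (1 + n) j = ord0 :> 'I_(1 + (1 + n)) by rewrite ord1; exact/val_inj.
      by rewrite /s' lift_perm_id; exact/val_inj.
    rewrite ord1 !bary0; congr (1 - _); rewrite [RHS](reindex_inj (@perm_inj _ s)).
    by apply: eq_bigr => k _; rewrite mxE.
  by rewrite /s' -lift0_rshift lift_perm_lift !lift0_rshift !baryS mxE.
rewrite -(simplex_int_perm cmc s' pF) /simplex_int /cint; congr Rintegral.
  apply/seteqP; split => t /=; rewrite ptRE => /refset_bary; rewrite ?E.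
    by move/stdsimplex_perm => /refset_bary.
  by move=> H; apply/refset_bary; rewrite E; apply/stdsimplex_perm.
by apply/funext => t /=; rewrite ptRE E.
Qed.

Lemma polyf_rows m (W : 'M[R]_(m, n.+1)) F : polyf F -> polyf (fun lam => F (lam *m W)).
Proof. by move=> pF; apply: polyf_comp => // i; exact: polyf_mulmx. Qed.

Lemma el_int_simplex (K : simplex) F : nondeg K -> polyf F ->
  el_int K F = `|\det (edges K)| * simplex_int muR (cons_pt pt) (fun lam => F (lam *m K)).
Proof.
move=> nK pF; rewrite /el_int volE (cint_affine cmR (row ord0 K) (region_hull nK) pF (edges_unit nK)).
congr (_ * _); rewrite -simplex_int_ptR; last exact: polyf_rows.
rewrite /simplex_int.
have -> : [set y | hull K (y *m edges K + row ord0 K)] = refset (n := n.+1).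
  apply/seteqP; split => y /=; rewrite addrC -bary_mulmx hull_bc // bcK ?sum_bary //.
    by move=> H; apply/refset_bary; split => //; exact: sum_bary.
  by move=> /refset_bary[].
by apply: eq_cint => y _; rewrite bary_mulmx addrC.
Qed.

Definition face_simplex_int (W : 'M[R]_(n.+1, n.+1)) F : R :=
  simplex_int mu pt (fun lam => F (lam *m W)).

Lemma face_int_simplex (K : simplex) i F :
  face_int K i F = Num.sqrt (\det (edges (row' i K) *m (edges (row' i K))^T)) *
    face_simplex_int (row' i K) F.
Proof.
rewrite /face_int; set G := \matrix_(_, _) _.
have p0 : nth 0 (face_verts K i) 0 = row ord0 (row' i K) by rewrite -face_verts_nth.
have GE : G = edges (row' i K).
  apply/matrixP => a b; rewrite [LHS]mxE [RHS]mxE p0.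
  by rewrite (_ : a.+1 = lift ord0 a) // face_verts_nth !mxE.
rewrite GE p0 refE; congr (_ * _); rewrite /face_simplex_int /simplex_int.
by apply: eq_cint => y _; rewrite bary_mulmx.
Qed.

Lemma face_simplex_perm (t : {perm 'I_n.+1}) W F : polyf F ->
  face_simplex_int (row_perm t W) F = face_simplex_int W F.
Proof.
move=> pF; rewrite /face_simplex_int -(simplex_int_perm cm t^-1%g (polyf_rows W pF)).
congr simplex_int; apply/funext => lam; congr F.
by rewrite row_permE mulmxA col_permE invgK.
Qed.

Lemma row_mx_head m (a : 'rV[R]_1) (b : 'rV[R]_m) :
  (row_mx a b : 'rV[R]_(1 + m)) 0 (ord0 : 'I_m.+1) = a 0 0.
Proof. by rewrite -(row_mxEl a b); congr (row_mx a b _ _); exact/val_inj. Qed.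

Lemma row'_row_perm (p : {perm 'I_n.+2}) a (K : simplex) F : polyf F ->
  face_simplex_int (row' a (row_perm p K)) F = face_simplex_int (row' (p a) K) F.
Proof.
move=> pF; have [t ht] := perm_lift p a; rewrite -[RHS](face_simplex_perm t _ pF).
have -> // : row' a (row_perm p K) = row_perm t (row' (p a) K) :> 'M[R]_(n.+1).
by apply/matrixP => k c; rewrite !mxE ht.
Qed.

(** The permutation [p] brings vertices [i] and [j] to positions zero and one, where
    [simplex_fubini] applies; the integrals do not feel the order of the vertices. *)
Lemma el_int_edge (K : simplex) F i j : nondeg K -> polyf F ->
  el_int K (fun x => derive F x (row j K - row i K)) =
  `|\det (edges K)| * (face_simplex_int (row' i K) F - face_simplex_int (row' j K) F).
Proof.
move=> nK pF; rewrite el_int_simplex //; last exact: polyf_derive.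
congr (_ * _); have [<-|ij] := eqVneq i j.
  rewrite !subrr; have -> : (fun lam : 'rV[R]_n.+2 => derive F (lam *m K) 0) = fun=> 0.
    apply/funext => lam; have := derive_linear (lam *m K) 0 0 (-1) pF.
    by rewrite scaler0 addr0 mulN1r addNr.
  have := simplex_int_linear cmc (-1) (polyf_cst _ 0) (polyf_cst _ 0).
  by under eq_fun do rewrite mulr0 addr0; rewrite mulN1r addNr.
have [j' jE|jE] := unliftP i j; last by rewrite jE eqxx in ij.
pose p : {perm 'I_n.+2} := lift_perm ord0 i (tperm ord0 j').
have p0 : p ord0 = i by rewrite /p lift_perm_id.
have p1 : p (lift ord0 ord0) = j by rewrite /p lift_perm_lift tpermL -jE.
pose K' := row_perm p K; pose H (x : 'rV[R]_(1 + (1 + n))) := F (x *m K').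
have pH : polyf H := polyf_rows K' pF.
have := simplex_fubini cm pH; set v := row_mx _ _.
have vK : v *m K' = row j K - row i K.
  apply/rowP => c; rewrite mxE !big_ord_recl big1 => [|k _]; last first.
    by rewrite /v !lift0_rshift !row_mxEr mxE mul0r.
  have -> : v 0 ord0 = -1 by rewrite /v row_mx_head mxE eqxx.
  have -> : v 0 (lift ord0 ord0) = 1 by rewrite lift0_rshift row_mxEr row_mx_head mxE eqxx.
  by rewrite !mxE p0 p1; ring.
rewrite (_ : (fun x => derive H x v) =
    fun x => (fun lam => derive F (lam *m K) (row j K - row i K)) (col_perm p^-1%g x)); last first.
  apply/funext => x; rewrite -vK col_permE invgK -mulmxA -row_permE -/K'.
  have [q hq] := polyf_line (x *m K') (v *m K') pF.
  have hq' t : H (x + t *: v) = q.[t] by rewrite /H mulmxDl -scalemxAl hq.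
  by have [_ ->] := is_derive_line hq; have [_ ->] := is_derive_line hq'.
rewrite (simplex_int_perm cmc p^-1%g
  (F := fun lam : 'rV[R]_n.+2 => derive F (lam *m K) (row j K - row i K))); last first.
  by exact: (polyf_rows K (polyf_derive _ pF)).
move=> ->; rewrite -p0 -p1 -!row'_row_perm // -/K'; congr (_ - _).
  congr simplex_int; apply/funext => x; rewrite /H; congr F.
  apply/rowP => c; rewrite !mxE big_ord_recl (_ : ins0 x 0 ord0 = 0) ?mul0r ?add0r; last first.
    by rewrite /ins0 row_mx_head mxE.
  by apply: eq_bigr => k _; rewrite lift0_rshift row_mxEr -lift0_rshift [X in _ = _ * X]mxE.
congr simplex_int; apply/funext => x; rewrite /H; congr F.
apply/rowP => c; rewrite !mxE !big_ord_recl.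
have -> : ins1 x 0 ord0 = x 0 ord0.
  by rewrite /ins1 row_mx_head mxE; congr (x 0 _); exact/val_inj.
have -> : ins1 x 0 (lift ord0 ord0) = 0.
  by rewrite lift0_rshift row_mxEr row_mx_head mxE.
rewrite mul0r add0r [X in _ = _ * X + _]mxE; congr (_ * K' _ c + _); first exact/val_inj.
apply: eq_bigr => k _; rewrite [X in _ = _ * X]mxE; congr (_ * K' _ c); last exact/val_inj.
by rewrite !lift0_rshift !row_mxEr mxE; congr (x 0 _); exact/val_inj.
Qed.

Lemma el_int_linear_model (K : simplex) a f g : nondeg K -> polyf f -> polyf g ->
  el_int K (fun x => a * f x + g x) = a * el_int K f + el_int K g.
Proof. by move=> nK pf pg; rewrite /el_int !volE; exact: (cint_linear cmR a (region_hull nK)). Qed.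

(** The direction is expanded in the edges from vertex zero, with coefficients [dbc K v]. These sum
    to zero, which cancels the contributions of face zero common to all edges; the rest is converted
    by [gram_height]. *)
Lemma gauss_model (K : simplex) F v : nondeg K -> polyf F ->
  el_int K (fun x => derive F x v) = \sum_i dotv v (nrm K i) * face_int K i F.
Proof.
move=> nK pF; set S := fun i => face_simplex_int (row' i K) F.
have sT : subspace [set: 'rV[R]_n.+1] by split.
have lT : linear_on [set: 'rV[R]_n.+1] (fun w => el_int K (fun x => derive F x w)).
  move=> a u w _ _; under eq_fun do rewrite (derive_linear _ _ _ _ pF).
  by apply: el_int_linear_model => //; exact: polyf_derive.
have -> : v = \sum_(j < n.+2) dbc K v 0 j *: (row j K - row ord0 K).
  under eq_bigr do rewrite scalerBr.
  by rewrite sumrB -scaler_suml sum_dbc // scale0r subr0 -mulmx_sum_row dbc_mulmx.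
rewrite (linear_on_sum sT lT) //; under eq_bigr do rewrite el_int_edge // -/(S _) mulrBr mulrBr.
have -> : \sum_(j < n.+2) dbc K v 0 j *: (row j K - row ord0 K) = v.
  under eq_bigr do rewrite scalerBr.
  by rewrite sumrB -scaler_suml sum_dbc // scale0r subr0 -mulmx_sum_row dbc_mulmx.
rewrite sumrB -mulr_suml sum_dbc // mul0r sub0r -sumrN; apply: eq_bigr => i _.
have [_ [h h0 hn]] := nrmP nK i.
rewrite hn face_int_simplex -(gram_height nK hn h0) -/(S i); ring.
Qed.

Lemma sqrt_gram_gt0 (K : simplex) i : nondeg K ->
  0 < Num.sqrt (\det (edges (row' i K) *m (edges (row' i K))^T)).
Proof.
move=> nK; have [_ [h h0 hn]] := nrmP nK i.
rewrite -(pmulr_rgt0 _ h0) (gram_height nK hn h0) normr_gt0; exact: nK.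
Qed.

Lemma face_rows (K : simplex) i x : stdsimplex x -> face K i (x *m row' i K).
Proof.
move=> Dx; apply: rows_conv => // k _; apply/face_vertsP; exists (lift i k).
  by rewrite eq_sym neq_lift.
by apply/rowP => c; rewrite !mxE.
Qed.

Lemma rows_face (K : simplex) i x : face K i x -> exists2 lam : 'rV[R]_n.+1, stdsimplex lam &
  x = lam *m row' i K.
Proof.
have H v : v \in face_verts K i -> exists k, v = row k (row' i K).
  move=> /face_vertsP[j ji ->]; have [k ->|e] := unliftP i j; last by rewrite e eqxx in ji.
  by exists k; apply/rowP => c; rewrite !mxE.
by move=> /(conv_rows H)[lam [D e _]]; exists lam.
Qed.

Lemma integral_calculus_model : integral_calculus (R := R) n.
Proof.
split.
- by move=> K nK a f g; exact: el_int_linear_model.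
- by move=> K f g fg; rewrite /el_int !volE; exact: eq_cint.
- by move=> K f f0; rewrite /el_int !volE; exact: cint_ge0.
- move=> K nK f pf f0; rewrite el_int_simplex // => /eqP; rewrite mulf_eq0 normr_eq0.
  rewrite (negbTE nK) /= => /eqP i0 x /hullP[lam Dl ->].
  apply: (simplex_int_eq0 cmc (polyf_rows K pf) _ i0 Dl) => y Dy; apply: f0; apply/hullP.
  by exists y.
- move=> K i a f g pf pg; rewrite !face_int_simplex /face_simplex_int.
  rewrite (simplex_int_linear cm a (polyf_rows _ pf) (polyf_rows _ pg)); ring.
- move=> K i f g fg; rewrite !face_int_simplex; congr (_ * _); apply: eq_simplex_int => x Dx.
  by apply: fg; exact: face_rows.
- move=> K i f f0; rewrite face_int_simplex mulr_ge0 ?sqrtr_ge0 // simplex_int_ge0 // => x Dx.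
  by apply: f0; exact: face_rows.
- move=> K i nK f pf f0; rewrite face_int_simplex => /eqP; rewrite mulf_eq0.
  rewrite (gt_eqF (sqrt_gram_gt0 i nK)) /= => /eqP i0 x /rows_face[lam Dl ->].
  apply: (simplex_int_eq0 cm (polyf_rows _ pf) _ i0 Dl) => y Dy; apply: f0; exact: face_rows.
- by move=> K f v nK pf; exact: gauss_model.
move=> K A N f nK oA fL sA a p q pp pq.
have mA : measurable (ptR @^-1` A).
  by apply: (measurable_open cmR) => x Ax; exact: open_nbhs_nbhs.
have mS := measurable_bc K; have [mH [r Hr]] := region_hull nK.
have sA' : ptR @^-1` strict_hull K `<=` ptR @^-1` A by move=> t; exact: sA.
have sH : ptR @^-1` strict_hull K `<=` ptR @^-1` hull K by move=> t; exact: strict_hull_sub.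
(* The datum is controlled on the open set [A] only, so the integral is moved to the strict hull.
   What is lost lies in hyperplanes where a barycentric coordinate vanishes; [inord] lists them as a
   sequence. *)
have null : muR ((ptR @^-1` hull K) `\` (ptR @^-1` strict_hull K)) = 0%E.
  apply/negligibleP; first exact: measurableD.
  apply: (@negligibleS _ _ _ muR (\bigcup_k [set t | bc K (ptR t) 0 (inord k) = 0])).
    move=> t [/= /(hull_bc nK) h /existsNP[i /negP b]]; exists i => //=.
    rewrite inord_val; apply/eqP; move: b; apply: contraR => b.
    by rewrite lt_neqAle eq_sym b h.
  apply: negligible_bigcup => k; set i := inord k.
  have [n1 [h h0 hn]] := nrmP nK i.
  have a0 : (nrm K i)^T != 0.
    apply: contraTneq (oner_neq0 R) => /(congr1 trmx); rewrite trmxK trmx0 => e.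
    by rewrite -n1 e /enorm dotvE mul0mx mxE sqrtr0 eqxx.
  have <- : [set t | (ptR t *m (nrm K i)^T) 0 0 = h * bc K 0 0 i] = [set t | bc K (ptR t) 0 i = 0].
    have E t : bc K (ptR t) 0 i = bc K 0 0 i - h^-1 * (ptR t *m (nrm K i)^T) 0 0.
      rewrite -dotvE hn; have := bc_line K 0 (ptR t) 1; rewrite !scale1r add0r => ->.
      by rewrite mxE mulrA mulrN mulVf ?gt_eqF // mulN1r opprK.
    apply/seteqP; split => t /=; rewrite E.
      by move=> ->; rewrite mulKf ?subrr ?gt_eqF.
    move/eqP; rewrite subr_eq0 => /eqP ->; by rewrite mulVKf ?gt_eqF.
  apply/negligibleP; last exact: cm_hyperplane cmR _ _ a0.
  have -> : [set t | (ptR t *m (nrm K i)^T) 0 0 = h * bc K 0 0 i] =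
     ptR @^-1` [set x | (x *m (nrm K i)^T) 0 0 - h * bc K 0 0 i <= 0] `&`
     ptR @^-1` [set x | - ((x *m (nrm K i)^T) 0 0 - h * bc K 0 0 i) <= 0].
    apply/seteqP; split => t /=; first by move=> ->; rewrite subrr oppr0.
    by move=> [u v]; lra.
  have pp0 : polyf (fun x => (x *m (nrm K i)^T) 0 0 - h * bc K 0 0 i).
    by apply: polyf_sub; [exact: polyf_mulmx|exact: polyf_cst].
  by apply: measurableI; apply: (measurable_polyf_le cmR) => //; exact: polyf_opp.
have E g : el_int K g = Rintegral muR (ptR @^-1` strict_hull K) (g \o ptR).
  by rewrite /el_int volE /cint (Rintegral_null _ mH mS sH null).
have rS : region ptR (strict_hull K).
  by split=> //; exists r => x /(strict_hull_sub nK) /Hr.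
(* The majorant is a bound of the polynomial times [1 + f^2], integrable as the region has finite
   measure. *)
have int1 c w : polyf w ->
    muR.-integrable (ptR @^-1` strict_hull K) (EFin \o (fun t => f c (ptR t) * w (ptR t))).
  move=> pw; have [M HM] := polyf_bounded r pw; have [mf sf] := L2E (fL c).
  apply: (@le_integrable _ _ _ _ _ mS _ (fun t => (M * (1 + f c (ptR t) ^+ 2))%:E)).
  - apply/measurable_EFinP; apply: measurable_funM.
      exact: measurable_funS mf.
    by apply: measurable_funTS; exact: (measurable_polyf cmR pw).
  - move=> t St; rewrite lee_fin normrM.
    have wM : `|w (ptR t)| <= M by apply: HM; apply: Hr; exact: sH.
    have M0 : 0 <= M := le_trans (normr_ge0 _) wM.
    rewrite [leRHS]ger0_norm; last by rewrite mulr_ge0 // addr_ge0 // sqr_ge0.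
    have f2 : `|f c (ptR t)| <= 1 + f c (ptR t) ^+ 2.
      rewrite -[f c _ ^+ 2]real_normK ?num_real //; have := sqr_ge0 (`|f c (ptR t)| - 2^-1); nra.
    by rewrite mulrC; apply: ler_pM.
  have -> : (fun t => (M * (1 + f c (ptR t) ^+ 2))%:E) =
     (fun t => M%:E * (((fun=> 1%R%:E) t : \bar R) + ((f c (ptR t) ^+ 2)%R%:E : \bar R)))%E.
    by apply/funext => t; rewrite -EFinD -EFinM.
  apply: integrableZl => //; apply: integrableD => //.
    exact: (integrable_polyf cmR rS (polyf_cst _ 1)).
  exact: integrableS sf.
have int w : (forall c, polyf (w c)) ->
    muR.-integrable (ptR @^-1` strict_hull K) (EFin \o (fun t => \sum_c f c (ptR t) * w c (ptR t))).
  move=> pw; have -> : EFin \o (fun t => \sum_c f c (ptR t) * w c (ptR t)) =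
     (fun t => \sum_(c <- index_enum 'I_N) ((f c (ptR t) * w c (ptR t))%R%:E : \bar R))%E.
    by apply/funext => t /=; rewrite sumEFin.
  by apply: integrable_sum => // c _; exact: int1.
rewrite !E -RintegralZl //; last exact: int.
rewrite -RintegralD //; last exact: int.
  congr Rintegral; apply/funext => t /=; rewrite mulr_sumr -big_split /=.
  by apply: eq_bigr => c _; ring.
have -> : EFin \o (fun x => a * ((fun x0 => \sum_c f c x0 * p c x0) \o ptR) x) =
   EFin \o (fun t => \sum_c f c (ptR t) * (a * p c (ptR t))).
  by apply/funext => t /=; congr EFin; rewrite mulr_sumr; apply: eq_bigr => c _; ring.
by apply: (int (fun c x => a * p c x)) => c; apply: polyf_mul => //; exact: polyf_cst.
Qed.
End Calculus.

(** * Dimensions two and three *)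

Section Models.
Context {R : realType}.
Local Notation leb := (@lebesgue_measure R).

Let e0 : 'I_2 := ord0.
Let e1 : 'I_2 := ord_max.

Lemma pt2E (p : R * R) : pt2 p = col_perm (tperm e0 e1) (cons_pt pt1 p).
Proof.
apply/rowP => i; rewrite [RHS]mxE [LHS]mxE; case: tpermP => [->|->|/eqP i0 /eqP i1] /=.
- have -> : e1 = rshift 1 (ord0 : 'I_1) by exact/val_inj.
  by apply: etrans (esym (row_mxEr _ _ _ _)); rewrite mxE.
- by rewrite row_mx_head mxE eqxx.
- by case: i i0 i1 => [[|[|]]].
Qed.

Lemma coord_measure2 : coord_measure (@leb2 R) pt2.
Proof. exact: coord_measure_perm (coord_measure_cons coord_measure1) pt2E. Qed.

Lemma integral_calculus1 : integral_calculus (R := R) 1.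
Proof.
apply: (integral_calculus_model coord_measure1 pt2E) => // F.
rewrite /ref_int /cint; congr Rintegral; apply/seteqP; split => t /=; rewrite in_itv /=.
  move=> /andP[t0 t1]; split => [i|]; first by rewrite mxE.
  by rewrite big_ord1 mxE.
by move=> [/(_ 0) + ]; rewrite big_ord1 mxE => -> ->.
Qed.

Let f0 : 'I_3 := ord0.
Let f1 : 'I_3 := lift ord0 ord0.
Let f2 : 'I_3 := ord_max.

Lemma pt3E (p : R * R * R) : pt3 p = col_perm (tperm f0 f1 * tperm f0 f2)%g (cons_pt pt2 p).
Proof.
have ne01 : f0 != f1 by []. have ne12 : f1 != f2 by []. have ne02 : f0 != f2 by [].
apply/rowP => i; rewrite [RHS]mxE [LHS]mxE permM.
have : [\/ i = f0, i = f1 | i = f2].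
  by case: i => [[|[|[|]]]] // lt; [apply: Or31|apply: Or32|apply: Or33]; exact/val_inj.
case=> -> /=.
- rewrite tpermL tpermD //; have -> : f1 = rshift 1 (ord0 : 'I_2) by exact/val_inj.
  by apply: etrans (esym (row_mxEr _ _ _ _)); rewrite mxE.
- rewrite tpermR tpermL; have -> : f2 = rshift 1 (ord_max : 'I_2) by exact/val_inj.
  by apply: etrans (esym (row_mxEr _ _ _ _)); rewrite mxE.
- rewrite (_ : tperm _ _ _ = f0); last by rewrite [tperm f0 f1 _]tpermD // tpermR.
  by rewrite /cons_pt row_mx_head mxE eqxx.
Qed.

(** The plane measure has to be sigma-finite to serve as first factor of the product with a third
    line. *)
Lemma sigma_finite_leb2 : sigma_finite setT (@leb2 R).
Proof.
have /sigma_finiteP[F [TF ndF Foo]] := sigma_finiteT leb.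
exists (fun n => F n `*` F n).
  rewrite -setXTT TF predeqE => -[x y]; split.
    move=> [/= [n _ Fnx] [k _ Gky]]; exists (maxn n k) => //; split.
    - by move: x Fnx; exact/subsetPset/ndF/leq_maxl.
    - by move: y Gky; exact/subsetPset/ndF/leq_maxr.
  by move=> [n _ []/= ? ?]; split; exists n.
move=> k; have [mF fF] := Foo k; split; first exact: measurableX.
by rewrite /leb2 product_measure1E // lte_mul_pinfty // ge0_fin_numE.
Qed.

Lemma integral_calculus2 : integral_calculus (R := R) 2.
Proof.
pose mu2 : {sigma_finite_measure set (measurableTypeR R * measurableTypeR R)%type -> \bar R} :=
  HB.pack (leb \x leb)%E (Measure_isSigmaFinite.Build _ _ _ (leb \x leb)%E sigma_finite_leb2).
have cm2 : coord_measure mu2 pt2 := coord_measure2.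
apply: (integral_calculus_model cm2 pt3E) => // F.
rewrite /ref_int /cint; congr Rintegral; apply/seteqP; split => t /=.
  move=> [t0 [t1 t2]]; split => [i|]; first by rewrite mxE; case: ifP.
  by rewrite big_ord_recl big_ord1 !mxE.
move=> [H]; rewrite big_ord_recl big_ord1 !mxE /=; have := H ord0; have := H ord_max.
by rewrite !mxE.
Qed.
End Models.

(** * Polynomial fields *)

Section LinearCombinators.
Context {R : realType} {E : lmodType R} (W : set E).

Lemma linear_on_add f g : linear_on W f -> linear_on W g -> linear_on W (fun u => f u + g u).
Proof. by move=> lf lg a u v Wu Wv; rewrite lf // lg //; ring. Qed.

Lemma linear_on_scale c f : linear_on W f -> linear_on W (fun u => c * f u).
Proof. by move=> lf a u v Wu Wv; rewrite lf //; ring. Qed.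

Lemma linear_on_opp f : linear_on W f -> linear_on W (fun u => - f u).
Proof. by move=> lf a u v Wu Wv; rewrite lf //; ring. Qed.

Lemma linear_on_sub f g : linear_on W f -> linear_on W g -> linear_on W (fun u => f u - g u).
Proof. by move=> lf lg; apply: linear_on_add => //; exact: linear_on_opp. Qed.

Lemma linear_on_bigsum (J : eqType) (r : seq J) (F : J -> E -> R) :
  (forall j, j \in r -> linear_on W (F j)) -> linear_on W (fun u => \sum_(j <- r) F j u).
Proof.
move=> lF a u v Wu Wv; rewrite mulr_sumr -big_split /=.
by apply: eq_big_seq => j jr; exact: lF.
Qed.
End LinearCombinators.

Section PolyFields.
Context {R : realType} {d : nat}.
Local Notation pt := 'rV[R]_d.

Definition polyv (v : pt -> pt) := forall c, polyf (fun x => v x 0 c).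

Lemma poly_vec_polyv r v : poly_vec r v -> polyv v.
Proof. by move=> pv c; exact: poly_le_polyf (pv c). Qed.

Lemma polyf_dotv u v : polyv u -> polyv v -> polyf (fun x => dotv (u x) (v x)).
Proof. by move=> pu pv; apply: polyf_sum => c; apply: polyf_mul. Qed.

Lemma polyv_cst (w : pt) : polyv (fun=> w).
Proof. by move=> c; exact: polyf_cst. Qed.

Lemma polyf_divf v : polyv v -> polyf (divf v).
Proof. by move=> pv; apply: polyf_sum => c; exact: polyf_derive (pv c). Qed.

Lemma polyv_gradf p : polyf p -> polyv (gradf p).
Proof. by move=> pp c; under eq_fun do rewrite mxE; exact: polyf_derive. Qed.

Lemma poly_vec_gradf r (p : pt -> R) : poly_le r p -> poly_vec r.-1 (gradf p).
Proof. by move=> pp c; under eq_fun do rewrite mxE; exact: poly_le_derive. Qed.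

Lemma derive_comb a f g (x v : pt) : polyf f -> polyf g ->
  derive (fun y => a * f y + g y) x v = a * derive f x v + derive g x v.
Proof.
move=> pf pg; have [q hq] := polyf_line x v pf; have [r hr] := polyf_line x v pg.
have [_ ->] := is_derive_line hq; have [_ ->] := is_derive_line hr.
have [t|_ ->] := @is_derive_line _ _ (fun y => a * f y + g y) x v (a *: q + r).
  by rewrite hq hr hornerD hornerZ.
by rewrite derivD derivZ hornerD hornerZ.
Qed.

Lemma derive_mul f g (x v : pt) : polyf f -> polyf g ->
  derive (fun y => f y * g y) x v = f x * derive g x v + g x * derive f x v.
Proof.
move=> pf pg; have -> : (fun y => f y * g y) = f * g by [].
by rewrite deriveM //; exact: polyf_derivable.
Qed.

Lemma derive_ecoord f (x v : pt) : polyf f -> derive f x v = dotv v (gradf f x).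
Proof.
move=> pf; have sT : subspace [set: pt] by split.
have lT : linear_on [set: pt] (fun w => derive f x w).
  by move=> a u w _ _; exact: derive_linear.
rewrite {1}[v]ecoord_sum (linear_on_sum sT lT) //.
by apply: eq_bigr => c _; rewrite mxE.
Qed.

Lemma gradf0_cst (f : pt -> R) : polyf f -> (forall x, gradf f x = 0) -> forall x y, f x = f y.
Proof.
move=> pf f0 x y; have [q hq] := polyf_line x (y - x) pf.
have q0 t : q^`().[t] = 0.
  by rewrite -(polyf_line_derive t pf hq) derive_ecoord // f0 dotvE trmx0 mulmx0 mxE.
have := horner_FTC q ler01; rewrite integral0_eq => [e|t _]; last by rewrite q0.
case: e => /esym/eqP; rewrite subr_eq0 => /eqP; rewrite -!hq scale0r addr0 scale1r.
by rewrite addrC subrK => ->.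
Qed.

(* Riesz representation in P_r for the (possibly degenerate) form (p, q) |-> I (p q). *)
Lemma riesz_poly r (I ell : (pt -> R) -> R) :
  (forall a f g, polyf f -> polyf g -> I (fun x => a * f x + g x) = a * I f + I g) ->
  (forall p, polyf p -> 0 <= I (fun x => p x * p x)) ->
  (forall a p q, poly_le r p -> poly_le r q ->
    ell (fun x => a * p x + q x) = a * ell p + ell q) ->
  (forall p, poly_le r p -> I (fun x => p x * p x) = 0 -> ell p = 0) ->
  exists q, poly_le r q /\ forall p, poly_le r p -> I (fun x => q x * p x) = ell p.
Proof.
move=> lI pI lell nell.
pose W : set (pt -> R^o) := poly_le r.
have sW : subspace W.
  split; first exact: poly_le0.
  by move=> a u v Wu Wv; exact: (poly_leD (poly_leZ a Wu) Wv).
pose B (u v : pt -> R^o) : R := I (fun x => u x * v x).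
have lB v : W v -> linear_on W (B ^~ v).
  move=> /poly_le_polyf pv a u w /poly_le_polyf pu /poly_le_polyf pw; rewrite /B -lI.
  - by congr I; apply/funext => x; rewrite /= mulrDl -mulrA.
  - exact: polyf_mul.
  - exact: polyf_mul.
have sB u v : W u -> W v -> B u v = B v u.
  by move=> _ _; congr I; apply/funext => x; rewrite mulrC.
have psdB u : W u -> 0 <= B u u by move=> /poly_le_polyf; exact: pI.
pose J := {ffun 'I_d -> 'I_r.+1}.
pose phi (j : 'I_#|J|) u := B u (if (\sum_i (enum_val j i : nat) <= r)%N
  then mono (fun i => enum_val j i : nat) else fun=> 0).
have Wm j : W (if (\sum_i (enum_val (j : 'I_#|J|) i : nat) <= r)%N
  then mono (fun i => enum_val j i : nat) else fun=> 0).
  by case: ifP => h; [exact: poly_le_mono|exact: poly_le0].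
have lphi j : linear_on W (phi j) by exact: lB (Wm j).
have phi0 u : W u -> (forall j, phi j u = 0) -> B u u = 0.
  move=> Wu pu; suff : forall p, poly_le r p -> W p /\ B u p = 0 by move=> /(_ u Wu)[].
  apply: poly_le_ind => [|f g [Wf f0] [Wg g0]|c a ar].
  - by split; [exact: sW.1|exact: (linear_on0 sW (psd_linear_r sW lB sB Wu))].
  - split; first exact: poly_leD.
    by rewrite (linear_onD (psd_linear_r sW lB sB Wu) Wf Wg) f0 g0 addr0.
  have Wa : W (mono a) := poly_le_mono ar.
  split; first exact: poly_leZ.
  rewrite (linear_onZ sW (psd_linear_r sW lB sB Wu) c Wa).
  have lt i : (a i < r.+1)%N by rewrite ltnS (leq_trans _ ar) // (bigD1 i) //= leq_addr.
  pose b : J := [ffun i => Ordinal (lt i)].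
  have := pu (enum_rank b); rewrite /phi enum_rankK.
  have bE : (fun i => b i : nat) = a by apply/funext => i; rewrite ffunE.
  rewrite (_ : (\sum_i (b i : nat) <= r)%N) ?bE; first by move=> ->; rewrite mulr0.
  by rewrite (eq_bigr a) // => i _; rewrite ffunE.
have lell' : linear_on W ell by move=> a u v Wu Wv; exact: lell.
have nell' v : W v -> B v v = 0 -> ell v = 0 by exact: nell.
have [q Wq hq] := riesz sW lB sB psdB lphi phi0 lell' nell'.
by exists q.
Qed.
End PolyFields.

(** * Weak operators on one element *)

Section Elements.
Context {R : realType} {n : nat}.
Hypothesis ic : integral_calculus (R := R) n.
Local Notation pt := 'rV[R]_n.+1.
Local Notation simplex := 'M[R]_(n.+2, n.+1).
Variable K : simplex.
Hypothesis nK : nondeg K.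

Lemma el_int_comb a (F G H : pt -> R) : polyf F -> polyf G -> (forall x, H x = a * F x + G x) ->
  el_int K H = a * el_int K F + el_int K G.
Proof. by move=> pF pG /funext ->; exact: (el_int_linear ic nK). Qed.

Lemma face_int_comb i a (F G H : pt -> R) : polyf F -> polyf G ->
  (forall x, H x = a * F x + G x) -> face_int K i H = a * face_int K i F + face_int K i G.
Proof. by move=> pF pG /funext ->; exact: (face_int_linear ic). Qed.

Lemma el_int_zero (F : pt -> R) : (forall x, hull K x -> F x = 0) -> el_int K F = 0.
Proof.
move=> F0; rewrite (eq_el_int ic (g := fun=> 0)) //.
have := @el_int_comb (-1) _ _ (fun=> 0) (polyf_cst _ 0) (polyf_cst _ 0).
by move=> ->; rewrite ?mulN1r ?addNr // => _; rewrite mulr0 addr0.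
Qed.

Lemma face_int_zero i (F : pt -> R) : (forall x, face K i x -> F x = 0) -> face_int K i F = 0.
Proof.
move=> F0; rewrite (eq_face_int ic (g := fun=> 0)) //.
have := @face_int_comb i (-1) _ _ (fun=> 0) (polyf_cst _ 0) (polyf_cst _ 0).
by move=> ->; rewrite ?mulN1r ?addNr // => _; rewrite mulr0 addr0.
Qed.

Lemma el_int_sum (J : Type) (r : seq J) (F : J -> pt -> R) : (forall j, polyf (F j)) ->
  el_int K (fun x => \sum_(j <- r) F j x) = \sum_(j <- r) el_int K (F j).
Proof.
move=> pF; elim: r => [|j r IH].
  by rewrite big_nil el_int_zero // => x _; rewrite big_nil.
rewrite big_cons -IH -[el_int K (F j)]mul1r; apply: el_int_comb => // [|x].
  exact: polyf_sum.
by rewrite big_cons mul1r.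
Qed.

Lemma face_int_sum i (J : Type) (r : seq J) (F : J -> pt -> R) : (forall j, polyf (F j)) ->
  face_int K i (fun x => \sum_(j <- r) F j x) = \sum_(j <- r) face_int K i (F j).
Proof.
move=> pF; elim: r => [|j r IH].
  by rewrite big_nil face_int_zero // => x _; rewrite big_nil.
rewrite big_cons -IH -[face_int K i (F j)]mul1r; apply: face_int_comb => // [|x].
  exact: polyf_sum.
by rewrite big_cons mul1r.
Qed.

Lemma el_int_sqr_eq0 (p : pt -> R) : polyf p -> el_int K (fun x => p x * p x) = 0 ->
  forall x, p x = 0.
Proof.
move=> pp p0; apply: (polyf_hull_ext nK pp (polyf_cst _ 0)) => x hx.
have /eqP := el_int_eq0 ic nK (polyf_mul pp pp) (fun x _ => sqr_ge0 (p x)) p0 hx.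
by rewrite mulf_eq0 orbb => /eqP.
Qed.

Lemma face_int_sqr_eq0 i (p : pt -> R) : polyf p -> face_int K i (fun x => p x * p x) = 0 ->
  forall x, face K i x -> p x = 0.
Proof.
move=> pp p0 x fx.
have /eqP := face_int_eq0 ic nK (polyf_mul pp pp) (fun x _ => sqr_ge0 (p x)) p0 fx.
by rewrite mulf_eq0 orbb => /eqP.
Qed.

Lemma el_riesz r (ell : (pt -> R) -> R) :
  (forall a p q, poly_le r p -> poly_le r q ->
    ell (fun x => a * p x + q x) = a * ell p + ell q) ->
  exists q, poly_le r q /\ forall p, poly_le r p -> el_int K (fun x => q x * p x) = ell p.
Proof.
move=> lell; apply: riesz_poly => //.
- by move=> a f g pf pg; exact: (el_int_linear ic nK).
- by move=> p _; apply: (el_int_ge0 ic) => x _; exact: sqr_ge0.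
move=> p pp /(el_int_sqr_eq0 (poly_le_polyf pp)) p0.
have := lell (-1) p p pp pp; rewrite mulN1r addNr => <-; congr ell.
by apply/funext => x; rewrite p0 mulr0 addr0.
Qed.

(** A polynomial of zero face norm vanishes on the face, not elsewhere. The functional to be
    represented is zero on such polynomials, which is what [riesz_poly] demands. *)
Lemma QbP l i phi : polyf phi -> poly_le l (Qb l K i phi) /\
  forall p, poly_le l p -> face_int K i (fun x => (Qb l K i phi x - phi x) * p x) = 0.
Proof.
move=> pphi; apply: (@xgetPex _ _ [set q | poly_le l q /\ forall p, poly_le l p ->
  face_int K i (fun x => (q x - phi x) * p x) = 0]).
have [||||q [pq hq]] := @riesz_poly _ _ l (face_int K i) (fun p => face_int K i (fun x => phi x * p x)).
- by move=> a f g pf pg; exact: (face_int_linear ic).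
- by move=> p _; apply: (face_int_ge0 ic) => x _; exact: sqr_ge0.
- move=> a p q /poly_le_polyf pp /poly_le_polyf pq; apply: face_int_comb; try exact: polyf_mul.
  by move=> x; ring.
- move=> p /poly_le_polyf pp /(face_int_sqr_eq0 pp) p0; apply: face_int_zero => x fx.
  by rewrite p0 // mulr0.
exists q; split=> // p pp; have pf := poly_le_polyf pp; have qf := poly_le_polyf pq.
rewrite (@face_int_comb _ (-1) (fun x => phi x * p x) (fun x => q x * p x)).
- by rewrite hq // mulN1r addNr.
- exact: polyf_mul.
- exact: polyf_mul.
by move=> x; ring.
Qed.

(** Against degree at most [l] the projection disappears, and with it the arbitrariness of its
    choice; the stabilisation owes its bilinearity to this. *)
Lemma Qb_test l i phi (ub p : pt -> R) : polyf phi -> polyf ub -> poly_le l p ->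
  face_int K i (fun x => (Qb l K i phi x - ub x) * p x) =
  face_int K i (fun x => (phi x - ub x) * p x).
Proof.
move=> pphi pu pp; have [/poly_le_polyf pq hq] := QbP l i pphi; have pf := poly_le_polyf pp.
rewrite (@face_int_comb _ 1 (fun x => (Qb l K i phi x - phi x) * p x)
  (fun x => (phi x - ub x) * p x)).
- by rewrite hq // mulr0 add0r.
- by apply: polyf_mul => //; exact: polyf_sub.
- by apply: polyf_mul => //; exact: polyf_sub.
by move=> x; ring.
Qed.

Lemma gradf_comb a (p q : pt -> R) x : polyf p -> polyf q ->
  gradf (fun y => a * p y + q y) x = a *: gradf p x + gradf q x.
Proof. by move=> pp pq; apply/rowP => c; rewrite !mxE derive_comb. Qed.

Lemma dotv_combr a (u v w : pt) : dotv u (a *: v + w) = a * dotv u v + dotv u w.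
Proof. by rewrite dotvC dotv_linear !(dotvC u). Qed.

Lemma wdivP r v0 vb : polyv v0 -> (forall i, polyv (vb i)) ->
  poly_le r (wdiv r K v0 vb) /\ forall phi, poly_le r phi ->
    el_int K (fun x => wdiv r K v0 vb x * phi x) =
    - el_int K (fun x => dotv (v0 x) (gradf phi x))
    + \sum_(i < n.+2) face_int K i (fun x => dotv (vb i x) (nrm K i) * phi x).
Proof.
move=> pv0 pvb; apply: (@xgetPex _ _ [set D | poly_le r D /\ forall phi, poly_le r phi ->
    el_int K (fun x => D x * phi x) =
    - el_int K (fun x => dotv (v0 x) (gradf phi x))
    + \sum_(i < n.+2) face_int K i (fun x => dotv (vb i x) (nrm K i) * phi x)]).
apply: el_riesz => a p q /poly_le_polyf pp /poly_le_polyf pq.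
rewrite (@el_int_comb a (fun x => dotv (v0 x) (gradf p x)) (fun x => dotv (v0 x) (gradf q x)));
  try (by apply: polyf_dotv => //; exact: polyv_gradf); last first.
  by move=> x; rewrite gradf_comb // dotv_combr.
have pvn i : polyf (fun x => dotv (vb i x) (nrm K i)) by apply: polyf_dotv => //; exact: polyv_cst.
rewrite mulrDr mulr_sumr mulrN opprD -!addrA; congr (_ + _).
rewrite addrCA; congr (_ + _); rewrite -big_split /=; apply: eq_bigr => i _.
by apply: face_int_comb; [exact: polyf_mul|exact: polyf_mul|move=> x; ring].
Qed.

(** The components decouple: component [c] represents [ell c], the part of the right-hand side that
    involves component [c] of [tau]. *)
Lemma wgradP r v0 vb : polyf v0 -> (forall i, polyf (vb i)) ->
  poly_vec r (wgrad r K v0 vb) /\ forall tau, poly_vec r tau ->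
    el_int K (fun x => dotv (wgrad r K v0 vb x) (tau x)) =
    - el_int K (fun x => v0 x * divf tau x)
    + \sum_(i < n.+2) face_int K i (fun x => vb i x * dotv (tau x) (nrm K i)).
Proof.
move=> pv0 pvb; apply: (@xgetPex _ _ [set G | poly_vec r G /\ forall tau, poly_vec r tau ->
    el_int K (fun x => dotv (G x) (tau x)) =
    - el_int K (fun x => v0 x * divf tau x)
    + \sum_(i < n.+2) face_int K i (fun x => vb i x * dotv (tau x) (nrm K i))]).
pose ell c (p : pt -> R) := - el_int K (fun x => v0 x * derive p x (ecoord c))
    + \sum_(i < n.+2) face_int K i (fun x => vb i x * (p x * nrm K i 0 c)).
have H c : exists q, poly_le r q /\ forall p, poly_le r p -> el_int K (fun x => q x * p x) = ell c p.
  apply: el_riesz => a p q /poly_le_polyf pp /poly_le_polyf pq; rewrite /ell.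
  rewrite (@el_int_comb a (fun x => v0 x * derive p x (ecoord c))
    (fun x => v0 x * derive q x (ecoord c))); try (by apply: polyf_mul => //; exact: polyf_derive);
    last by move=> x; rewrite derive_comb //; ring.
  rewrite mulrDr mulr_sumr mulrN opprD -!addrA; congr (_ + _).
  rewrite addrCA; congr (_ + _); rewrite -big_split /=; apply: eq_bigr => i _.
  apply: face_int_comb; last by move=> x; ring.
    by apply: polyf_mul => //; apply: polyf_mul => //; exact: polyf_cst.
  by apply: polyf_mul => //; apply: polyf_mul => //; exact: polyf_cst.
have [q hq] := choice H.
exists (fun x => \row_c q c x); split=> [c|tau ptau].
  by under eq_fun do rewrite mxE; exact: (hq c).1.
have pt' c := poly_le_polyf (ptau c); have pq c := poly_le_polyf (hq c).1.
transitivity (\sum_c el_int K (fun x => q c x * tau x 0 c)).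
  rewrite -el_int_sum => [|c]; last exact: polyf_mul.
  by congr el_int; apply/funext => x; apply: eq_bigr => c _; rewrite mxE.
rewrite (eq_bigr (fun c => ell c (fun x => tau x 0 c))) => [|c _]; last exact: (hq c).2.
rewrite big_split /= sumrN; congr (- _ + _).
  rewrite -el_int_sum => [|c]; last by apply: polyf_mul => //; exact: polyf_derive (pt' c).
  by congr el_int; apply/funext => x; rewrite /divf mulr_sumr.
rewrite exchange_big /=; apply: eq_bigr => i _.
rewrite -face_int_sum => [|c]; last first.
  by apply: polyf_mul => //; apply: polyf_mul => //; exact: polyf_cst.
by congr face_int; apply/funext => x; rewrite /dotv mulr_sumr.
Qed.

Lemma gauss_div (u : pt -> R) tau : polyf u -> polyv tau ->
  el_int K (fun x => dotv (gradf u x) (tau x)) =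
  - el_int K (fun x => u x * divf tau x)
  + \sum_(i < n.+2) face_int K i (fun x => u x * dotv (tau x) (nrm K i)).
Proof.
move=> pu ptau.
have G c : el_int K (fun x => derive (fun y => u y * tau y 0 c) x (ecoord c)) =
    \sum_i face_int K i (fun x => u x * (tau x 0 c * nrm K i 0 c)).
  rewrite (gauss_int ic _ nK); last exact: polyf_mul.
  apply: eq_bigr => i _.
  have -> : dotv (ecoord c) (nrm K i) = nrm K i 0 c.
    rewrite /dotv (bigD1 c) //= big1 ?addr0 => [|c' ne]; rewrite mxE.
      by rewrite eqxx mul1r.
    by rewrite (negbTE ne) mul0r.
  rewrite [RHS](@face_int_comb i (nrm K i 0 c) (fun x => u x * tau x 0 c) (fun=> 0)).
  - by rewrite (face_int_zero (F := fun=> 0)) // addr0.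
  - exact: polyf_mul.
  - exact: polyf_cst.
  by move=> x; ring.
have pd c : polyf (fun x => derive (fun y => u y * tau y 0 c) x (ecoord c)).
  by apply: polyf_derive; exact: polyf_mul.
apply/eqP; rewrite addrC eq_sym subr_eq; apply/eqP.
transitivity (\sum_c el_int K (fun x => derive (fun y => u y * tau y 0 c) x (ecoord c))).
  under [RHS]eq_bigr do rewrite G.
  rewrite exchange_big /=; apply: eq_bigr => i _; rewrite -face_int_sum => [|c]; last first.
    by apply: polyf_mul => //; apply: polyf_mul => //; exact: polyf_cst.
  by congr face_int; apply/funext => x; rewrite mulr_sumr.
rewrite -el_int_sum // -[el_int K (fun x => dotv _ _)]mul1r; apply: el_int_comb.
- by apply: polyf_dotv => //; exact: polyv_gradf.
- by apply: polyf_mul => //; exact: polyf_divf.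
move=> x; rewrite mul1r /dotv /divf mulr_sumr -big_split /=; apply: eq_bigr => c _.
by rewrite derive_mul // mxE; ring.
Qed.

Lemma hK_gt0 : 0 < hK K.
Proof.
have ge i j : enorm (row i K - row j K) <= hK K.
  apply: le_trans (le_bigmax _ _ i); exact: (le_bigmax _ (fun j => enorm (row i K - row j K)) j).
have h1 := ge (lift ord0 ord0) ord0; apply: lt_le_trans h1; rewrite sqrtr_gt0.
rewrite lt_neqAle dotvv_ge0 andbT eq_sym; apply/eqP => /dotvv_eq0 e.
have := dbc_edge nK ord0 (lift ord0 ord0); rewrite e /dbc !mul0mx => /rowP /(_ ord0).
rewrite !mxE !eqxx /= => /eqP; rewrite eq_sym sub0r oppr_eq0; exact/negP/oner_neq0.
Qed.

Lemma tauK_gt0 : 0 < tauK K.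
Proof. by rewrite invr_gt0 hK_gt0. Qed.

Lemma el_int_dotv_eq0 w : polyv w -> el_int K (fun x => dotv (w x) (w x)) = 0 -> forall x, w x = 0.
Proof.
move=> pw; rewrite /dotv el_int_sum => [/eqP|c']; last exact: polyf_mul.
rewrite psumr_eq0 => [/allP h x|c' _]; last first.
  by apply: (el_int_ge0 ic) => x _; exact: sqr_ge0.
apply/rowP => c; rewrite [RHS]mxE; move: x; apply: el_int_sqr_eq0 => //.
exact/eqP/(h c (mem_index_enum _)).
Qed.

(** The gradient of [u0] has degree at most [k.-1 <= m], so it may test the weak gradient. Its
    normal components have degree at most [l], so [u0] and [ub] have the same moments against them
    on faces. Integration by parts then equates its squared norm with a pairing against the
    vanishing weak gradient. *)
Lemma local_kernel k l m u0 ub : (k.-1 <= m <= l)%N -> poly_le k u0 ->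
  (forall i, poly_le l (ub i)) ->
  el_int K (fun x => dotv (wgrad m K u0 ub x) (wgrad m K u0 ub x)) = 0 ->
  (forall i, face_int K i (fun x =>
     (Qb l K i u0 x - ub i x) * (Qb l K i u0 x - ub i x)) = 0) ->
  exists c, (forall x, u0 x = c) /\ forall i x, face K i x -> ub i x = c.
Proof.
move=> /andP[km ml] pu pub w0 f0.
have pu' := poly_le_polyf pu; have pub' i := poly_le_polyf (pub i).
have [pw hw] := wgradP m pu' pub'.
set w := wgrad m K u0 ub in w0 pw hw.
have pQ i := QbP l i pu'.
have Qu i : forall x, face K i x -> Qb l K i u0 x = ub i x.
  move=> x fx; apply/eqP; rewrite -subr_eq0; apply/eqP; move: x fx.
  by apply: face_int_sqr_eq0 => //; apply: polyf_sub => //; exact: poly_le_polyf (pQ i).1.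
have w1 := el_int_dotv_eq0 (poly_vec_polyv pw) w0.
have gm : poly_vec m (gradf u0) by move=> c; apply: poly_le_widen km _; exact: poly_vec_gradf.
have g0 x : gradf u0 x = 0.
  have : el_int K (fun x => dotv (gradf u0 x) (gradf u0 x)) = 0.
    rewrite gauss_div //; last exact: poly_vec_polyv gm.
    transitivity (el_int K (fun x => dotv (w x) (gradf u0 x))); last first.
      by apply: el_int_zero => y _; rewrite w1 dotvE mul0mx mxE.
    rewrite hw //; congr (_ + _); apply: eq_bigr => i _.
    have pt' : poly_le l (fun x => dotv (gradf u0 x) (nrm K i)).
      apply: poly_le_sum => c _; under eq_fun do rewrite mulrC; apply: poly_leZ.
      exact: poly_le_widen ml (gm c).
    rewrite (eq_face_int ic (K := K) (i := i) (g := fun x => (u0 x - ub i x) *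
      dotv (gradf u0 x) (nrm K i) + ub i x * dotv (gradf u0 x) (nrm K i))); last by move=> y _; ring.
    rewrite (@face_int_comb i 1 (fun x => (u0 x - ub i x) * dotv (gradf u0 x) (nrm K i))
       (fun x => ub i x * dotv (gradf u0 x) (nrm K i))).
    - rewrite -(Qb_test (l := l)) // mul1r [X in X + _](_ : _ = 0) ?add0r //.
      by apply: face_int_zero => y fy; rewrite Qu // subrr mul0r.
    - by apply: polyf_mul; [exact: polyf_sub|exact: poly_le_polyf pt'].
    - by apply: polyf_mul => //; exact: poly_le_polyf pt'.
    by move=> y; rewrite mul1r.
  move=> e; apply: el_int_dotv_eq0 e x; exact: polyv_gradf.
have cst x : u0 x = u0 0 by exact: gradf0_cst.
exists (u0 0); split=> // i x fx; rewrite -(Qu i x fx).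
(* The difference between the projection and the constant is tested with itself. *)
have pQc : poly_le l (fun y => Qb l K i u0 y - u0 0).
  by apply: poly_leD (pQ i).1 _; exact: poly_le_cst.
have := (pQ i).2 _ pQc; rewrite (_ : (fun y => _) =
   fun y => (Qb l K i u0 y - u0 0) * (Qb l K i u0 y - u0 0)); last first.
  by apply/funext => y; rewrite [u0 y]cst.
move=> /(face_int_sqr_eq0 (poly_le_polyf pQc)) /(_ x fx) /eqP.
by rewrite subr_eq0 => /eqP.
Qed.
End Elements.

(** * Rays through a triangulation *)

Section Generic.
Context {R : realType} {d : nat}.
Local Notation pt := 'rV[R]_d.

(** The conditions already met persist near the current point, and the next polynomial, not being
    zero, cannot vanish on a whole box there. *)
Lemma generic_point (J : eqType) (r : seq J) (F : J -> pt -> R) (x : pt) e : 0 < e ->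
  (forall j, j \in r -> polyf (F j) /\ exists y, F j y != 0) ->
  exists y : pt, (forall i, `|y 0 i - x 0 i| < e) /\ forall j, j \in r -> F j y != 0.
Proof.
move=> e0; elim: r => [|j r IH] HF.
  by exists x; split=> // i; rewrite subrr normr0.
have [|x' [xx' nz]] := IH; first by move=> j' jr; apply: HF; rewrite in_cons jr orbT.
have [pF [y0 y0n]] := HF j (mem_head _ _).
have : \forall y \near x', (forall i, `|(y : pt) 0 i - x 0 i| < e) /\ forall j, j \in r -> F j y != 0.
  have near1 : \forall y \near x', forall i : 'I_d, 0 < e ^+ 2 - ((y : pt) 0 i - x 0 i) ^+ 2.
    apply: (@filter_forall _ _ _ (nbhs x') (nbhs_filter x')) => i.
    apply: (near_gt0 (f := fun y : pt => e ^+ 2 - (y 0 i - x 0 i) ^+ 2)).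
      apply: polyf_continuous; apply: polyf_sub; first exact: polyf_cst.
      by apply: polyf_exp; apply: polyf_sub; [exact: polyf_coord|exact: polyf_cst].
    by rewrite subr_gt0 -[ltLHS]real_normK ?num_real // ltr_pXn2r // nnegrE ltW.
  have near2 : \forall y \near x', forall j, j \in r -> F j y != 0.
    have HF' j' : j' \in r -> polyf (F j') by move=> h; apply: (HF j' _).1; rewrite in_cons h orbT.
    elim: (r) HF' nz => [|j' r' IH'] pF' nz; first by apply: filterE.
    have n1 : \forall y \near x', 0 < F j' y * F j' y.
      apply: near_gt0; last by rewrite -expr2 exprn_even_gt0 //= nz ?mem_head.
      by apply: polyf_continuous; apply: polyf_mul; apply: pF'; exact: mem_head.
    have n2 : \forall y \near x', forall j, j \in r' -> F j y != 0.
      by apply: IH' => j'' h; [apply: pF'|apply: nz]; rewrite in_cons h orbT.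
    move: n1 n2; apply: filterS2 => y y1 y2 j''; rewrite in_cons => /predU1P[->|]; last exact: y2.
    by apply: contraTneq y1 => ->; rewrite mul0r ltxx.
  move: near1 near2; apply: filterS2 => y y1 y2; split=> // i.
  by have := y1 i; rewrite subr_gt0 -[ltLHS]real_normK ?num_real // ltr_pXn2r // nnegrE ltW.
move=> /nbhs_ballP[e' /= e'0 He'].
have [y [yy' Fy]] : exists y : pt, (forall i, `|y 0 i - x' 0 i| < e') /\ F j y != 0.
  apply: contrapT => /forallNP H; have := y0n; rewrite (polyf_zero_box (x := x') pF e'0) ?eqxx // => y yy.
  by apply/eqP; apply: contraT => n; case: (H y).
exists y; have [|H1 H2] := He' y; first by apply: rV_ball => // i; rewrite distrC.
by split=> // j'; rewrite in_cons => /predU1P[->|/H2].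
Qed.

Lemma line_near (y v : pt) A : nbhs y A -> exists2 e, 0 < e & forall t, `|t| < e -> A (y + t *: v).
Proof.
move=> /nbhs_ballP[e /= e0 He]; pose S := 1 + \sum_i `|v 0 i|.
have S0 : 0 < S by rewrite ltr_pwDl // sumr_ge0.
exists (e / S); first by rewrite divr_gt0.
move=> t; rewrite ltr_pdivlMr // => tS; apply/He/rV_ball => // i.
rewrite !mxE opprD addNKr normrN normrM; apply: le_lt_trans tS; apply: ler_wpM2l => //.
by rewrite /S (bigD1 i) //= addrCA lerDl addr_ge0 // sumr_ge0.
Qed.

Lemma uniform_small (J : eqType) (r : seq J) (P : J -> R -> Prop) :
  (forall j, j \in r -> exists2 e, 0 < e & forall t, 0 < t < e -> P j t) ->
  exists2 e, 0 < e & forall j t, j \in r -> 0 < t < e -> P j t.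
Proof.
elim: r => [|j r IH] H; first by exists 1.
have [|e e0 He] := IH; first by move=> j' h; apply: H; rewrite in_cons h orbT.
have [e' e'0 He'] := H j (mem_head _ _).
exists (Num.min e e'); first by rewrite lt_min e0.
move=> j' t; rewrite in_cons lt_min => /predU1P[->|jr] /and3P[t0 te te'].
  by apply: He'; rewrite t0.
by apply: He => //; rewrite t0.
Qed.
End Generic.

(** * Rays leaving a simplex *)

Section Exit.
Context {R : realType} {n : nat}.
Local Notation pt := 'rV[R]_n.+1.
Local Notation simplex := 'M[R]_(n.+2, n.+1).
Implicit Types (K : simplex) (x w : pt).

Lemma bc_ray K x w t i : bc K (x + t *: w) 0 i = bc K x 0 i + t * dbc K w 0 i.
Proof. by rewrite bc_line !mxE. Qed.

Lemma dbc_neg K w : dbc K w != 0 -> nondeg K -> exists i, dbc K w 0 i < 0.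
Proof.
move=> w0 nK; apply: contrapT => /forallNP H; move/negP: w0; apply; apply/eqP/rowP => i.
have ge j : 0 <= dbc K w 0 j by rewrite leNgt; apply/negP.
have /eqP := sum_dbc K w; rewrite psumr_eq0 // => /allP/(_ i (mem_index_enum _)) /eqP ->.
by rewrite mxE.
Qed.

(** The exit is the least zero of a decreasing barycentric coordinate; some coordinate decreases
    because the rates sum to zero without all vanishing. *)
Lemma ray_exit K x w t : nondeg K -> dbc K w != 0 -> hull K (x + t *: w) ->
  exists i t', [/\ t <= t', dbc K w 0 i < 0, hull K (x + t' *: w) & bc K (x + t' *: w) 0 i = 0].
Proof.
move=> nK /dbc_neg/(_ nK)[i0 i0n] hx.
pose f i := bc K x 0 i / - dbc K w 0 i.
case: (@Order.TotalTheory.arg_minP _ _ _ i0 (fun i => dbc K w 0 i < 0) f i0n) => i in_ imin.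
have key j : dbc K w 0 j < 0 -> t <= f j.
  move=> jn; rewrite /f ler_pdivlMr ?oppr_gt0 // mulrN -subr_ge0 opprK.
  by have := (hull_bc nK _).1 hx j; rewrite bc_ray.
have bi : bc K (x + f i *: w) 0 i = 0.
  by rewrite bc_ray /f; field; rewrite lt_eqF.
exists i, (f i); split=> //; first exact: key.
apply/(hull_bc nK) => j; rewrite bc_ray.
have [jn|jp] := ltP (dbc K w 0 j) 0.
  have := imin j jn; rewrite {2}/f ler_pdivlMr ?oppr_gt0 // mulrN -subr_ge0 opprK; exact.
have := (hull_bc nK _).1 hx j; rewrite bc_ray => h; apply: le_trans h _.
by rewrite lerD2l ler_wpM2r // key.
Qed.

Lemma nondeg_row_inj K : nondeg K -> injective (fun i => row i K).
Proof.
move=> nK i j /= e; have := congr1 (bc K) e; rewrite !bc_row // => /rowP/(_ i).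
by rewrite !mxE !eqxx /=; case: eqVneq => // _ /eqP; rewrite oner_eq0.
Qed.

(** The [n.+1] vertices of the face are distinct vertices of [K'], which has exactly one more, and
    that one is [i']. *)
Lemma shared_face K K' i : nondeg K -> nondeg K' ->
  (forall j, j != i -> row j K \in verts K') ->
  exists i', face K i = face K' i'.
Proof.
move=> nK nK' H.
have H' k : exists j', row (lift i k) K = row j' K'.
  by apply/vertsP/H; rewrite eq_sym neq_lift.
have [f hf] := choice H'.
have finj : injective f.
  move=> a b e; apply: (@lift_inj _ i); apply: (nondeg_row_inj nK).
  by rewrite /= !hf e.
have [i' i'n] : exists i', i' \notin codom f.
  apply: contrapT => /forallNP A.
  have : #|codom f| = n.+2.
    rewrite -[RHS]card_ord; apply: eq_card => x; rewrite [RHS]inE.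
    by apply/idP; apply: contraT => h; case: (A x).
  by rewrite card_codom // card_ord => /n_Sn.
have cod k : k != i' -> exists a, k = f a.
  have G a : exists b, f a = lift i' b.
    by have [b ->|e] := unliftP i' (f a); [exists b|rewrite -e codom_f in i'n].
  have [g hg] := choice G.
  have ginj : injective g by move=> a b e; apply: finj; rewrite !hg e.
  have [h _ hK] := injF_bij ginj.
  by have [b ->|->] := unliftP i' k; [exists (h b); rewrite hg hK|rewrite eqxx].
exists i'; apply: conv_mem => v; apply/face_vertsP/face_vertsP => -[j jn ->].
  have [k jk|jk] := unliftP i j; last by rewrite jk eqxx in jn.
  exists (f k); last by rewrite jk hf.
  by apply: contraNneq i'n => <-; exact: codom_f.
have [a ->] := cod j jn; exists (lift i a); first by rewrite eq_sym neq_lift.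
by rewrite hf.
Qed.
End Exit.

Section RayArgument.
Context {R : realType} {n : nat}.
Hypothesis n0 : (0 < n)%N.
Local Notation pt := 'rV[R]_n.+1.
Local Notation simplex := 'M[R]_(n.+2, n.+1).
Variable s : seq simplex.
Hypothesis ts : triangulation s.

Let nd K : K \in s -> nondeg K := ts.2.1 K.

Lemma hull_union K : K \in s -> hull K `<=` union s.
Proof. by move=> Ks x hx; exists K. Qed.

Lemma strict_hull_union K : K \in s -> strict_hull K `<=` interior (union s).
Proof.
move=> Ks x /(strict_hull_interior (nd Ks)); apply: interiorS; exact: hull_union.
Qed.

Lemma hull_closure K : K \in s -> hull K `<=` closure (interior (union s)).
Proof.
move=> Ks x hx B /(line_near (centroid n.+2 *m K - x))[e e0 He].
have nK := nd Ks.
pose t := Num.min (e / 2) 2^-1.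
have t0 : 0 < t by rewrite lt_min divr_gt0 //= invr_gt0.
have te : `|t| < e by rewrite gtr0_norm // gt_min ltr_pdivrMr // ltr_pMr // ltr1n.
have t1 : t < 1 by rewrite gt_min invf_lt1 // ltr1n orbT.
exists (x + t *: (centroid n.+2 *m K - x)); split; last exact: He.
apply: (strict_hull_union Ks) => i.
have -> : x + t *: (centroid n.+2 *m K - x) = ((1 - t) *: bc K x + t *: centroid n.+2) *m K.
  rewrite mulmxDl -!scalemxAl (bc_mulmx nK) scalerBl scale1r scalerBr -!addrA; congr (_ + _).
  by rewrite addrC.
have [_ c1] := stdsimplex_centroid (R := R) n.+1.
have [b [b0 b1 ->]] : exists b : 'rV[R]_n.+2, [/\ forall j, 0 <= b 0 j, \sum_j b 0 j = 1 & bc K x = b].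
  by exists (bc K x); split=> //; [exact/(hull_bc nK)|exact: sum_bc].
rewrite bcK //.
  rewrite !mxE ltr_wpDl ?mulr_gt0 ?invr_gt0 // mulr_ge0 //; by rewrite subr_ge0 ltW.
under eq_bigr do rewrite mxE [X in X + _]mxE [X in _ + X]mxE.
by rewrite big_split /= -!mulr_sumr b1 c1 !mulr1 subrK.
Qed.

(* The hyperplane of directions through [x] that meet a codimension-two flat. *)
Definition badform (x : pt) (q : simplex * ('I_n.+2 * 'I_n.+2)) (w : pt) : R :=
  if q.2.1 == q.2.2 then 1
  else bc q.1 x 0 q.2.2 * dbc q.1 w 0 q.2.1 - bc q.1 x 0 q.2.1 * dbc q.1 w 0 q.2.2.

Lemma polyf_dbc (K : simplex) i : polyf (fun w : pt => dbc K w 0 i).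
Proof. by rewrite /dbc; under eq_fun do rewrite -mulmxA; exact: polyf_mulmx. Qed.

(** The edge from [k] to [i] changes barycentric coordinate [i] and not [j], which shows that
    [badform] is not identically zero. *)
Lemma third_index (i j : 'I_n.+2) : exists k, (k != i) && (k != j).
Proof.
apply: contrapT => /forallNP H.
have : #|pred2 i j| = n.+2.
  rewrite -[RHS]card_ord; apply: eq_card => x; apply/idP; apply: contraT.
  by rewrite !inE negb_or => h; case: (H x).
by rewrite card2; move: n0; case: eqP => _ /=; lia.
Qed.

(** First [x] is taken off all hyperplanes spanned by faces. For such an [x] each [badform] is
    nonzero somewhere, and [w] is taken off their zero sets. *)
Lemma generic_ray K : K \in s -> exists x w, strict_hull K x /\
  forall K' i j, K' \in s -> i != j -> badform x (K', (i, j)) w != 0.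
Proof.
move=> Ks; have nK := nd Ks.
have /nbhs_ballP[e /= e0 He] := strict_hull_nbhs (strict_hull_centroid nK).
pose q1 := [seq (K', i) | K' <- s, i <- enum 'I_n.+2].
have [|x [xc xn]] := @generic_point R _ _ q1 (fun p x => bc p.1 x 0 p.2)
    (centroid n.+2 *m K) e e0.
  move=> p /allpairsP[[K' i] /= [K's _ ->]] /=; split; first exact: polyf_bc.
  by exists (row i K'); rewrite bc_row ?nd // mxE !eqxx oner_neq0.
pose q2 := [seq (K', p) | K' <- s, p <- enum {: 'I_n.+2 * 'I_n.+2}].
have [|w [_ wn]] := @generic_point R _ _ q2 (badform x) 0 1 ltr01.
  move=> p /allpairsP[[K' [i j]] /= [K's _ ->]]; rewrite /badform /=.
  have [ij|ij] := eqVneq i j.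
    by split; [exact: polyf_cst|exists 0; rewrite oner_neq0].
  split.
    by apply: polyf_sub; apply: polyf_mul; try exact: polyf_cst; exact: polyf_dbc.
  have [k /andP[ki kj]] := third_index i j; exists (row i K' - row k K').
  have xj : bc K' x 0 j != 0.
    by apply: (xn (K', j)); apply/allpairsP; exists (K', j); rewrite mem_enum.
  have ji : (j == i) = false by rewrite eq_sym (negbTE ij).
  rewrite dbc_edge ?nd //; move: (bc K' x) xj => b bj; rewrite !mxE !eqxx /= ji.
  by rewrite (eq_sym i k) (negbTE ki) (eq_sym j k) (negbTE kj) !subr0 mulr1 mulr0 subr0.
exists x, w; split.
  by apply: He; apply: rV_ball => // i; rewrite distrC.
move=> K' i j K's ij; apply: wn; apply/allpairsP; exists (K', (i, j)).
by rewrite mem_enum.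
Qed.

Theorem face_constant_zero (c : simplex -> R) (ub : set pt -> pt -> R) :
  (forall K i x, K \in s -> face K i x -> ub (face K i) x = c K) ->
  (forall K i, K \in s -> face K i `<=` bdry (interior (union s)) ->
     forall x, face K i x -> ub (face K i) x = 0) ->
  forall K, K \in s -> c K = 0.
Proof.
move=> cst bdry0 K0 K0s; apply/eqP; apply: contraT => c0.
have [x0 [w [x0s gen]]] := generic_ray K0s.
have i01 : ord0 != lift ord0 ord0 :> 'I_n.+2 by [].
have w0 K : K \in s -> dbc K w != 0.
  move=> Ks; apply: contraTneq (gen K _ _ Ks i01) => e; rewrite /badform /= e !mxE.
  by rewrite !mulr0 subrr eqxx.
(* Were both coordinates zero at the same parameter, their values at [x0] would be proportional to
   their rates, and [badform] would vanish. *)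
have codim2 K i j t : K \in s -> i != j -> bc K (x0 + t *: w) 0 i = 0 -> bc K (x0 + t *: w) 0 j != 0.
  move=> Ks ij; rewrite !bc_ray => ei; apply/negP => /eqP ej.
  have := gen K i j Ks ij; rewrite /badform /= (negbTE ij).
  move/eqP: ei; rewrite addr_eq0 => /eqP ->; move/eqP: ej; rewrite addr_eq0 => /eqP ->.
  by move/eqP; apply; ring.
(* Exits are indexed by a simplex and a vertex. There are finitely many pairs, and each determines
   its parameter, so a last exit exists. *)
pose P (p : seq_sub s * 'I_n.+2) (t : R) := c (ssval p.1) = c K0 /\
  [/\ dbc (ssval p.1) w 0 p.2 < 0, hull (ssval p.1) (x0 + t *: w) &
     bc (ssval p.1) (x0 + t *: w) 0 p.2 = 0].
have Puniq p t t' : P p t -> P p t' -> t = t'.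
  move=> [_ [d0 _]]; rewrite bc_ray => e [_ [_ _]]; rewrite bc_ray -e => /eqP.
  by rewrite eq_sym (inj_eq (addrI _)) (inj_eq (mulIf (ltr0_neq0 d0))) => /eqP.
pose tm p := xget 0 (P p).
have exitP K t : K \in s -> c K = c K0 -> hull K (x0 + t *: w) ->
    exists p, P p (tm p) /\ t <= tm p.
  move=> Ks cK hK'; have [i [t' [tt' di h b]]] := ray_exit (nd Ks) (w0 K Ks) hK'.
  exists (SeqSub Ks, i); have Pt : P (SeqSub Ks, i) t' by [].
  have Pt' : P (SeqSub Ks, i) (tm (SeqSub Ks, i)) := xgetPex 0 (ex_intro _ _ Pt).
  by split => //; rewrite (Puniq _ _ _ Pt' Pt).
have [|p0 [Pp0 _]] := exitP K0 0 K0s erefl.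
  by rewrite scale0r addr0; apply: (strict_hull_sub (nd K0s)).
have Pb : `[< P p0 (tm p0) >] by apply/asboolP.
case: (@Order.TotalTheory.arg_maxP _ _ _ p0 (fun p => `[< P p (tm p) >]) tm Pb) =>
  -[[K' K's] i] /asboolP[/= cK' [di hx bi]] pmax.
set t := tm _ in hx bi pmax; set xs := x0 + t *: w in hx bi.
have last K t' : K \in s -> c K = c K0 -> t < t' -> ~ hull K (x0 + t' *: w).
  move=> Ks cK tt' /(exitP K t' Ks cK)[p [Pp t'p]].
  by have := pmax p; rewrite asboolT // => /(_ isT); rewrite leNgt (lt_le_trans tt' t'p).
have fx : face K' i xs by apply/(face_bc (nd K's)).
have [sub|/existsNP[y /not_implyP[fy nby]]] := pselect (face K' i `<=` bdry (interior (union s))).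
  by move: c0; rewrite -cK' -(cst K' i xs K's fx) (bdry0 K' i K's sub xs fx) eqxx.
have nK' := nd K's.
have yO : interior (interior (union s)) y.
  apply: contrapT => ny; apply: nby; split => //; apply: (hull_closure K's).
  by have /(face_bc nK')[] := fy.
have [e e0 He] := line_near (xs - y) yO.
pose dl := Num.min (e / 2) 2^-1.
have dl0 : 0 < dl by rewrite lt_min divr_gt0 //= invr_gt0.
have dle : `|dl| < e by rewrite gtr0_norm // gt_min ltr_pdivrMr // ltr_pMr // ltr1n.
have dl1 : dl < 1 by rewrite gt_min invf_lt1 // ltr1n orbT.
(* [y] is interior to the domain but may lie on several faces of [K']; [xs] lies on face [i] alone
   but is not known to be interior. A short move from [y] towards [xs] yields both properties. *)
pose z := y + dl *: (xs - y); have zO : interior (union s) z by exact: He.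
have [/(hull_bc nK') hy byi] := (face_bc nK' i y).1 fy.
have zE j : bc K' z 0 j = (1 - dl) * bc K' y 0 j + dl * bc K' xs 0 j.
  rewrite /z bc_ray; have := bc_line K' y (xs - y) 1.
  by rewrite scale1r [y + _]addrC subrK => ->; rewrite !mxE; ring.
have zi : bc K' z 0 i = 0 by rewrite zE byi bi !mulr0 addr0.
have zj j : j != i -> 0 < bc K' z 0 j.
  move=> ji; rewrite zE ltr_wpDl ?mulr_ge0 ?subr_ge0 ?(ltW dl1) ?hy // mulr_gt0 //.
  rewrite lt_neqAle eq_sym (codim2 K' i j) // 1?eq_sym //=; exact: (hull_bc nK' _).1.
have zhull : hull K' z.
  by apply/(hull_bc nK') => j; have [->|/zj/ltW//] := eqVneq j i; rewrite zi.
have [e1 e10 He1] := line_near w zO.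
(* Just beyond [z] the ray lies in a neighbour [K2] sharing the face with [K']. *)
have [K2 K2s K2w] : exists2 K2, K2 \in s & forall e2, 0 < e2 ->
    exists2 t2, 0 < t2 < e2 & hull K2 (z + t2 *: w).
  apply: contrapT => H.
  have [|e2 e20 He2] := @uniform_small R _ s (fun K2 t2 => ~ hull K2 (z + t2 *: w)).
    move=> K2 K2s; apply: contrapT => H2; apply: H; exists K2 => // e2 e20.
    apply: contrapT => H3; apply: H2; exists e2 => // t2 t20 h; apply: H3.
    by exists t2.
  pose t2 := Num.min e1 e2 / 2.
  have m0 : 0 < Num.min e1 e2 by rewrite lt_min e10.
  have t20 : 0 < t2 by rewrite divr_gt0.
  have t2m : t2 < Num.min e1 e2 by rewrite ltr_pdivrMr // ltr_pMr // ltr1n.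
  move: (t2m); rewrite lt_min => /andP[t2e1 t2e2].
  have [K2 K2s h] := He1 t2 (etrans (congr1 (fun r => r < e1) (gtr0_norm t20)) t2e1).
  by apply: (He2 K2 t2 K2s) => //; rewrite t20.
have nK2 := nd K2s.
(* A negative coordinate of [z] would stay negative on a short piece of the ray, contrary to
   [K2w]. *)
have zK2 : hull K2 z.
  apply/(hull_bc nK2) => j; rewrite leNgt; apply/negP => zneg.
  have [e2 e20 He2] : exists2 e2, 0 < e2 & forall t2, 0 < t2 < e2 -> bc K2 z 0 j + t2 * dbc K2 w 0 j < 0.
    exists (- bc K2 z 0 j / (1 + `|dbc K2 w 0 j|)); first by rewrite divr_gt0 ?oppr_gt0 // ltr_pwDl.
    move=> t2 /andP[t20]; rewrite ltr_pdivlMr ?ltr_pwDl // => lt.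
    have := ler_norm (t2 * dbc K2 w 0 j); rewrite normrM (gtr0_norm t20).
    by move: lt; rewrite mulrDr mulr1; lra.
  have [t2 t2e /(hull_bc nK2) /(_ j)] := K2w e2 e20.
  by rewrite bc_ray leNgt He2.
have K2K' : K' != K2.
  apply/eqP => e'; have [t2 /andP[t20 _] /(hull_bc nK2)/(_ i)] := K2w 1 ltr01.
  by rewrite -e' bc_ray zi add0r leNgt nmulr_llt0 // t20.
(* [z] lies in both simplices, hence in the hull of their common vertices; its weight at each vertex
   of [K'] other than [i] is positive. *)
have common j : j != i -> row j K' \in verts K2.
  move=> ji.
  have /(@conv_rows _ _ _ _ K') : Defs.conv [seq v <- verts K' | v \in verts K2] z.
    by rewrite -ts.2.2.1.
  case=> [v|lam [[_ l1] zl l0]]; first by rewrite mem_filter => /andP[_ /vertsP].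
  have := zj j ji; rewrite zl bcK //; apply: contraTT => h.
  by rewrite l0 ?ltxx // mem_filter (negbTE h).
have [i2 Fe] := shared_face nK' nK2 common.
have cK2 : c K2 = c K0.
  by rewrite -cK' -(cst K' i xs K's fx) Fe; apply/esym/cst; rewrite // -Fe.
have fx2 : face K2 i2 xs by rewrite -Fe.
have fz2 : face K2 i2 z by rewrite -Fe; apply/(face_bc nK').
have [/(hull_bc nK2) hxs2 bxs2] := (face_bc nK2 i2 xs).1 fx2.
have [_ bz2] := (face_bc nK2 i2 z).1 fz2.
(* The sign is seen at [z], but the rate is the same at [xs], so the ray enters [K2] there too,
   beyond the last exit. *)
have d2 : 0 <= dbc K2 w 0 i2.
  have [t2 /andP[t20 _] /(hull_bc nK2)/(_ i2)] := K2w 1 ltr01.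
  by rewrite bc_ray bz2 add0r pmulr_rge0.
have [e2 e20 He2] : exists2 e2, 0 < e2 & forall t2 : R, 0 < t2 < e2 -> hull K2 (xs + t2 *: w).
  have [|e2 e20 He2] := @uniform_small R _ (enum 'I_n.+2)
      (fun j t2 => 0 <= bc K2 (xs + t2 *: w) 0 j).
    move=> j _; have [->|ji2] := eqVneq j i2.
      exists 1 => // t2 /andP[t20 _].
      by rewrite bc_ray bxs2 add0r mulr_ge0 // ltW.
    have pj : 0 < bc K2 xs 0 j.
      by rewrite lt_neqAle eq_sym (codim2 K2 i2 j) // 1?eq_sym //= hxs2.
    exists (bc K2 xs 0 j / (1 + `|dbc K2 w 0 j|)); first by rewrite divr_gt0 // ltr_pwDl.
    move=> t2 /andP[t20]; rewrite ltr_pdivlMr ?ltr_pwDl // bc_ray => lt.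
    have := ler_norm (- (t2 * dbc K2 w 0 j)); rewrite normrN normrM (gtr0_norm t20).
    by move: lt; rewrite mulrDr mulr1; lra.
  exists e2 => // t2 t2e; apply/(hull_bc nK2) => j; apply: He2 => //.
  by rewrite mem_enum.
have t20 : 0 < e2 / 2 < e2 by rewrite divr_gt0 //= ltr_pdivrMr // ltr_pMr // ltr1n.
have := He2 _ t20; rewrite /xs -addrA -scalerDl => h.
by case: (last K2 (t + e2 / 2) K2s cK2 _ h); rewrite ltrDl divr_gt0.
Qed.
End RayArgument.

(** * Element forms *)

Section ElementForms.
Context {R : realType} {n : nat}.
Hypothesis ic : integral_calculus (R := R) n.
Local Notation pt := 'rV[R]_n.+1.
Local Notation simplex := 'M[R]_(n.+2, n.+1).
Variables (k l m : nat).
Local Notation swf := (@wfun R n.+1 R).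
Local Notation vwf := (@wfun R n.+1 pt).
Implicit Types (K : simplex) (s t : swf) (w : vwf).

Definition wpoly K s := poly_le k (f0 s K) /\ forall i, poly_le l (fb s (face K i)).
Definition wvpoly K w := polyv (f0 w K) /\ forall i, polyv (fb w (face K i)).
Definition wcomb K a s t (st : swf) := (forall x, f0 st K x = a * f0 s K x + f0 t K x) /\
  forall i x, fb st (face K i) x = a * fb s (face K i) x + fb t (face K i) x.
Definition wvcomb K a w w' (ww' : vwf) := (forall x : pt, f0 ww' K x = a *: f0 w K x + f0 w' K x) /\
  forall i (x : pt), fb ww' (face K i) x = a *: fb w (face K i) x + fb w' (face K i) x.
(** The functions ignored by all forms: [fb] is asked to vanish on the face itself only. *)
Definition wnull K s := (forall x : pt, f0 s K x = 0) /\
  forall i x, face K i x -> fb s (face K i) x = 0.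

Definition a_el K s t : R :=
  el_int K (fun x => dotv (wG m K s x) (wG m K t x))
  + \sum_(i < n.+2) face_int K i (fun x => tauK K *
     ((Qb l K i (f0 s K) x - fb s (face K i) x) *
      (Qb l K i (f0 t K) x - fb t (face K i) x))).

Definition c_el K w s (phi : pt -> R) : R :=
  el_int K (fun x => wD k K (scalw s w) x * phi x).

Variable K : simplex.
Hypothesis nK : nondeg K.

Let pf0 s : wpoly K s -> polyf (f0 s K).
Proof. by move=> [/poly_le_polyf]. Qed.

Let pfb s i : wpoly K s -> polyf (fb s (face K i)).
Proof. by move=> [_ /(_ i) /poly_le_polyf]. Qed.

Lemma wG_test s tau : wpoly K s -> poly_vec m tau ->
  el_int K (fun x => dotv (wG m K s x) (tau x)) = - el_int K (fun x => f0 s K x * divf tau x)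
    + \sum_(i < n.+2) face_int K i (fun x => fb s (face K i) x * dotv (tau x) (nrm K i)).
Proof. by move=> ps pt'; apply: (wgradP ic nK m _ _).2 => // [|i]; [exact: pf0|exact: pfb]. Qed.

Lemma wG_poly s : wpoly K s -> poly_vec m (wG m K s).
Proof. by move=> ps; apply: (wgradP ic nK m _ _).1 => // [|i]; [exact: pf0|exact: pfb]. Qed.

Let jump_poly s i : wpoly K s -> poly_le l (fun x => Qb l K i (f0 s K) x - fb s (face K i) x).
Proof.
move=> ps; have := poly_leD (QbP ic nK l i (pf0 ps)).1 (poly_leZ (-1) (ps.2 i)).
by congr poly_le; apply/funext => x; rewrite mulN1r.
Qed.

Lemma a_el_sym s t : a_el K s t = a_el K t s.
Proof.
congr (_ + _); first by congr el_int; apply/funext => x; rewrite dotvC.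
by apply: eq_bigr => i _; congr face_int; apply/funext => x; ring.
Qed.

(** Testing the defining identity with the weak gradient of [r] leaves only [f0] and [fb] of the
    first argument; in the stabilisation [Qb_test] does the same, the jump of [r] having degree at
    most [l]. *)
Lemma a_el_linear a s t (st r : swf) : wpoly K s -> wpoly K t -> wpoly K st -> wpoly K r ->
  wcomb K a s t st -> a_el K st r = a * a_el K s r + a_el K t r.
Proof.
move=> ps pt' pst pr [c0 cb]; rewrite /a_el !(wG_test _ (wG_poly pr)) //.
have pr' := poly_vec_polyv (wG_poly pr).
have pd := polyf_divf pr'.
rewrite (el_int_comb ic nK (a := a) (F := fun x => f0 s K x * divf (wG m K r) x)
   (G := fun x => f0 t K x * divf (wG m K r) x)); last first.
- by move=> x; rewrite c0; ring.
- by apply: polyf_mul => //; exact: pf0.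
- by apply: polyf_mul => //; exact: pf0.
have E i : face_int K i (fun x => fb st (face K i) x * dotv (wG m K r x) (nrm K i)) =
    a * face_int K i (fun x => fb s (face K i) x * dotv (wG m K r x) (nrm K i)) +
    face_int K i (fun x => fb t (face K i) x * dotv (wG m K r x) (nrm K i)).
  have pn : polyf (fun x => dotv (wG m K r x) (nrm K i)).
    by apply: polyf_dotv => //; exact: polyv_cst.
  apply: (face_int_comb ic); last by move=> x; rewrite cb; ring.
    by apply: polyf_mul => //; exact: pfb.
  by apply: polyf_mul => //; exact: pfb.
under eq_bigr do rewrite E.
have J q i : wpoly K q -> face_int K i (fun x => tauK K *
     ((Qb l K i (f0 q K) x - fb q (face K i) x) * (Qb l K i (f0 r K) x - fb r (face K i) x))) =
   face_int K i (fun x => (f0 q K x - fb q (face K i) x) *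
     (tauK K * (Qb l K i (f0 r K) x - fb r (face K i) x))).
  move=> pq; rewrite -(Qb_test ic nK (l := l)).
  - by congr face_int; apply/funext => x; ring.
  - exact: pf0.
  - exact: pfb.
  by apply: poly_leZ; exact: jump_poly.
have E' i : face_int K i (fun x => tauK K *
     ((Qb l K i (f0 st K) x - fb st (face K i) x) * (Qb l K i (f0 r K) x - fb r (face K i) x))) =
   a * face_int K i (fun x => tauK K *
     ((Qb l K i (f0 s K) x - fb s (face K i) x) * (Qb l K i (f0 r K) x - fb r (face K i) x))) +
   face_int K i (fun x => tauK K *
     ((Qb l K i (f0 t K) x - fb t (face K i) x) * (Qb l K i (f0 r K) x - fb r (face K i) x))).
  have pj : polyf (fun x => tauK K * (Qb l K i (f0 r K) x - fb r (face K i) x)).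
    by apply: polyf_mul; [exact: polyf_cst|exact: poly_le_polyf (jump_poly i pr)].
  rewrite !J //; apply: (face_int_comb ic); last by move=> x; rewrite c0 cb; ring.
    by apply: polyf_mul => //; apply: polyf_sub; [exact: pf0|exact: pfb].
  by apply: polyf_mul => //; apply: polyf_sub; [exact: pf0|exact: pfb].
under [X in _ + X]eq_bigr do rewrite E'.
rewrite !big_split /= -!mulr_sumr; ring.
Qed.

Lemma a_el_jump_ge0 s i : 0 <= face_int K i (fun x => tauK K *
     ((Qb l K i (f0 s K) x - fb s (face K i) x) * (Qb l K i (f0 s K) x - fb s (face K i) x))).
Proof.
by apply: (face_int_ge0 ic) => x _; rewrite mulr_ge0 ?(ltW (tauK_gt0 nK)) // -expr2 sqr_ge0.
Qed.

Lemma a_el_ge0 s : 0 <= a_el K s s.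
Proof.
apply: addr_ge0; first by apply: (el_int_ge0 ic) => x _; exact: dotvv_ge0.
by apply: sumr_ge0 => i _; exact: a_el_jump_ge0.
Qed.

Lemma a_el_null s t : wpoly K s -> wpoly K t -> wnull K s -> a_el K s t = 0.
Proof.
move=> ps pt' [s0 sb]; rewrite /a_el (wG_test _ (wG_poly pt')) //.
rewrite (el_int_zero ic nK) => [|x _]; last by rewrite s0 mul0r.
rewrite oppr0 add0r big1 => [|i _]; last first.
  by apply: (face_int_zero ic) => x fx; rewrite sb // mul0r.
rewrite add0r big1 // => i _.
have pj : poly_le l (fun x => tauK K * (Qb l K i (f0 t K) x - fb t (face K i) x)).
  by apply: poly_leZ; exact: jump_poly.
have := Qb_test ic nK i (pf0 ps) (pfb i ps) pj.
rewrite [X in _ = X](face_int_zero ic) => [e|x fx]; last by rewrite s0 sb // subrr mul0r.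
by rewrite -[RHS]e; congr face_int; apply/funext => x; ring.
Qed.

Lemma a_el_kernel s : (k.-1 <= m <= l)%N -> wpoly K s -> a_el K s s = 0 ->
  exists c, (forall x, f0 s K x = c) /\ forall i x, face K i x -> fb s (face K i) x = c.
Proof.
move=> kml ps; rewrite /a_el => /eqP; rewrite paddr_eq0; first last.
- by apply: sumr_ge0 => i _; exact: a_el_jump_ge0.
- by apply: (el_int_ge0 ic) => x _; exact: dotvv_ge0.
move=> /andP[/eqP g0]; rewrite psumr_eq0 => [/allP j0|i _]; last exact: a_el_jump_ge0.
apply: (local_kernel ic nK kml ps.1 ps.2 g0) => i.
have /eqP := j0 i (mem_index_enum _).
have pj := poly_le_polyf (jump_poly i ps).
rewrite (@face_int_comb _ _ ic K i (tauK K) (fun x => (Qb l K i (f0 s K) x - fb s (face K i) x) *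
   (Qb l K i (f0 s K) x - fb s (face K i) x)) (fun=> 0)).
- rewrite [X in _ + X](face_int_zero ic) // addr0 => /eqP.
  by rewrite mulf_eq0 (gt_eqF (tauK_gt0 nK)) /= => /eqP.
- exact: polyf_mul.
- exact: polyf_cst.
by move=> x; rewrite addr0.
Qed.

Let polyv_scale (q : pt -> R) (v : pt -> pt) : polyf q -> polyv v -> polyv (fun x => q x *: v x).
Proof. by move=> pq pv c; under eq_fun do rewrite mxE; exact: polyf_mul. Qed.

Lemma c_elE s w phi : wpoly K s -> wvpoly K w -> poly_le k phi ->
  c_el K w s phi = - el_int K (fun x => dotv (f0 s K x *: f0 w K x) (gradf phi x))
   + \sum_(i < n.+2) face_int K i (fun x =>
       dotv (fb s (face K i) x *: fb w (face K i) x) (nrm K i) * phi x).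
Proof.
move=> ps pw pp; apply: (wdivP ic nK k _ _).2 => // [|i].
  by apply: polyv_scale; [exact: pf0|exact: pw.1].
by apply: polyv_scale; [exact: pfb|exact: pw.2].
Qed.

Let p_el s w phi : wpoly K s -> wvpoly K w -> poly_le k phi ->
  polyf (fun x => dotv (f0 s K x *: f0 w K x) (gradf phi x)).
Proof.
move=> ps pw /poly_le_polyf pp; apply: polyf_dotv; last exact: polyv_gradf.
by apply: polyv_scale; [exact: pf0|exact: pw.1].
Qed.

Let p_face s w phi i : wpoly K s -> wvpoly K w -> poly_le k phi ->
  polyf (fun x => dotv (fb s (face K i) x *: fb w (face K i) x) (nrm K i) * phi x).
Proof.
move=> ps pw /poly_le_polyf pp; apply: polyf_mul => //; apply: polyf_dotv; last exact: polyv_cst.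
by apply: polyv_scale; [exact: pfb|exact: pw.2].
Qed.

(** A common source of linearity in each of the three arguments: the integrands of [c_elE] need only
    combine pointwise. *)
Let c_el_comb a s1 w1 p1 s2 w2 p2 s3 w3 p3 :
  wpoly K s1 -> wvpoly K w1 -> poly_le k p1 -> wpoly K s2 -> wvpoly K w2 -> poly_le k p2 ->
  wpoly K s3 -> wvpoly K w3 -> poly_le k p3 ->
  (forall x, dotv (f0 s3 K x *: f0 w3 K x) (gradf p3 x) =
     a * dotv (f0 s1 K x *: f0 w1 K x) (gradf p1 x) + dotv (f0 s2 K x *: f0 w2 K x) (gradf p2 x)) ->
  (forall i x, dotv (fb s3 (face K i) x *: fb w3 (face K i) x) (nrm K i) * p3 x =
     a * (dotv (fb s1 (face K i) x *: fb w1 (face K i) x) (nrm K i) * p1 x) +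
     dotv (fb s2 (face K i) x *: fb w2 (face K i) x) (nrm K i) * p2 x) ->
  c_el K w3 s3 p3 = a * c_el K w1 s1 p1 + c_el K w2 s2 p2.
Proof.
move=> ps1 pw1 pp1 ps2 pw2 pp2 ps3 pw3 pp3 e0 eb; rewrite !c_elE //.
rewrite (el_int_comb ic nK (p_el ps1 pw1 pp1) (p_el ps2 pw2 pp2) e0).
have E i := face_int_comb ic K i (p_face i ps1 pw1 pp1) (p_face i ps2 pw2 pp2) (eb i).
under eq_bigr do rewrite E.
rewrite big_split /= -mulr_sumr; ring.
Qed.

Lemma c_el_linear_s a s t (st : swf) w phi : wpoly K s -> wpoly K t -> wpoly K st -> wvpoly K w ->
  poly_le k phi -> wcomb K a s t st -> c_el K w st phi = a * c_el K w s phi + c_el K w t phi.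
Proof.
move=> ps pt' pst pw pp [c0 cb]; apply: c_el_comb => // [x|i x]; rewrite !dotvZl ?c0 ?cb; ring.
Qed.

Lemma c_el_linear_w a s w w' (ww' : vwf) phi : wpoly K s -> wvpoly K w -> wvpoly K w' -> wvpoly K ww' ->
  poly_le k phi -> wvcomb K a w w' ww' -> c_el K ww' s phi = a * c_el K w s phi + c_el K w' s phi.
Proof.
move=> ps pw pw' pww pp [c0 cb]; apply: c_el_comb => // [x|i x];
  rewrite !dotvZl ?c0 ?cb dotv_linear; ring.
Qed.

Lemma c_el_linear_phi a s w p q pq : wpoly K s -> wvpoly K w -> poly_le k p -> poly_le k q ->
  poly_le k pq -> (forall x, pq x = a * p x + q x) ->
  c_el K w s pq = a * c_el K w s p + c_el K w s q.
Proof.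
move=> ps pw pp pq' ppq c0; apply: c_el_comb => // [x|i x]; last by rewrite c0; ring.
move/funext: c0 => ->; rewrite (gradf_comb _ _ (poly_le_polyf pp) (poly_le_polyf pq')).
exact: dotv_combr.
Qed.

Lemma c_el_null s w phi : wpoly K s -> wvpoly K w -> poly_le k phi -> wnull K s ->
  c_el K w s phi = 0.
Proof.
move=> ps pw pp [s0 sb]; rewrite c_elE //.
rewrite (el_int_zero ic nK) => [|x _]; last by rewrite s0 dotvZl mul0r.
rewrite oppr0 add0r big1 // => i _; apply: (face_int_zero ic) => x fx.
by rewrite sb // dotvZl !mul0r.
Qed.

Lemma c_el_null_phi s w phi : (forall x, phi x = 0) -> c_el K w s phi = 0.
Proof. by move=> p0; apply: (el_int_zero ic nK) => x _; rewrite p0 mulr0. Qed.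
End ElementForms.

(** * Mesh forms *)

Section MeshForms.
Context {R : realType} {n : nat}.
Hypothesis ic : integral_calculus (R := R) n.
Local Notation pt := 'rV[R]_n.+1.
Local Notation simplex := 'M[R]_(n.+2, n.+1).
Local Notation swf := (@wfun R n.+1 R).
Local Notation vwf := (@wfun R n.+1 pt).
Variables (k l m : nat) (TH : seq simplex) (E : lmodType R) (W : set E) (N : nat).
Variable U : 'I_N -> E -> swf.
Hypothesis lk : (l <= k)%N.
Hypothesis sW : subspace W.
Hypothesis nd : forall K, K \in TH -> nondeg K.
Hypothesis combU : forall c a u v K, wcomb K a (U c u) (U c v) (U c (a *: u + v)).
Hypothesis polyU : forall c u K, W u -> K \in TH -> wpoly k l K (U c u).

(** [U c] extracts a scalar component. The velocity has [n.+1] of them and the temperature one, so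
    both diffusion forms are instances, up to their coefficients. *)
Definition diffusion (u v : E) : R :=
  \sum_(K <- TH) \sum_(c < N) a_el l m K (U c u) (U c v).

Lemma diffusion_linear v : W v -> linear_on W (diffusion ^~ v).
Proof.
move=> Wv; apply: linear_on_bigsum => K Ks; apply: linear_on_bigsum => c _ a u w Wu Ww.
apply: (a_el_linear ic m (nd Ks) (polyU c Wu Ks) (polyU c Ww Ks) _ (polyU c Wv Ks)) => //.
by apply: polyU => //; exact: sW.2.
Qed.

Lemma diffusion_sym u v : diffusion u v = diffusion v u.
Proof. by apply: eq_bigr => K _; apply: eq_bigr => c _; exact: a_el_sym. Qed.

Lemma diffusion_ge0 u : 0 <= diffusion u u.
Proof.
rewrite /diffusion big_seq_cond; apply: sumr_ge0 => K; rewrite andbT => Ks.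
by apply: sumr_ge0 => c _; exact: (a_el_ge0 ic l m (nd Ks)).
Qed.

Lemma diffusion_null u v : W u -> W v -> (forall c K, K \in TH -> wnull K (U c u)) ->
  diffusion u v = 0.
Proof.
move=> Wu Wv H; rewrite /diffusion big_seq_cond big1 // => K; rewrite andbT => Ks.
rewrite big1 // => c _.
by apply: (a_el_null ic m (nd Ks) (polyU c Wu Ks) (polyU c Wv Ks)); exact: H.
Qed.

Lemma diffusion_eq0 u c K : W u -> diffusion u u = 0 -> K \in TH ->
  a_el l m K (U c u) (U c u) = 0.
Proof.
move=> Wu /eqP; rewrite /diffusion big_seq_cond psumr_eq0 => [/allP H Ks|K']; last first.
  by rewrite andbT => Ks; apply: sumr_ge0 => c' _; exact: (a_el_ge0 ic l m (nd Ks)).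
have := H K Ks; rewrite Ks /= psumr_eq0 => [/allP/(_ c (mem_index_enum _)) /eqP //|c' _].
exact: (a_el_ge0 ic l m (nd Ks)).
Qed.

(** The functionals are moments of all components, on all elements and faces, against the monomials
    with exponents at most [k]; since [l <= k], they also test a face polynomial against itself. *)
Lemma diffusion_finite : exists N' (phi : 'I_N' -> E -> R), (forall j, linear_on W (phi j)) /\
  forall u, W u -> (forall j, phi j u = 0) -> diffusion u u = 0.
Proof.
pose J : finType := (seq_sub TH * option 'I_n.+2 * 'I_N * {ffun 'I_n.+1 -> 'I_k.+1})%type.
pose mo (j : J) : pt -> R := mono (fun i => j.2 i : nat).
pose phi (j : J) u : R := match j.1.1.2 with
  | None => el_int (ssval j.1.1.1) (fun x => f0 (U j.1.2 u) (ssval j.1.1.1) x * mo j x)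
  | Some i => face_int (ssval j.1.1.1) i
      (fun x => fb (U j.1.2 u) (face (ssval j.1.1.1) i) x * mo j x) end.
have pmo j : polyf (mo j) := polyf_mono _.
exists #|J|, (fun j => phi (enum_val j)); split.
  move=> j a u v Wu Wv; rewrite /phi; case: (enum_val j) => -[[[K Ks] o] c] b /=.
  have [pu0 pub] := polyU c Wu Ks; have [pv0 pvb] := polyU c Wv Ks.
  have [c0 cb] := combU c a u v K.
  case: o => [i|].
    apply: (face_int_comb ic); last by move=> x; rewrite cb; ring.
      by apply: polyf_mul; [exact: poly_le_polyf (pub i)|exact: polyf_mono].
    by apply: polyf_mul; [exact: poly_le_polyf (pvb i)|exact: polyf_mono].
  apply: (el_int_comb ic (nd Ks)); last by move=> x; rewrite c0; ring.
    by apply: polyf_mul; [exact: poly_le_polyf pu0|exact: polyf_mono].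
  by apply: polyf_mul; [exact: poly_le_polyf pv0|exact: polyf_mono].
move=> u Wu pu; apply: diffusion_null => // c K Ks.
have {}pu j : phi j u = 0 by rewrite -(enum_rankK j).
have [pu0 pub] := polyU c Wu Ks.
(* Vanishing moments against all monomials of degree at most [k] kill a polynomial of that degree. *)
have mom (I : (pt -> R) -> R) q : polyf q -> (forall a f g, polyf f -> polyf g ->
      I (fun x => a * f x + g x) = a * I f + I g) ->
    (forall b : {ffun 'I_n.+1 -> 'I_k.+1}, I (fun x => q x * mono (fun i => b i : nat) x) = 0) ->
    forall p, poly_le k p -> I (fun x => q x * p x) = 0.
  move=> pq lI H p /(poly_le_ind (n := k) (P := fun p => polyf p /\ I (fun x => q x * p x) = 0)).
  case=> //.
  - split; first exact: polyf_cst.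
    have := lI (-1) _ _ (polyf_mul pq (polyf_cst _ 0)) (polyf_mul pq (polyf_cst _ 0)).
    by rewrite mulN1r addNr => e; rewrite -[RHS]e; congr I; apply/funext => x; ring.
  - move=> f g [pf f0] [pg g0]; split; first exact: polyf_add.
    have := lI 1 _ _ (polyf_mul pq pf) (polyf_mul pq pg); rewrite f0 g0 mulr0 addr0 => e.
    by rewrite -[RHS]e; congr I; apply/funext => x; ring.
  move=> r a ar; split; first by apply: polyf_mul; [exact: polyf_cst|exact: polyf_mono].
  have lt i : (a i < k.+1)%N by rewrite ltnS (leq_trans _ ar) // (bigD1 i) //= leq_addr.
  have := H [ffun i => Ordinal (lt i)].
  rewrite (_ : (fun i => _) = a); last by apply/funext => i; rewrite ffunE.
  move=> h; have := lI r _ _ (polyf_mul pq (polyf_mono (R := R) a)) (polyf_cst _ 0).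
  have z : I (fun=> 0) = 0.
    have := lI (-1) _ _ (polyf_cst _ 0) (polyf_cst _ 0); rewrite [X in _ = X + _]mulN1r addNr => e.
    by rewrite -[RHS]e; congr I; apply/funext => x; ring.
  by rewrite h z mulr0 addr0 => e; rewrite -[RHS]e; congr I; apply/funext => x; ring.
split=> [|i].
  apply: (el_int_sqr_eq0 ic (nd Ks) (poly_le_polyf pu0)); apply: (mom (el_int K)) => //.
  - exact: poly_le_polyf pu0.
  - by move=> a f g pf pg; exact: (el_int_linear ic (nd Ks)).
  by move=> b; have := pu (SeqSub Ks, None, c, b).
apply: (face_int_sqr_eq0 ic (nd Ks) (poly_le_polyf (pub i))); apply: (mom (face_int K i)) => //.
- exact: poly_le_polyf (pub i).
- by move=> a f g pf pg; exact: (face_int_linear ic).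
- by move=> b; have := pu (SeqSub Ks, Some i, c, b).
exact: poly_le_widen lk (pub i).
Qed.

Lemma diffusion_kernel u : (0 < n)%N -> (k.-1 <= m <= l)%N -> triangulation TH ->
  (forall c K i, K \in TH -> face K i `<=` bdry (interior (union TH)) ->
     forall x, face K i x -> fb (U c u) (face K i) x = 0) ->
  W u -> diffusion u u = 0 -> forall c K, K \in TH -> wnull K (U c u).
Proof.
move=> n0 kml tT bd Wu d0 c.
have H K : exists r, K \in TH -> (forall x, f0 (U c u) K x = r) /\
    forall i x, face K i x -> fb (U c u) (face K i) x = r.
  have [Ks|Ks] := boolP (K \in TH); last by exists 0.
  have [r hr] := a_el_kernel ic (nd Ks) kml (polyU c Wu Ks) (diffusion_eq0 c Wu d0 Ks).
  by exists r.
have [r hr] := choice H.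
have r0 : forall K, K \in TH -> r K = 0.
  apply: (face_constant_zero n0 tT (ub := fun e => fb (U c u) e)); last exact: bd.
  by move=> K i x Ks; exact: (hr K Ks).2.
move=> K Ks; split=> [x|i x fx]; first by rewrite (hr K Ks).1 r0.
by rewrite (hr K Ks).2 // r0.
Qed.

Variables (E1 : lmodType R) (W1 : set E1) (Y : E1 -> vwf).
Hypothesis sW1 : subspace W1.
Hypothesis combY : forall a w w' K, K \in TH -> wvcomb K a (Y w) (Y w') (Y (a *: w + w')).
Hypothesis polyY : forall w K, W1 w -> K \in TH -> wvpoly K (Y w).

Definition transport (w : E1) (u v : E) : R :=
  \sum_(K <- TH) \sum_(c < N) c_el k K (Y w) (U c u) (f0 (U c v) K).
Definition convection w u v := 2^-1 * transport w u v - 2^-1 * transport w v u.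

Lemma transport_linear_w u v : W u -> W v -> linear_on W1 (fun w => transport w u v).
Proof.
move=> Wu Wv; apply: linear_on_bigsum => K Ks; apply: linear_on_bigsum => c _ a w w' Ww Ww'.
apply: (c_el_linear_w ic (nd Ks) (polyU c Wu Ks) (polyY Ww Ks) (polyY Ww' Ks)).
- by apply: polyY => //; exact: sW1.2.
- exact: (polyU c Wv Ks).1.
exact: combY.
Qed.

Lemma transport_linear_u w v : W1 w -> W v -> linear_on W (fun u => transport w u v).
Proof.
move=> Ww Wv; apply: linear_on_bigsum => K Ks; apply: linear_on_bigsum => c _ a u u' Wu Wu'.
apply: (c_el_linear_s ic (nd Ks) (polyU c Wu Ks) (polyU c Wu' Ks)) => //.
- by apply: polyU => //; exact: sW.2.
- exact: polyY.
exact: (polyU c Wv Ks).1.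
Qed.

Lemma transport_linear_v w u : W1 w -> W u -> linear_on W (transport w u).
Proof.
move=> Ww Wu; apply: linear_on_bigsum => K Ks; apply: linear_on_bigsum => c _ a v v' Wv Wv'.
apply: (c_el_linear_phi ic (nd Ks) (polyU c Wu Ks) (polyY Ww Ks)).
- exact: (polyU c Wv Ks).1.
- exact: (polyU c Wv' Ks).1.
- by apply: (polyU c _ Ks).1; exact: sW.2.
exact: (combU c a v v' K).1.
Qed.

Lemma convection_linear_w u v : W u -> W v -> linear_on W1 (fun w => convection w u v).
Proof. by move=> Wu Wv; apply: linear_on_sub; apply: linear_on_scale; exact: transport_linear_w. Qed.

Lemma convection_linear_u w v : W1 w -> W v -> linear_on W (fun u => convection w u v).
Proof.
move=> Ww Wv; apply: linear_on_sub; apply: linear_on_scale.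
  exact: transport_linear_u.
exact: transport_linear_v.
Qed.

Lemma convection_linear_v w u : W1 w -> W u -> linear_on W (convection w u).
Proof.
move=> Ww Wu; apply: linear_on_sub; apply: linear_on_scale.
  exact: transport_linear_v.
exact: transport_linear_u.
Qed.

Lemma convection_skew w u : convection w u u = 0.
Proof. exact: subrr. Qed.

(** The null function occurs once as a plain factor and once inside the weak divergence, where the
    defining identity expresses it by its values on the element and its faces. *)
Lemma convection_null w u v : W1 w -> W u -> W v -> (forall c K, K \in TH -> wnull K (U c v)) ->
  convection w u v = 0.
Proof.
move=> Ww Wu Wv H; rewrite /convection /transport big_seq_cond.
rewrite big1 => [|K]; last first.
  by rewrite andbT => Ks; rewrite big1 // => c _; apply: (c_el_null_phi ic k (nd Ks)); exact: (H c K Ks).1.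
rewrite mulr0 sub0r big_seq_cond big1 ?mulr0 ?oppr0 // => K; rewrite andbT => Ks.
rewrite big1 // => c _.
apply: (c_el_null ic (nd Ks) (polyU c Wv Ks) (polyY Ww Ks)); last exact: H.
exact: (polyU c Wu Ks).1.
Qed.
End MeshForms.

(** * The reduced problem *)

Section ReducedProblem.
Context {R : realType} {n : nat}.
Hypothesis n0 : (0 < n)%N.
Hypothesis ic : integral_calculus (R := R) n.
Local Notation pt := 'rV[R]_n.+1.
Local Notation simplex := 'M[R]_(n.+2, n.+1).
Local Notation swf := (@wfun R n.+1 R).
Local Notation vwf := (@wfun R n.+1 pt).
Variables (THf THs : seq simplex) (k l m : nat).
Hypothesis tT : triangulation (THf ++ THs).
Hypothesis tF : triangulation THf.
Hypothesis lk : (l <= k)%N.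
Hypothesis kml : (k.-1 <= m <= l)%N.
Variables (Pr kappa Ra : R) (f : pt -> pt) (g : pt -> R).
Hypotheses (hPr : 0 < Pr) (hkappa : 0 < kappa).
Hypothesis hf : forall c : 'I_n.+1, L2 (Omegaf THf) (fun x => f x 0 c).
Hypothesis hg : L2 (Omega THf THs) g.

(** Pairs replace the record [wfun]: products and function spaces carry the module structure that
    [galerkin_solution] works with, and [R^o] is the field as a module over itself. *)
Local Notation E1 := ((simplex -> pt -> pt) * (set pt -> pt -> pt))%type.
Local Notation E2 := ((simplex -> pt -> R^o) * (set pt -> pt -> R^o))%type.
Let toV (p : E1) : vwf := WF p.1 p.2.
Let toS (p : E2) : swf := WF p.1 p.2.
Let U1 (c : 'I_n.+1) (p : E1) : swf := Defs.comp (toV p) c.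
Let U2 (c : 'I_1) (p : E2) : swf := toS p.
Let V0 : set E1 := fun p => in_V0 THf k l (toV p).
Let W1 : set E1 := fun p => in_W THf k l (toV p).
Let W2 : set E2 := fun p => in_S0 THf THs k l (toS p).

Let ndF K : K \in THf -> nondeg K := tF.2.1 K.
Let ndT K : K \in THf ++ THs -> nondeg K := tT.2.1 K.

Let combU1 c a u v K : wcomb K a (U1 c u) (U1 c v) (U1 c (a *: u + v)).
Proof. by split=> [x|i x]; rewrite /= !mxE. Qed.

Let combU2 c a u v K : wcomb K a (U2 c u) (U2 c v) (U2 c (a *: u + v)).
Proof. by []. Qed.

Let combV a u v K : wvcomb K a (toV u) (toV v) (toV (a *: u + v)).
Proof. by []. Qed.

Let polyV c u K : V0 u -> K \in THf -> wpoly k l K (U1 c u).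
Proof. by move=> [p0 [pb _]] Ks; split=> [|i]; [exact: p0|exact: pb]. Qed.

Let polyU1 c u K : W1 u -> K \in THf -> wpoly k l K (U1 c u).
Proof. by move=> [Vu _]; exact: polyV. Qed.

Let polyU2 c u K : W2 u -> K \in THf ++ THs -> wpoly k l K (U2 c u).
Proof. by move=> [p0 [pb _]] Ks; split=> [|i]; [exact: p0|exact: pb]. Qed.

Let polyvV w K : V0 w -> K \in THf -> wvpoly K (toV w).
Proof.
move=> [p0 [pb _]] Ks; split=> [|i]; first exact: poly_vec_polyv (p0 K Ks).
exact: poly_vec_polyv (pb K i Ks).
Qed.

Let sV0 : subspace V0.
Proof.
have z0 : poly_vec k (fun=> 0 : pt) /\ poly_vec l (fun=> 0 : pt).
  by split=> c; under eq_fun do rewrite mxE; exact: poly_le0.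
split.
  by split=> [K Ks|]; [exact: z0.1|split=> // K i Ks; exact: z0.2].
move=> a u v [u0 [ub ue]] [v0 [vb ve]]; split=> [K Ks c|]; last split=> [K i Ks c|K i Ks sub x fx].
- have := poly_leD (poly_leZ a (u0 K Ks c)) (v0 K Ks c); congr poly_le.
  by apply/funext => x; rewrite /= !mxE.
- have := poly_leD (poly_leZ a (ub K i Ks c)) (vb K i Ks c); congr poly_le.
  by apply/funext => x; rewrite /= !mxE.
by rewrite ((combV a u v K).2 i) (ue K i Ks sub x fx) (ve K i Ks sub x fx) scaler0 addr0.
Qed.

Let wG_q q K : in_Q0 THf k q -> K \in THf -> polyv (wG k K q).
Proof.
move=> [q0 [qb _]] Ks; apply: poly_vec_polyv; apply: (wgradP ic (ndF Ks) k _ _).1 => [|i].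
  exact: poly_le_polyf (q0 K Ks).
exact: poly_le_polyf (qb K i Ks).
Qed.

Let lb q : in_Q0 THf k q -> linear_on V0 (fun u => b_h k THf (toV u) q).
Proof.
move=> Qq; apply: linear_on_bigsum => K Ks a u v Vu Vv.
have pq := wG_q Qq Ks.
apply: (el_int_comb ic (ndF Ks)).
- by apply: polyf_dotv => //; exact: (polyvV Vu Ks).1.
- by apply: polyf_dotv => //; exact: (polyvV Vv Ks).1.
by move=> x; rewrite -dotv_combr.
Qed.

Let sW1 : subspace W1.
Proof.
split; first by split=> [|q Qq]; [exact: sV0.1|exact: (linear_on0 sV0 (lb Qq))].
move=> a u v [Vu bu] [Vv bv]; split=> [|q Qq]; first exact: sV0.2.
by rewrite (lb Qq) // bu // bv // mulr0 addr0.
Qed.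

Let sW2 : subspace W2.
Proof.
split.
  by split=> [K Ks|]; [exact: poly_le0|split=> // K i Ks; exact: poly_le0].
move=> a u v [u0 [ub ue]] [v0 [vb ve]]; split=> [K Ks|]; last split=> [K i Ks|K i Ks sub x fx].
- by rewrite (funext (combU2 ord0 a u v K).1); exact: (poly_leD (poly_leZ a (u0 K Ks)) (v0 K Ks)).
- rewrite (funext ((combU2 ord0 a u v K).2 i)).
  exact: (poly_leD (poly_leZ a (ub K i Ks)) (vb K i Ks)).
by rewrite ((combU2 ord0 a u v K).2 i) (ue K i Ks sub x fx) (ve K i Ks sub x fx) mulr0 addr0.
Qed.

Let Y2 (w : E1) : vwf := ext0 THf (toV w).

Let combY2 a w w' K : K \in THf ++ THs -> wvcomb K a (Y2 w) (Y2 w') (Y2 (a *: w + w')).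
Proof.
move=> _; split=> [x|i x] /=; first by case: ifP => // _; rewrite scaler0 addr0.
by case: ifP => // _; rewrite scaler0 addr0.
Qed.

(** [ext0] looks a face up as a point set, so a face of a solid element may coincide with one of a
    fluid element [K'] and take its polynomial from there. *)
Let polyY2 w K : W1 w -> K \in THf ++ THs -> wvpoly K (Y2 w).
Proof.
move=> [[p0 [pb _]] _] _; split=> [c|i c] /=.
  have [Ks|_] := boolP (K \in THf); first exact: poly_le_polyf (p0 K Ks c).
  by under eq_fun do rewrite mxE; exact: polyf_cst.
case: asboolP => [[K' [i' [K's ->]]]|_]; first exact: poly_le_polyf (pb K' i' K's c).
by under eq_fun do rewrite mxE; exact: polyf_cst.
Qed.

Let polyY1 w K : W1 w -> K \in THf -> wvpoly K (toV w).
Proof. by move=> [Vw _]; exact: polyvV. Qed.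

Let diff1 := diffusion l m THf U1.
Let diff2 := diffusion l m (THf ++ THs) U2.
Let conv1 := convection k THf U1 toV.
Let conv2 := convection k (THf ++ THs) U2 Y2.
Let D T v := d_h Pr Ra THf (toS T) (toV v).

Let a_hE u v : a_h Pr m l THf (toV u) (toV v) = Pr * diff1 u v.
Proof. by []. Qed.

Let abar_hE u v : abar_h kappa m l (THf ++ THs) (toS u) (toS v) = kappa * diff2 u v.
Proof. by congr (_ * _); apply: eq_bigr => K _; rewrite big_ord1. Qed.

Let c_hE w u v : c_h k THf (toV w) (toV u) (toV v) = conv1 w u v.
Proof. by []. Qed.

Let cbar_hE w u v : cbar_h k THf THs (toV w) (toS u) (toS v) = conv2 w u v.
Proof.
by congr (_ * _ - _ * _); apply: eq_bigr => K _; rewrite big_ord1.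
Qed.

Let memT K : K \in THf -> K \in THf ++ THs.
Proof. by rewrite mem_cat => ->. Qed.

Let polyT T K : W2 T -> K \in THf ++ THs -> polyf (f0 (toS T) K).
Proof. by move=> [p0 _] Ks; exact: poly_le_polyf (p0 K Ks). Qed.

Let polyjv v K : W1 v -> K \in THf -> polyf (fun x => dotv jvec (f0 (toV v) K x)).
Proof.
by move=> Wv Ks; apply: polyf_dotv; [exact: polyv_cst|exact: (polyY1 Wv Ks).1].
Qed.

Let lDT v : W1 v -> linear_on W2 (D ^~ v).
Proof.
move=> Wv; apply: linear_on_scale; apply: linear_on_bigsum => K Ks a T S WT WS.
have pv := polyjv Wv Ks.
apply: (el_int_comb ic (ndF Ks)).
- by apply: polyf_mul => //; exact: polyT WT (memT Ks).
- by apply: polyf_mul => //; exact: polyT WS (memT Ks).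
by move=> x; rewrite (combU2 ord0 a T S K).1 /U2; ring.
Qed.

Let lDv T : W2 T -> linear_on W1 (D T).
Proof.
move=> WT; apply: linear_on_scale; apply: linear_on_bigsum => K Ks a u v Wu Wv.
have pT := polyT WT (memT Ks).
apply: (el_int_comb ic (ndF Ks)).
- by apply: polyf_mul => //; exact: polyjv.
- by apply: polyf_mul => //; exact: polyjv.
by move=> x; rewrite (combV a u v K).1 dotv_combr; ring.
Qed.

(** The datum is square integrable on the interior of the mesh union, which contains the strict hull
    of every element. *)
Let lf : linear_on W1 (fun v => rhs_f THf f (toV v)).
Proof.
apply: linear_on_bigsum => K Ks a u v Wu Wv.
have pU w c : W1 w -> polyf (fun x => f0 (toV w) K x 0 c) by move=> Ww; exact: (polyY1 Ww Ks).1.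
rewrite -(@el_int_L2 _ _ ic K _ _ (fun c x => f x 0 c) (ndF Ks) (@open_interior _ _) hf
  (strict_hull_union tF Ks) a _ _ (fun c => pU u c Wu) (fun c => pU v c Wv)).
congr el_int; apply/funext => x; apply: eq_bigr => c _; congr (_ * _).
by rewrite /= !mxE.
Qed.

Let lg : linear_on W2 (fun s => rhs_g (THf ++ THs) g (toS s)).
Proof.
apply: linear_on_bigsum => K Ks a u v Wu Wv.
have := @el_int_L2 _ _ ic K _ 1 (fun=> g) (ndT Ks) (@open_interior _ _) (fun=> hg)
  (strict_hull_union tT Ks) a _ _ (fun=> polyT Wu Ks) (fun=> polyT Wv Ks).
have E (w : pt -> R) : el_int K (fun x => \sum_(c < 1) g x * w x) = el_int K (fun x => g x * w x).
  by congr el_int; apply/funext => x; rewrite big_ord1.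
by rewrite !E => e; rewrite -e (funext (combU2 ord0 a u v K).1).
Qed.

Lemma reduced_problem_solvable : exists (u : vwf) (T : swf),
    in_W THf k l u /\ in_S0 THf THs k l T /\
    (forall v, in_W THf k l v ->
       A_h Pr k m l THf u u v - d_h Pr Ra THf T v = rhs_f THf f v) /\
    (forall s, in_S0 THf THs k l s ->
       Abar_h kappa k m l THf THs u T s = rhs_g (THf ++ THs) g s).
Proof.
have [N1 [phi1 [lphi1 phi10]]] := diffusion_finite ic m lk ndF combU1 polyU1.
have [N2 [phi2 [lphi2 phi20]]] := diffusion_finite ic m lk ndT combU2 polyU2.
have ker1 v : W1 v -> Pr * diff1 v v = 0 -> forall c K, K \in THf -> wnull K (U1 c v).
  move=> Wv /eqP; rewrite mulf_eq0 (gt_eqF hPr) /= => /eqP dv.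
  apply: (diffusion_kernel ic ndF polyU1 n0 kml tF _ Wv dv) => c K i Ks sub x fx.
  by rewrite -[LHS]/(fb (toV v) (face K i) x 0 c) (Wv.1.2.2 K i Ks sub x fx) mxE.
have ker2 s : W2 s -> kappa * diff2 s s = 0 -> forall c K, K \in THf ++ THs -> wnull K (U2 c s).
  move=> Ws /eqP; rewrite mulf_eq0 (gt_eqF hkappa) /= => /eqP dv.
  apply: (diffusion_kernel ic ndT polyU2 n0 kml tT _ Ws dv) => c K i Ks sub x fx.
  exact: (Ws.2.2 K i Ks sub x fx).
have la1 v : W1 v -> linear_on W1 (fun u => Pr * diff1 u v).
  by move=> Wv; apply: linear_on_scale; exact: (diffusion_linear ic m sW1 ndF combU1 polyU1).
have la2 v : W2 v -> linear_on W2 (fun u => kappa * diff2 u v).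
  by move=> Wv; apply: linear_on_scale; exact: (diffusion_linear ic m sW2 ndT combU2 polyU2).
have sa1 u v : W1 u -> W1 v -> Pr * diff1 u v = Pr * diff1 v u.
  by move=> _ _; rewrite /diff1 diffusion_sym.
have sa2 u v : W2 u -> W2 v -> kappa * diff2 u v = kappa * diff2 v u.
  by move=> _ _; rewrite /diff2 diffusion_sym.
have pa1 u : W1 u -> 0 <= Pr * diff1 u u.
  by move=> _; apply: mulr_ge0 (ltW hPr) _; exact: (diffusion_ge0 ic l m U1 ndF).
have pa2 u : W2 u -> 0 <= kappa * diff2 u u.
  by move=> _; apply: mulr_ge0 (ltW hkappa) _; exact: (diffusion_ge0 ic l m U2 ndT).
have fin1 u : W1 u -> (forall j, phi1 j u = 0) -> Pr * diff1 u u = 0.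
  by move=> Wu h; rewrite /diff1 phi10 ?mulr0.
have fin2 u : W2 u -> (forall j, phi2 j u = 0) -> kappa * diff2 u u = 0.
  by move=> Wu h; rewrite /diff2 phi20 ?mulr0.
have lc1w u v : W1 u -> W1 v -> linear_on W1 (fun w => conv1 w u v).
  exact: (convection_linear_w ic ndF polyU1 sW1 (fun a w w' K _ => combV a w w' K) polyY1).
have lc1u w v : W1 w -> W1 v -> linear_on W1 (fun u => conv1 w u v).
  exact: (convection_linear_u ic sW1 ndF combU1 polyU1 polyY1).
have lc1v w u : W1 w -> W1 u -> linear_on W1 (conv1 w u).
  exact: (convection_linear_v ic sW1 ndF combU1 polyU1 polyY1).
have lc2w u v : W2 u -> W2 v -> linear_on W1 (fun w => conv2 w u v).
  exact: (convection_linear_w ic ndT polyU2 sW1 combY2 polyY2).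
have lc2u w v : W1 w -> W2 v -> linear_on W2 (fun u => conv2 w u v).
  exact: (convection_linear_u ic sW2 ndT combU2 polyU2 polyY2).
have lc2v w u : W1 w -> W2 u -> linear_on W2 (conv2 w u).
  exact: (convection_linear_v ic sW2 ndT combU2 polyU2 polyY2).
have null1 v : W1 v -> Pr * diff1 v v = 0 ->
  [/\ forall w u, W1 w -> W1 u -> conv1 w u v = 0, forall T, W2 T -> D T v = 0 &
      rhs_f THf f (toV v) = 0].
  move=> Wv /(ker1 v Wv) kv.
  have v0 K x : K \in THf -> f0 (toV v) K x = 0.
    move=> Ks; apply/rowP => c; rewrite [RHS]mxE; exact: (kv c K Ks).1.
  split=> [w u Ww Wu|T WT|].
  - exact: (convection_null ic ndF polyU1 polyY1 Ww Wu Wv kv).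
  - rewrite /D /d_h big_seq_cond big1 ?mulr0 // => K; rewrite andbT => Ks.
    apply: (el_int_zero ic (ndF Ks)) => x _.
    by rewrite v0 // [dotv _ 0]dotvE trmx0 mulmx0 [X in _ * X]mxE mulr0.
  rewrite /rhs_f big_seq_cond big1 // => K; rewrite andbT => Ks.
  by apply: (el_int_zero ic (ndF Ks)) => x _; rewrite v0 // dotvE trmx0 mulmx0 mxE.
have null2 s : W2 s -> kappa * diff2 s s = 0 ->
  (forall w T, W1 w -> W2 T -> conv2 w T s = 0) /\ rhs_g (THf ++ THs) g (toS s) = 0.
  move=> Ws /(ker2 s Ws) ks; split=> [w T Ww WT|].
    exact: (convection_null ic ndT polyU2 polyY2 Ww WT Ws ks).
  rewrite /rhs_g big_seq_cond big1 // => K; rewrite andbT => Ks.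
  by apply: (el_int_zero ic (ndT Ks)) => x _; rewrite (ks ord0 K Ks).1 mulr0.
have skew1 w u : W1 w -> W1 u -> conv1 w u u = 0 by move=> _ _; exact: convection_skew.
have skew2 w u : W1 w -> W2 u -> conv2 w u u = 0 by move=> _ _; exact: convection_skew.
have [u [T [Wu WT hu hT]]] := galerkin_solution sW1 sW2 la1 la2 sa1 sa2 pa1 pa2 lphi1 lphi2
  fin1 fin2 lc1w lc1u lc1v lc2w lc2u lc2v lDT lDv lf lg skew1 skew2 null1 null2.
exists (toV u), (toS T); split; first exact: Wu.
split; first exact: WT.
split=> [[v0 vb] Wv|[s0 sb] Ws].
  by have := hu (v0, vb) Wv; rewrite -a_hE -c_hE.
by have := hT (s0, sb) Ws; rewrite -abar_hE -cbar_hE.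
Qed.
End ReducedProblem.

Theorem theorem3p1 (R : realType) (d : nat) (hd : d = 2%N \/ d = 3%N)
  (THf THs : seq 'M[R]_(d.+1, d)) (hmesh : fs_mesh THf THs)
  (k l m : nat) (hk : (1 <= k)%N) (hl : l = k.-1 \/ l = k)
  (hm : (k.-1 <= m <= l)%N)
  (Pr kappa Ra : R) (hPr : 0 < Pr) (hkappa : 0 < kappa) (hRa : 0 < Ra)
  (f : 'rV[R]_d -> 'rV[R]_d)
  (hf : forall c : 'I_d, L2 (Omegaf THf) (fun x => f x 0 c))
  (g : 'rV[R]_d -> R) (hg : L2 (Omega THf THs) g) :
  exists (u : wfun 'rV[R]_d) (T : wfun R),
    in_W THf k l u /\ in_S0 THf THs k l T /\
    (forall v, in_W THf k l v ->
       A_h Pr k m l THf u u v - d_h Pr Ra THf T v = rhs_f THf f v) /\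
    (forall s, in_S0 THf THs k l s ->
       Abar_h kappa k m l THf THs u T s = rhs_g (THf ++ THs) g s).
Proof.
have [tT tF] := hmesh.
have lk : (l <= k)%N by case: hl => ->; rewrite ?leq_pred.
(* [integral_calculus] is indexed by [d - 1]. *)
case: hd => e; move: THf THs {hmesh} f g hf hg tT tF; rewrite {d}e =>
  THf THs f g hf hg tT tF.
- exact: (reduced_problem_solvable _ integral_calculus1 tT tF).
- exact: (reduced_problem_solvable _ integral_calculus2 tT tF).
Qed.
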